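(* Let $(M^{2n+s},f,Q,\xi_i,\eta^i,g)$ be a weak nearly $\mathcal S$-manifold or a weak nearly $\mathcal C$-manifold such that $$[\xi_i,\xi_j]=0\quad\text{and}\quad \eta^k(\nabla_{\xi_i}\xi_j)=0\qquad (1\le i,j,k\le s).$$ Then the distribution $\ker f$ defines a flat totally geodesic foliation (i.e. $\ker f$ is integrable and its leaves are totally geodesic and flat in the induced metric). Moreover, if in addition $$g(\nabla_X\xi_i,\xi_j)=0\quad (X\in\mathfrak X_M,\ 1\le i,j\le s)$$ and $$(\nabla_XQ)Y=0\quad (X,Y\in\mathfrak X_M,\ Y\perp\ker f),$$ then the vector fields $\xi_1,\dots,\xi_s$ are Killing vector fields.
   Context: All objects are smooth; $\mathfrak X_M$ is the set of vector fields on $M$ and $\nabla$ is the Levi-Civita connection of $g$. A weak metric $f$-structure on a manifold $M^{2n+s}$ ($n,s>0$) is a set $(f,Q,\xi_i,\eta^i,g)$ ($1\le i\le s$), where $g$ is a Riemannian metric, $f$ is a $(1,1)$-tensor of rank $2n$, skew-symmetric with respect to $g$, $Q$ is a self-adjoint nonsingular $(1,1)$-tensor, $\xi_i$ are orthonormal vector fields, and $\eta^i$ are dual 1-forms, satisfying $$f^2=-Q+\sum_{i=1}^s\eta^i\otimes\xi_i,\quad \eta^i(\xi_j)=\delta^i_j,\quad Q\xi_i=\xi_i,\quad g(fX,fY)=g(X,QY)-\sum_{i=1}^s\eta^i(X)\eta^i(Y).$$ Consequently $\eta^i=g(\xi_i,\cdot)$ and $\ker f=\mathrm{span}\{\xi_1,\dots,\xi_s\}$.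 Put $\bar\eta=\sum_{i=1}^s\eta^i$ and $\bar\xi=\sum_{i=1}^s\xi_i$. The manifold with such a structure is called a weak nearly $\mathcal S$-manifold if $$(\nabla_Xf)Y+(\nabla_Yf)X=2\,g(fX,fY)\,\bar\xi+\bar\eta(X)f^2Y+\bar\eta(Y)f^2X\quad (X,Y\in\mathfrak X_M),$$ and a weak nearly $\mathcal C$-manifold if $(\nabla_Xf)Y+(\nabla_Yf)X=0$ for all $X,Y\in\mathfrak X_M$. *)

(* Defs.v *)
From HB Require Import structures.
From mathcomp Require Import all_boot all_order all_algebra.
From mathcomp Require Import all_classical all_reals all_analysis.

Set Implicit Arguments.
Unset Strict Implicit.
Unset Printing Implicit Defensive.

Import Order.TTheory GRing.Theory Num.Theory.
Import numFieldNormedType.Exports.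

Local Open Scope classical_set_scope.
Local Open Scope ring_scope.

Section EuclideanSmoothness.
Variables (R : realType) (m : nat).

(* Meant for open [U]: the values of [phi] outside [U] are then irrelevant. *)
Fixpoint Ck_on (k : nat) (U : set 'rV[R]_m) (phi : 'rV[R]_m -> R^o) : Prop :=
  (forall x, U x -> {for x, continuous phi}) /\
  match k with
  | 0%N => True
  | k'.+1 => forall i : 'I_m,
      (forall x, U x -> derivable phi x (delta_mx 0 i)) /\
      Ck_on k' U ('D_(delta_mx 0 i) phi)
  end.

Definition smooth_on (U : set 'rV[R]_m) (phi : 'rV[R]_m -> R^o) : Prop :=
  forall k, Ck_on k U phi.

End EuclideanSmoothness.

Record chart (R : realType) (T : topologicalType) (m : nat) := Chart {
  chart_dom : set T;
  chart_coord : T -> 'rV[R]_m;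
  chart_param : 'rV[R]_m -> T;
  chart_dom_open : open chart_dom;
  chart_coord_open : open (chart_coord @` chart_dom);
  chart_coord_continuous : forall p, chart_dom p -> {for p, continuous chart_coord};
  chart_param_continuous :
    forall x, (chart_coord @` chart_dom) x -> {for x, continuous chart_param};
  chart_coordK : forall p, chart_dom p -> chart_param (chart_coord p) = p }.

Record smooth_manifold (R : realType) (m : nat) := SmoothManifold {
  carrier :> topologicalType;
  atlas : set (chart R carrier m);
  manifold_hausdorff : hausdorff_space carrier;
  manifold_second_countable : @second_countable carrier;
  atlas_cover : forall p : carrier, exists2 c, atlas c & chart_dom c p;
  atlas_compatible : forall c d, atlas c -> atlas d -> forall j : 'I_m,
    smooth_on (chart_coord c @` (chart_dom c `&` chart_dom d))
      (fun x => chart_coord d (chart_param c x) 0 j) }.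

Section TangentVectors.
Variables (R : realType) (m : nat) (M : smooth_manifold R m).

(* Smoothness on some neighbourhood of [p]. *)
Definition smooth_at (p : M) (phi : M -> R) : Prop :=
  forall c, atlas c -> chart_dom c p ->
    exists U : set 'rV[R]_m,
      [/\ open U, U (chart_coord c p), U `<=` chart_coord c @` chart_dom c &
          smooth_on U (phi \o chart_param c)].

Definition smooth_function (phi : M -> R) : Prop :=
  forall p, smooth_at p phi.

Definition operator : Type := (M -> R) -> R^o.

(* Tangent vectors are derivations of the germs at [p] of smooth functions.
   They are represented by operators on all functions, set to 0 on the
   functions that are not smooth near [p], so that equality of tangent vectors
   is equality of operators.  An operator satisfying these axioms takes equal
   values on functions that coincide near [p]. *)
Definition tangent_space (p : M) : set operator :=
  [set v | [/\ forall (a : R) phi psi, smooth_at p phi -> smooth_at p psi ->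
                 v (fun q => a * phi q + psi q) = a * v phi + v psi,
               forall phi psi, smooth_at p phi -> smooth_at p psi ->
                 v (fun q => phi q * psi q) = v phi * psi p + phi p * v psi &
               forall phi, ~ smooth_at p phi -> v phi = 0]].

Definition vector_field (X : M -> operator) : Prop :=
  (forall p, tangent_space p (X p)) /\
  (forall p phi, smooth_at p phi -> smooth_at p (fun q => X q phi)).

Definition lie_bracket (X Y : M -> operator) : M -> operator := fun p phi =>
  if `[< smooth_at p phi >]
  then X p (fun q => Y q phi) - Y p (fun q => X q phi) else 0.

Definition is_one_form (eta : M -> operator -> R) : Prop :=
  (forall p (a : R) u v, tangent_space p u -> tangent_space p v ->
     eta p (a *: u + v) = a * eta p u + eta p v) /\
  (forall X, vector_field X -> smooth_function (fun p => eta p (X p))).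

Definition is_endo_tensor (A : M -> operator -> operator) : Prop :=
  [/\ forall p u, tangent_space p u -> tangent_space p (A p u),
      forall p (a : R) u v, tangent_space p u -> tangent_space p v ->
        A p (a *: u + v) = a *: A p u + A p v &
      forall X, vector_field X -> vector_field (fun p => A p (X p))].

Record is_riemannian_metric (g : M -> operator -> operator -> R) : Prop := {
  metric_linear : forall p (a : R) u v w, tangent_space p u ->
    tangent_space p v -> tangent_space p w ->
    g p (a *: u + v) w = a * g p u w + g p v w;
  metric_sym : forall p u v, tangent_space p u -> tangent_space p v ->
    g p u v = g p v u;
  metric_pos : forall p u, tangent_space p u -> u <> 0 -> 0 < g p u u;
  metric_smooth : forall X Y, vector_field X -> vector_field Y ->
    smooth_function (fun p => g p (X p) (Y p)) }.

(* [nabla p v Y] is the covariant derivative of [Y] along [v] in T_pM. *)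
Definition covariant_derivative : Type :=
  forall p : M, operator -> (M -> operator) -> operator.

Definition cov (nabla : covariant_derivative) (X Y : M -> operator) :
  M -> operator := fun p => nabla p (X p) Y.

Record is_connection (nabla : covariant_derivative) : Prop := {
  conn_tangent : forall p v Y, tangent_space p v -> vector_field Y ->
    tangent_space p (nabla p v Y);
  conn_linear : forall p (a : R) u v Y, tangent_space p u ->
    tangent_space p v -> vector_field Y ->
    nabla p (a *: u + v) Y = a *: nabla p u Y + nabla p v Y;
  conn_add : forall p v Y Z, tangent_space p v -> vector_field Y ->
    vector_field Z ->
    nabla p v (fun q => Y q + Z q) = nabla p v Y + nabla p v Z;
  conn_leibniz : forall p v phi Y, tangent_space p v ->
    smooth_function phi -> vector_field Y ->
    nabla p v (fun q => phi q *: Y q) = v phi *: Y p + phi p *: nabla p v Y;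
  conn_smooth : forall X Y, vector_field X -> vector_field Y ->
    vector_field (cov nabla X Y) }.

Record is_levi_civita (g : M -> operator -> operator -> R)
    (nabla : covariant_derivative) : Prop := {
  lc_connection : is_connection nabla;
  lc_metric : forall p v Y Z, tangent_space p v -> vector_field Y ->
    vector_field Z ->
    v (fun q => g q (Y q) (Z q)) =
      g p (nabla p v Y) (Z p) + g p (Y p) (nabla p v Z);
  lc_torsion_free : forall X Y, vector_field X -> vector_field Y ->
    forall p, cov nabla X Y p - cov nabla Y X p = lie_bracket X Y p }.

(* (nabla_X A) Y for a (1,1)-tensor A. *)
Definition cov_endo (nabla : covariant_derivative)
    (A : M -> operator -> operator) (X Y : M -> operator) : M -> operator :=
  fun p => cov nabla X (fun q => A q (Y q)) p - A p (cov nabla X Y p).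

Definition curvature (nabla : covariant_derivative) (X Y Z : M -> operator) :
    M -> operator :=
  fun p => cov nabla X (cov nabla Y Z) p - cov nabla Y (cov nabla X Z) p
           - cov nabla (lie_bracket X Y) Z p.

(* The quantification over [nabla] is only a way to refer to the Levi-Civita
   connection, which exists and is unique on tangent vectors and vector fields
   when [g] is a Riemannian metric. *)
Definition is_flat (g : M -> operator -> operator -> R) : Prop :=
  forall nabla, is_levi_civita g nabla ->
  forall X Y Z, vector_field X -> vector_field Y -> vector_field Z ->
  forall p, curvature nabla X Y Z p = 0.

Definition lie_derivative_metric (X : M -> operator)
    (g : M -> operator -> operator -> R) (Y Z : M -> operator) : M -> R :=
  fun p => X p (fun q => g q (Y q) (Z q))
           - g p (lie_bracket X Y p) (Z p) - g p (Y p) (lie_bracket X Z p).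

Definition is_killing (g : M -> operator -> operator -> R)
    (X : M -> operator) : Prop :=
  vector_field X /\
  forall Y Z, vector_field Y -> vector_field Z ->
  forall p, lie_derivative_metric X g Y Z p = 0.

Definition ker_distribution (A : M -> operator -> operator) (p : M) : set operator :=
  [set u | tangent_space p u /\ A p u = 0].

End TangentVectors.

Arguments tangent_space {R m M} p.
Arguments smooth_at {R m M} p phi.

Definition has_dimension (R : realType) (V : lmodType R) (D : set V)
    (r : nat) : Prop :=
  exists e : 'I_r -> V,
    D = [set u | exists c : 'rV[R]_r, u = \sum_(i < r) c 0 i *: e i] /\
    (forall c : 'rV[R]_r, \sum_(i < r) c 0 i *: e i = 0 -> c = 0).

Section Submanifolds.
Variables (R : realType) (k m : nat).
Variables (N : smooth_manifold R k) (M : smooth_manifold R m).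

Definition smooth_map (iota : N -> M) : Prop :=
  continuous iota /\
  forall q d, atlas d -> chart_dom d (iota q) -> forall j : 'I_m,
    smooth_at q (fun q' => chart_coord d (iota q') 0 j).

Definition tangent_map (iota : N -> M) (q : N) (v : operator N) :
    operator M :=
  fun phi => if `[< smooth_at (iota q) phi >] then v (phi \o iota) else 0.

Definition immersed_submanifold (iota : N -> M) : Prop :=
  [/\ smooth_map iota, injective iota &
      forall q, set_inj (tangent_space q) (tangent_map iota q)].

Definition integral_manifold (D : M -> set (operator M)) (iota : N -> M) :
    Prop :=
  immersed_submanifold iota /\
  forall q, tangent_map iota q @` tangent_space q = D (iota q).

Definition pullback_metric (g : M -> operator M -> operator M -> R)
    (iota : N -> M) : N -> operator N -> operator N -> R :=
  fun q u v => g (iota q) (tangent_map iota q u) (tangent_map iota q v).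

(* Vanishing of the second fundamental form: its value on a pair of vectors
   tangent to N at q is the normal component of nabla_X Y at iota q, where X
   and Y extend these vectors and are tangent to N along N near q. *)
Definition totally_geodesic (nabla : covariant_derivative M) (iota : N -> M) :
    Prop :=
  forall (q : N) (X Y : M -> operator M), vector_field X -> vector_field Y ->
  (\forall q' \near q,
     (tangent_map iota q' @` tangent_space q') (X (iota q')) /\
     (tangent_map iota q' @` tangent_space q') (Y (iota q'))) ->
  (tangent_map iota q @` tangent_space q) (cov nabla X Y (iota q)).

End Submanifolds.

Definition integrable_distribution (R : realType) (m k : nat) (M : smooth_manifold R m)
    (D : M -> set (operator M)) : Prop :=
  forall p : M, exists (N : smooth_manifold R k) (iota : N -> M),
    integral_manifold D iota /\ exists q, iota q = p.

(* The conditions are imposed on all integral manifolds of D, hence in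
   particular on the leaves, which are the maximal connected ones. *)
Definition flat_totally_geodesic_foliation (R : realType) (m k : nat)
    (M : smooth_manifold R m) (g : M -> operator M -> operator M -> R)
    (nabla : covariant_derivative M) (D : M -> set (operator M)) : Prop :=
  integrable_distribution k D /\
  forall (N : smooth_manifold R k) (iota : N -> M),
    integral_manifold D iota ->
    totally_geodesic nabla iota /\ is_flat (pullback_metric g iota).

Section WeakStructures.
Variables (R : realType) (n s : nat) (M : smooth_manifold R (2 * n + s)).
Variables (f Q : M -> operator M -> operator M).
Variables (xi : 'I_s -> M -> operator M) (eta : 'I_s -> M -> operator M -> R).
Variable g : M -> operator M -> operator M -> R.
Variable nabla : covariant_derivative M.

Record weak_metric_f_structure : Prop := {
  wmf_metric : is_riemannian_metric g;
  wmf_f : is_endo_tensor f;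
  wmf_Q : is_endo_tensor Q;
  wmf_xi : forall i, vector_field (xi i);
  wmf_eta : forall i, is_one_form (eta i);
  wmf_f_rank : forall p, has_dimension (f p @` tangent_space p) (2 * n)%N;
  wmf_f_skew : forall p u v, tangent_space p u -> tangent_space p v ->
    g p (f p u) v = - g p u (f p v);
  wmf_Q_selfadjoint : forall p u v, tangent_space p u -> tangent_space p v ->
    g p (Q p u) v = g p u (Q p v);
  wmf_Q_nonsingular : forall p,
    set_bij (tangent_space p) (tangent_space p) (Q p);
  wmf_xi_orthonormal : forall p i j, g p (xi i p) (xi j p) = (i == j)%:R;
  wmf_f_square : forall p u, tangent_space p u ->
    f p (f p u) = - Q p u + \sum_(i < s) eta i p u *: xi i p;
  wmf_eta_xi : forall p i j, eta i p (xi j p) = (i == j)%:R;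
  wmf_Q_xi : forall p i, Q p (xi i p) = xi i p;
  wmf_compatible : forall p u v, tangent_space p u -> tangent_space p v ->
    g p (f p u) (f p v) = g p u (Q p v) - \sum_(i < s) eta i p u * eta i p v }.

Definition eta_bar (p : M) (u : operator M) : R := \sum_(i < s) eta i p u.

Definition xi_bar (p : M) : operator M := \sum_(i < s) xi i p.

Definition weak_nearly_S : Prop :=
  forall X Y, vector_field X -> vector_field Y -> forall p,
  cov_endo nabla f X Y p + cov_endo nabla f Y X p =
    (2 * g p (f p (X p)) (f p (Y p))) *: xi_bar p
    + eta_bar p (X p) *: f p (f p (Y p)) + eta_bar p (Y p) *: f p (f p (X p)).

Definition weak_nearly_C : Prop :=
  forall X Y, vector_field X -> vector_field Y -> forall p,
  cov_endo nabla f X Y p + cov_endo nabla f Y X p = 0.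

End WeakStructures.

(* Main.v *)
(* In both cases the defining identity reads
     (nabla_X f) Y + (nabla_Y f) X
       = kappa (2 g(fX, fY) xi_bar + eta_bar(X) f^2 Y + eta_bar(Y) f^2 X),
   with kappa = 1 or 0.  On a pair (xi_i, xi_j) the right-hand side vanishes,
   so nabla_{xi_i} xi_j, which is symmetric in i and j as the xi_i commute, is
   in ker f; being orthogonal to ker f as well, it is 0.

   Leaves.  The commuting frame xi_1, ..., xi_s of ker f integrates: if c_u is
   the integral curve of sum_a u_a xi_a from p, then u |-> c_u(1) satisfies
   d/du_b = xi_b, hence parametrizes an integral manifold near p.  A leaf is
   totally geodesic because nabla_{xi_i} xi_j = 0.  It is flat because the xi_i
   restrict to a commuting orthonormal frame of the leaf, which by Koszul's
   argument is parallel for the induced connection.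

   Killing fields.  Put A X = nabla_X xi_i and T = nabla_{xi_i} f.  The identity
   for the pair (xi_i, X) gives T X = f A X + kappa f^2 X, and T is
   skew-symmetric.  Since f^2 = - Q on the orthogonal complement of ker f and Q
   is parallel there, T anticommutes with f, whence
   A f X = - f A X - 2 kappa f^2 X for X orthogonal to ker f.  With the skewness
   of T this says that the symmetric part of A pairs every X to 0 with f Z, for
   Z orthogonal to ker f.  As f is invertible on the orthogonal complement of
   ker f, the symmetric part of A vanishes. *)

Require Import Defs.
From HB Require Import structures.
From mathcomp Require Import all_boot all_order all_algebra.
From mathcomp Require Import all_classical all_reals all_analysis.
From mathcomp Require Import ring lra.

Set Implicit Arguments.
Unset Strict Implicit.
Unset Printing Implicit Defensive.

Import Order.TTheory GRing.Theory Num.Theory.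
Import numFieldNormedType.Exports.

Local Open Scope classical_set_scope.
Local Open Scope ring_scope.

(** Two steps that look immediate shape the proof. Differentiability of u |-> c_u(1) is proved by
    hand: the curve with parameter u + h e_b is compared with c_u(t) + h t xi_b(c_u(t)), and
    commutativity makes the error solve a homogeneous linear equation up to O(h^2), hence be O(h^2).
    Smoothness comes afterwards for free, because the derivative xi_b(c_u(1)) is as regular as
    c_u(1) itself.

    The inverse of f on the orthogonal complement of ker f is never formed. The identities behind
    the Killing property involve covariant derivatives, hence vector fields, so that inverting f
    would demand a smooth preimage of Z. Instead they are applied to Z, f Z, f^2 Z and so on, so
    that the symmetric part of A pairs X to 0 with f^k Z for all k >= 1; as f has finite rank and is
    injective on the complement, Z is at each point a combination of these.

    As tangent vectors are derivations of germs, coordinates enter only through Hadamard's lemma,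
    which is why integrals along segments and their smoothness in the endpoint are needed. *)

(** * Calculus on row vectors *)

Section RowNorm.
Variables (R : realType) (m : nat).
Implicit Types x y z : 'rV[R]_m.

Lemma norm_coord_le x i : `|x 0 i| <= `|x|.
Proof.
rewrite [leRHS]/Num.Def.normr/= mx_normrE.
exact: (le_bigmax _ (fun ij : 'I_1 * 'I_m => `|x ij.1 ij.2|) (0, i)).
Qed.

Lemma norm_le_coord x c : 0 <= c -> (forall i, `|x 0 i| <= c) -> `|x| <= c.
Proof.
move=> c0 xc; rewrite [leLHS]/Num.Def.normr/= mx_normrE.
by apply: bigmax_le => // -[i j] _ /=; rewrite (ord1 i).
Qed.

End RowNorm.

Section Derivatives.
Variable R : realType.

Lemma is_deriveP (V W : normedModType R) (f : V -> W) x v df :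
  is_derive x v f df <->
  (fun h => h^-1 *: (f (h *: v + x) - f x)) @ 0^' --> df.
Proof.
split=> [[fx <-]|fdf]; first exact: fx.
by apply: DeriveDef; [apply/cvg_ex; exists df|exact/cvg_lim].
Qed.

Lemma is_derive_line (V W : normedModType R) (f : V -> W) x v (t : R) df :
  is_derive (x + t *: v) v f df <->
  is_derive t (1 : R) (fun s : R => f (x + s *: v)) df.
Proof.
rewrite !is_deriveP.
suff -> : (fun h => h^-1 *: (f (h *: v + (x + t *: v)) - f (x + t *: v))) =
  (fun h => h^-1 *: (f (x + (h *: (1 : R) + t) *: v) - f (x + t *: v))) by [].
apply/funext => h /=; congr (_ *: (f _ - _)).
by rewrite scalerDl [h *: 1]mulr1 addrCA.
Qed.

Lemma is_derive_continuous (f : R -> R) (x df : R) :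
  is_derive x (1 : R) f df -> {for x, continuous f}.
Proof.
by move=> [fx _]; apply: differentiable_continuous; apply/derivable1_diffP.
Qed.

(** The increment [d] may have either sign, as coordinate steps do; writing the intermediate point
    as [t * d] with [t] in [0, 1] spares the later estimates a case distinction. *)
Lemma MVT_origin (h dh : R -> R) (d : R) :
  (forall t : R, 0 <= t <= 1 -> is_derive (t * d) (1 : R) h (dh (t * d))) ->
  exists2 t, 0 <= t <= 1 & h d - h 0 = d * dh (t * d).
Proof.
move=> hd; have [-> |dn0] := eqVneq d 0.
  by exists 0; rewrite ?lexx ?ler01// subrr mul0r.
have [d0|d0] := leP 0 d.
- have in_le t : t \in `[0, d] -> 0 <= t / d <= 1 /\ t = t / d * d.
    rewrite in_itv /= => /andP[t0 td]; rewrite divfK//; split=> //.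
    have dp : 0 < d by rewrite lt_neqAle eq_sym dn0.
    by rewrite divr_ge0//= ler_pdivrMr// mul1r.
  have [||c cd ->] := @MVT_segment R h dh 0 d d0.
  + by move=> x /subset_itv_oo_cc /in_le [/hd] + e; rewrite -e.
  + apply/continuous_in_subspaceT => t; rewrite inE /= => /in_le [/hd + e].
    by rewrite -e; exact: is_derive_continuous.
  + have [c01 e] := in_le _ cd; exists (c / d) => //.
    by rewrite subr0 mulrC -e.
- have in_le t : t \in `[d, 0] -> 0 <= t / d <= 1 /\ t = t / d * d.
    rewrite in_itv /= => /andP[td t0]; rewrite divfK//; split=> //.
    by rewrite ler_ndivlMr// mul0r t0 ler_ndivrMr// mul1r.
  have [||c cd e] := @MVT_segment R h dh d 0 (ltW d0).
  + by move=> x /subset_itv_oo_cc /in_le [/hd] + e; rewrite -e.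
  + apply/continuous_in_subspaceT => t; rewrite inE /= => /in_le [/hd + e].
    by rewrite -e; exact: is_derive_continuous.
  + have [c01 ec] := in_le _ cd; exists (c / d) => //.
    by rewrite -opprB e -ec; ring.
Qed.

Lemma convex_norm_le (a b t r : R) : `|a| <= r -> `|b| <= r ->
  0 <= t <= 1 -> `|a + t * (b - a)| <= r.
Proof. by rewrite !ler_norml => /andP[? ?] /andP[? ?] /andP[? ?]; nra. Qed.

(* The sup norm makes balls cubes, so one can go from x to y inside a ball by
   changing one coordinate at a time. *)
Lemma partial_MVT m (F : 'rV[R]_m -> R) (dF : 'I_m -> 'rV[R]_m -> R)
    (c : 'rV[R]_m) (r : R) (x y : 'rV[R]_m) :
  `|x - c| <= r -> `|y - c| <= r ->
  (forall z, `|z - c| <= r ->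
     forall i, is_derive z (delta_mx 0 i) F (dF i z)) ->
  exists z : 'I_m -> 'rV[R]_m,
    (forall i, `|z i - x| <= `|y - x| /\ `|z i - c| <= r) /\
    F y - F x = \sum_i (y 0 i - x 0 i) * dF i (z i).
Proof.
move=> xr yr Fd.
pose w (k : nat) : 'rV[R]_m := \row_j (if (j < k)%N then y 0 j else x 0 j).
have w0 : w 0%N = x by apply/rowP => j; rewrite mxE ltn0.
have wm : w m = y by apply/rowP => j; rewrite mxE ltn_ord.
have wS (i : 'I_m) : w i.+1 = w i + (y 0 i - x 0 i) *: delta_mx 0 i.
  apply/rowP => j; rewrite !mxE ltnS leq_eqVlt eqxx /=.
  have [<-|ij] := eqVneq i j.
    by rewrite eqxx ltnn /= mulr1; ring.
  by rewrite (_ : (j == i :> nat) = false) /= ?mulr0 ?addr0 //;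
    apply/negbTE; rewrite eq_sym.
have bnd (c' : 'rV[R]_m) r' (i : 'I_m) (t : R) :
    `|x - c'| <= r' -> `|y - c'| <= r' -> 0 <= t <= 1 ->
    `|w i + (t * (y 0 i - x 0 i)) *: delta_mx 0 i - c'| <= r'.
  move=> xc yc t01; apply: norm_le_coord => [|j]; first exact: le_trans xc.
  have := norm_coord_le (x - c') j; have := norm_coord_le (y - c') j.
  rewrite !mxE eqxx /= => /le_trans/(_ yc) yj /le_trans/(_ xc) xj.
  case: (eqVneq j i) yj xj => [->|_] yj xj; last first.
    by rewrite mulr0 addr0; case: ifP.
  rewrite ltnn mulr1 -(_ : (x 0 i - c' 0 i) + t * (y 0 i - c' 0 i - (x 0 i - c' 0 i)) =
    x 0 i + t * (y 0 i - x 0 i) - c' 0 i); last by ring.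
  exact: convex_norm_le.
have step (i : 'I_m) : exists z, (`|z - x| <= `|y - x| /\ `|z - c| <= r) /\
    F (w i.+1) - F (w i) = (y 0 i - x 0 i) * dF i z.
  have [t t01|t t01 e] := @MVT_origin (fun t : R => F (w i + t *: delta_mx 0 i))
     (fun t : R => dF i (w i + t *: delta_mx 0 i)) (y 0 i - x 0 i).
    by apply: (is_derive_line _ _ _ _ _).1; apply: Fd; exact: bnd.
  exists (w i + (t * (y 0 i - x 0 i)) *: delta_mx 0 i); split.
    by split; apply: bnd; rewrite // subrr normr0.
  by rewrite wS -e scale0r addr0.
have [z hz] := choice step.
exists z; split=> [i|]; first by case: (hz i).
rewrite -[in LHS]wm -[in LHS]w0 -(telescope_sumr (fun k => F (w k))) // big_mkord.
by apply: eq_bigr => i _; case: (hz i).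
Qed.

Lemma partial_derive_le m (F : 'rV[R]_m -> R) (dF : 'I_m -> 'rV[R]_m -> R)
    (c : 'rV[R]_m) (r : R) (x y : 'rV[R]_m) (K : R) :
  `|x - c| <= r -> `|y - c| <= r ->
  (forall z, `|z - c| <= r ->
     forall i, is_derive z (delta_mx 0 i) F (dF i z) /\ `|dF i z| <= K) ->
  `|F y - F x| <= m%:R * K * `|y - x|.
Proof.
move=> xr yr Fd; have [z zr i|z [zx ->]] := @partial_MVT m F dF c r x y xr yr.
  by case: (Fd _ zr i).
apply: le_trans (ler_norm_sum _ _ _) _.
apply: (@le_trans _ _ (\sum_(i < m) K * `|y - x|)).
  apply: ler_sum => i _; rewrite normrM mulrC; apply: ler_pM => //.
    by have [_ /Fd/(_ i) []] := zx i.
  by have := @norm_coord_le R m (y - x) i; rewrite !mxE.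
by rewrite sumr_const card_ord -[X in _ <= X]mulrA mulr_natl lexx.
Qed.

Lemma cvg_line (V W : normedModType R) (f : V -> W) x v :
  derivable f x v -> (fun h : R => f (h *: v + x)) @ 0^' --> f x.
Proof.
move/derivable1P/derivable1_diffP/differentiable_continuous => fx.
have -> : f x = f (0 *: v + x) by rewrite scale0r add0r.
by apply: cvg_trans fx; apply: cvg_app; exact: nbhs_dnbhs.
Qed.

(** No total differential of [F] is assumed, only partial derivatives near [G x] that are continuous
    there. [partial_MVT], on the cube about [G x] whose radius is the size of the increment of [G],
    expresses the increment of [F] by partial derivatives at points squeezed towards [G x]. *)
Lemma is_derive_chain (V : normedModType R) m (G : V -> 'rV[R]_m)
    (F : 'rV[R]_m -> R) (dG : 'I_m -> R) (dF : 'I_m -> 'rV[R]_m -> R) x v :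
  (forall i, is_derive x v (fun y => G y 0 i : R) (dG i)) ->
  (\forall z \near G x, forall i, is_derive z (delta_mx 0 i) F (dF i z)) ->
  (forall i, {for G x, continuous (dF i)}) ->
  is_derive x v (fun y => F (G y)) (\sum_i dG i * dF i (G x)).
Proof.
move=> Gd Fd cF; apply/is_deriveP.
have Gx : (fun h : R => G (h *: v + x)) @ 0^' --> G x.
  by apply: cvg_line; apply/derivable_mxP => i j; rewrite (ord1 i);
    case: (Gd j).
have [r r0 rF] := (nbhs_ballP _ _).1 Fd.
have sel (h : R) : exists z : 'I_m -> 'rV[R]_m,
    `|G x - G (h *: v + x)| < r ->
    (forall i, `|z i - G x| <= `|G (h *: v + x) - G x|) /\
    F (G (h *: v + x)) - F (G x) =
      \sum_i (G (h *: v + x) 0 i - G x 0 i) * dF i (z i).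
  (* The value 0 is a dummy for large increments; only [h] near 0 matters. *)
  have [hr|] := pselect (`|G x - G (h *: v + x)| < r); last by exists (fun=> 0).
  have [||z zx i|z [zx e]] := @partial_MVT m F dF (G x)
      (`|G (h *: v + x) - G x|) (G x) (G (h *: v + x)).
  - by rewrite subrr normr0.
  - by [].
  - apply: rF; rewrite -ball_normE /ball_ /=.
    by rewrite distrC (le_lt_trans zx)// distrC.
  by exists z => _; split=> // i; case: (zx i).
have [z hz] := choice sel.
have near_r : \forall h \near (0 : R)^', `|G x - G (h *: v + x)| < r.
  by move/cvgrPdist_lt : Gx; apply.
apply: (@cvg_trans _ ((fun h : R =>
   \sum_i (h^-1 *: (G (h *: v + x) 0 i - G x 0 i)) * dF i (z h i)) @ 0^')).
  apply: near_eq_cvg; near=> h.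
  have hr : `|G x - G (h *: v + x)| < r by near: h.
  have [_ ->] := hz h hr; rewrite scaler_sumr; apply: eq_bigr => i _.
  by rewrite -scalerAl.
apply: cvg_big => [|i _]; first exact: add_continuous.
apply: cvgM; first exact: (is_deriveP _ _ _ _).1 (Gd i).
apply: (@cvg_comp _ _ _ (fun h => z h i) (dF i) _ (nbhs (G x))); last exact: cF.
apply/cvgrPdist_lt => e e0; near=> h.
have hr : `|G x - G (h *: v + x)| < r by near: h.
rewrite distrC; have [/(_ i)/le_lt_trans + _] := hz h hr.
by apply; rewrite distrC; near: h; move/cvgrPdist_lt : Gx; apply.
Unshelve. all: by end_near. Qed.

End Derivatives.

(** * Smooth functions on open sets of row vectors *)

Section Smooth.
Variable R : realType.

Lemma continuous_rV (T : topologicalType) m (G : T -> 'rV[R]_m) x :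
  (forall i, {for x, continuous (fun y => G y 0 i)}) -> {for x, continuous G}.
Proof.
move=> cG; apply/cvgrPdist_le => e e0; near=> y.
apply: norm_le_coord => [|i]; first exact: ltW.
rewrite !mxE; move: i; near: y; apply: filter_forall => i.
exact: ((cvgrPdist_le _ _).1 (cG i)).
Unshelve. all: by end_near. Qed.

Lemma open_near (T : topologicalType) (U : set T) x :
  open U -> U x -> \forall y \near x, U y.
Proof. by move=> oU Ux; apply: open_nbhs_nbhs. Qed.

Lemma near_eq_continuous (S T : topologicalType) (f g : S -> T) x :
  (\forall y \near x, f y = g y) ->
  {for x, continuous f} -> {for x, continuous g}.
Proof.
move=> fg cf; rewrite /prop_for /continuous_at -(nbhs_singleton fg).
exact: cvg_trans (near_eq_cvg fg) cf.
Qed.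

Lemma near_dist (V : normedModType R) (x : V) r :
  0 < r -> \forall y \near x, `|y - x| < r.
Proof.
by move=> r0; apply/nbhs_normP; exists r => // y; rewrite /ball_ /= distrC.
Qed.

Lemma lipschitz_continuous (V W : normedModType R) (f : V -> W) x r K :
  0 < r -> (forall y, `|y - x| < r -> `|f y - f x| <= K * `|y - x|) ->
  {for x, continuous f}.
Proof.
move=> r0 fK; apply/cvgrPdist_le => e e0.
have K1 : 0 < `|K| + 1 by rewrite ltr_wpDl.
near=> y; rewrite distrC.
have yr : `|y - x| < r by near: y; exact: near_dist.
have ye : `|y - x| < e / (`|K| + 1) by near: y; apply: near_dist; exact: divr_gt0.
apply: le_trans (fK y yr) _.
rewrite ltr_pdivlMr// in ye; apply: le_trans (ltW ye); rewrite mulrC.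
by rewrite ler_wpM2l// (le_trans (ler_norm K))// lerDl.
Unshelve. all: by end_near. Qed.

(** Identifies a derivative whose value is already guessed. It serves twice: for integrals depending
    on a parameter, and for endpoints of integral curves depending on the coefficients of the
    field. *)
Lemma is_derive_quadratic (V : normedModType R) (f : V -> R) x v df r C :
  0 < r -> 0 <= C ->
  (forall h : R, `|h| <= r ->
     `|f (h *: v + x) - f x - h * df| <= `|h| * (C * `|h|)) ->
  is_derive x v f df.
Proof.
move=> r0 C0 fC; apply/is_deriveP/cvgrPdist_le => e e0; near=> h.
have h0 : h != 0 by near: h; exact: nbhs_dnbhs_neq.
have hr : `|h| <= r by near: h; apply: dnbhs0_le.
have he : `|h| <= e / (C + 1).
  by near: h; apply: dnbhs0_le; rewrite divr_gt0// ltr_wpDl.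
rewrite distrC -[X in `|_ - X|](mulKf h0) -mulrBr normrM normfV.
rewrite ler_pdivrMl ?normr_gt0//; apply: le_trans (fC h hr) _.
rewrite ler_wpM2l//; rewrite ler_pdivlMr ?ltr_wpDl// in he.
by apply: le_trans he; rewrite mulrC ler_wpM2l// lerDl.
Unshelve. all: by end_near. Qed.

Variable m : nat.
Implicit Types (U V : set 'rV[R]_m) (phi psi : 'rV[R]_m -> R).

Lemma Ck_onW k U phi : Ck_on k.+1 U phi -> Ck_on k U phi.
Proof.
elim: k phi => [phi [? _]|k IH phi [cphi dphi]]; first by split.
by split=> // i; have [dp Hp] := dphi i; split=> //; exact: IH.
Qed.

Lemma Ck_on_sub k U V phi : V `<=` U -> Ck_on k U phi -> Ck_on k V phi.
Proof.
move=> VU; elim: k phi => [|k IH] phi [cphi dphi]; split=> //.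
- by move=> x /VU; exact: cphi.
- by move=> x /VU; exact: cphi.
- move=> i; have [dp Hp] := dphi i; split; last exact: IH.
  by move=> x /VU; exact: dp.
Qed.

Lemma Ck_on_continuous k U phi x : Ck_on k U phi -> U x ->
  {for x, continuous phi}.
Proof. by case: k => [|k] [cphi _]; exact: cphi. Qed.

Lemma Ck_on_derive k U phi x i : Ck_on k.+1 U phi -> U x ->
  is_derive x (delta_mx 0 i) phi ('D_(delta_mx 0 i) (phi : _ -> R^o) x).
Proof. by case=> _ /(_ i) [dphi _] /dphi; exact: derivableP. Qed.

Lemma eq_Ck_on k U phi psi : open U -> (forall x, U x -> phi x = psi x) ->
  Ck_on k U phi -> Ck_on k U psi.
Proof.
move=> oU; elim: k phi psi => [|k IH] phi psi e [cphi dphi].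
  split=> // x Ux; apply: near_eq_continuous (cphi x Ux).
  by apply: filterS (open_near oU Ux) => y; exact: e.
have nx x : U x -> \forall y \near x, phi y = psi y.
  by move=> Ux; apply: filterS (open_near oU Ux) => y; exact: e.
split=> [x Ux|i]; first exact: near_eq_continuous (nx x Ux) (cphi x Ux).
have [dp Hp] := dphi i; split.
  by move=> x Ux; apply: near_eq_derivable (nx x Ux) (dp x Ux).
by apply: IH Hp => x Ux; apply: near_eq_derive; exact: nx.
Qed.

(** Lets inductions on [k] run on explicit formulas for the partial derivatives. The formulas need
    to be right on [U] only, which is enough because [U] is open. *)
Lemma Ck_on_intro k U phi (dphi : 'I_m -> 'rV[R]_m -> R) : open U ->
  (forall x, U x -> {for x, continuous phi}) ->
  (forall x i, U x -> is_derive x (delta_mx 0 i) phi (dphi i x)) ->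
  (forall i, Ck_on k U (dphi i)) -> Ck_on k.+1 U phi.
Proof.
move=> oU cphi dp Hp; split=> // i; split.
  by move=> x Ux; case: (dp x i Ux).
by apply: eq_Ck_on (Hp i) => // x Ux; have [_ ->] := dp x i Ux.
Qed.

Lemma Ck_on_cst k U (c : R) : open U -> Ck_on k U (fun=> c).
Proof.
move=> oU; elim: k c => [|k IH] c.
  by split=> // x _; exact: cst_continuous.
apply: (@Ck_on_intro _ _ _ (fun _ _ => 0)) => // x *.
exact: cst_continuous.
Qed.

Lemma is_derive_coord x (j i : 'I_m) :
  is_derive x (delta_mx 0 i) (fun y : 'rV[R]_m => y 0 j : R) (j == i)%:R.
Proof.
apply/is_deriveP/(cvg_trans (near_eq_cvg _) (cvg_cst _)); near=> h.
rewrite !mxE eqxx addrK /=.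
have h0 : h != 0 by near: h; exact: nbhs_dnbhs_neq.
by rewrite -[RHS]/(h^-1 * _) mulrA mulVf// mul1r.
Unshelve. all: by end_near. Qed.

Lemma Ck_on_coord k U j : open U -> Ck_on k U (fun y : 'rV[R]_m => y 0 j).
Proof.
move=> oU; have cj (x : 'rV[R]_m) : {for x, continuous (fun y : 'rV[R]_m => y 0 j)}.
  exact: coord_continuous.
case: k => [|k]; first by split.
apply: (@Ck_on_intro _ _ _ (fun i _ => (j == i)%:R)) => // [x i _|i].
  exact: is_derive_coord.
exact: Ck_on_cst.
Qed.

Lemma Ck_onD k U phi psi : open U -> Ck_on k U phi -> Ck_on k U psi ->
  Ck_on k U (fun x => phi x + psi x).
Proof.
move=> oU; elim: k phi psi => [|k IH] phi psi Hphi Hpsi.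
  split=> // x Ux; apply: continuousD; [exact: Ck_on_continuous Hphi Ux|].
  exact: Ck_on_continuous Hpsi Ux.
apply: (@Ck_on_intro _ _ _ (fun i x => 'D_(delta_mx 0 i) (phi : _ -> R^o) x +
   'D_(delta_mx 0 i) (psi : _ -> R^o) x)) => // [x Ux|x i Ux|i].
- apply: continuousD; [exact: Ck_on_continuous Hphi Ux|].
  exact: Ck_on_continuous Hpsi Ux.
- exact: (is_deriveD (Ck_on_derive i Hphi Ux) (Ck_on_derive i Hpsi Ux)).
- by apply: IH; [case: Hphi => _ /(_ i) []|case: Hpsi => _ /(_ i) []].
Qed.

Lemma Ck_onM k U phi psi : open U -> Ck_on k U phi -> Ck_on k U psi ->
  Ck_on k U (fun x => phi x * psi x).
Proof.
move=> oU; elim: k phi psi => [|k IH] phi psi Hphi Hpsi.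
  split=> // x Ux; apply: continuousM; [exact: Ck_on_continuous Hphi Ux|].
  exact: Ck_on_continuous Hpsi Ux.
apply: (@Ck_on_intro _ _ _ (fun i x =>
   phi x * 'D_(delta_mx 0 i) (psi : _ -> R^o) x +
   psi x * 'D_(delta_mx 0 i) (phi : _ -> R^o) x)) => // [x Ux|x i Ux|i].
- apply: continuousM; [exact: Ck_on_continuous Hphi Ux|].
  exact: Ck_on_continuous Hpsi Ux.
- exact: (is_deriveM (Ck_on_derive i Hphi Ux) (Ck_on_derive i Hpsi Ux)).
- apply: Ck_onD => //; apply: IH; try exact: Ck_onW.
    by case: Hpsi => _ /(_ i) [].
  by case: Hphi => _ /(_ i) [].
Qed.

Lemma Ck_on_sum k U (I : Type) (r : seq I) (phi : I -> 'rV[R]_m -> R) :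
  open U -> (forall i, Ck_on k U (phi i)) ->
  Ck_on k U (fun x => \sum_(i <- r) phi i x).
Proof.
move=> oU Hphi; elim: r => [|i r IH].
  by under eq_fun do rewrite big_nil; exact: Ck_on_cst.
by under eq_fun do rewrite big_cons; exact: Ck_onD.
Qed.

Lemma Ck_onV k U phi : open U -> (forall x, U x -> phi x != 0) ->
  Ck_on k U phi -> Ck_on k U (fun x => (phi x)^-1).
Proof.
move=> oU n0; elim: k => [|k IH] Hphi.
  by split=> // x Ux; apply: continuousV; [exact: n0|exact: (Ck_on_continuous Hphi Ux)].
have HV := IH (Ck_onW Hphi).
apply: (@Ck_on_intro _ _ _ (fun i x =>
   -1 * ((phi x)^-1 * ((phi x)^-1 * 'D_(delta_mx 0 i) (phi : _ -> R^o) x)))) => //.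
- by move=> x Ux; apply: continuousV; [exact: n0|exact: (Ck_on_continuous Hphi Ux)].
- move=> x i Ux; have [dp _] := Ck_on_derive i Hphi Ux.
  apply: DeriveDef; first by apply: derivableV => //; exact: n0.
  rewrite deriveV ?n0// [LHS]mulNr mulN1r expr2 invfM.
  by rewrite mulrA.
- move=> i; do ?[apply: Ck_onM => //]; first exact: Ck_on_cst.
  by case: Hphi => _ /(_ i) [].
Qed.

End Smooth.

(** Induction on [k] for all [F] at once: the chain rule produces composites of the partial
    derivatives of [F] with the same [G], to which the induction hypothesis applies. *)
Lemma Ck_on_comp (R : realType) l m k (U : set 'rV[R]_l) (V : set 'rV[R]_m)
    (G : 'rV[R]_l -> 'rV[R]_m) (F : 'rV[R]_m -> R) :
  open U -> open V -> (forall x, U x -> V (G x)) ->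
  (forall i, Ck_on k U (fun x => G x 0 i)) -> Ck_on k V F ->
  Ck_on k U (fun x => F (G x)).
Proof.
move=> oU oV UV; elim: k F => [|k IH] F HG HF.
  split=> // x Ux; apply: (@continuous_comp _ _ _ G F).
    by apply: continuous_rV => i; exact: (Ck_on_continuous (HG i) Ux).
  by apply: (Ck_on_continuous HF); exact: UV.
apply: (@Ck_on_intro _ _ _ _ _ (fun i x =>
   \sum_j 'D_(delta_mx 0 i) (fun x => G x 0 j : R^o) x *
     'D_(delta_mx 0 j) (F : _ -> R^o) (G x))) => //.
- move=> x Ux; apply: (@continuous_comp _ _ _ G F).
    by apply: continuous_rV => i; exact: (Ck_on_continuous (HG i) Ux).
  by apply: (Ck_on_continuous HF); exact: UV.
- move=> x i Ux.
  apply: (@is_derive_chain _ _ _ G F _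
    (fun j => 'D_(delta_mx 0 j) (F : _ -> R^o))) => [j||j].
  + exact: Ck_on_derive Ux.
  + apply: filterS (open_near oV (UV _ Ux)) => z Vz j.
    exact: (Ck_on_derive _ HF).
  + by case: HF => _ /(_ j) [_ HF]; exact: (Ck_on_continuous HF (UV _ Ux)).
- move=> i; apply: Ck_on_sum => // j; apply: Ck_onM => //.
    by case: (HG j) => _ /(_ i) [].
  apply: (IH (fun z => 'D_(delta_mx 0 j) (F : _ -> R^o) z)).
    by move=> j'; exact/Ck_onW/HG.
  by case: HF => _ /(_ j) [].
Qed.

(** * Integration along segments and Hadamard's lemma *)

Section UnitInterval.
Variable R : realType.
Implicit Types (h H : R -> R) (t c C : R).

Definition clamp t : R := Num.max 0 (Num.min t 1).

Lemma clamp_itv t : 0 <= clamp t <= 1.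
Proof. by rewrite /clamp le_max lexx /= ge_max ler01 ge_min lexx orbT. Qed.

Lemma clamp_id t : 0 <= t <= 1 -> clamp t = t.
Proof. by case/andP=> t0 t1; rewrite /clamp min_l// max_r. Qed.

Lemma clamp_continuous : continuous clamp.
Proof.
move=> t; apply: (@continuous_max R R (cst 0) (id \min cst 1)).
  exact: cst_continuous.
apply: (@continuous_min R R id (cst 1)); first exact: cvg_id.
exact: cst_continuous.
Qed.

(* Composing with [clamp] extends [h] continuously beyond both endpoints, where
   the fundamental theorem of calculus then applies. *)
Lemma antiderivative h c : (forall t, 0 <= t <= 1 -> {for t, continuous h}) ->
  exists2 H, H 0 = c & forall t, 0 <= t <= 1 -> is_derive t (1 : R) H (h t).
Proof.
move=> ch; pose k := h \o clamp.
have ck : continuous k.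
  move=> t; apply: continuous_comp; first exact: clamp_continuous.
  exact/ch/clamp_itv.
pose P (x : R) := \int[@lebesgue_measure R]_(t in [set` `[-1, x]]) k t.
exists (fun x => P x - P 0 + c) => [|t t01]; first by rewrite subrr add0r.
have [Pd Pe] : derivable P t 1 /\ (P^`())%classic t = k t.
  apply: (@continuous_FTC1_closed R k (-1) t (t + 1)); last exact: ck.
  - by rewrite ltrDl.
  - apply: continuous_compact_integrable; first exact: segment_compact.
    exact: continuous_subspaceT.
  - by case/andP: t01; lra.
have hk : is_derive t 1 P (h t).
  by apply: DeriveDef => //; rewrite -derive1E Pe /k /= clamp_id.
have -> : (fun x => P x - P 0 + c) = P + cst (c - P 0).
  by apply/funext => x; rewrite -[RHS]/(P x + (c - P 0)) -addrA [- _ + _]addrC.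
by rewrite -[h t]addr0; exact: is_deriveD.
Qed.

Lemma unit_derive_le H h C t :
  (forall t, 0 <= t <= 1 -> is_derive t (1 : R) H (h t) /\ `|h t| <= C) ->
  0 <= t <= 1 -> `|H t - H 0| <= C.
Proof.
move=> Hh /andP[t0 t1].
have in01 (s : R) : s \in `[0, t] -> 0 <= s <= 1.
  by rewrite in_itv /= => /andP[-> st]; exact: le_trans st t1.
have [||s /in01 s01 ->] := @MVT_segment R H h 0 t t0.
- by move=> s /subset_itv_oo_cc /in01 /Hh [].
- apply/continuous_in_subspaceT => s; rewrite inE /= => /in01 /Hh [sd _].
  exact: is_derive_continuous sd.
- rewrite subr0 normrM (ger0_norm t0); have [_ hC] := Hh _ s01.
  by rewrite (le_trans _ hC)// ler_piMr.
Qed.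

(* The increment over [0, 1] of an antiderivative, 0 if there is none. *)
Definition unit_integral h : R :=
  xget 0 [set c | exists H, [/\ H 0 = 0,
    forall t, 0 <= t <= 1 -> is_derive t (1 : R) H (h t) & H 1 = c]].

Lemma unit_integralP h : (forall t, 0 <= t <= 1 -> {for t, continuous h}) ->
  exists H, [/\ H 0 = 0,
    forall t, 0 <= t <= 1 -> is_derive t (1 : R) H (h t) &
    H 1 = unit_integral h].
Proof.
move=> /(@antiderivative h 0)[H H0 Hd].
apply: (@xgetPex _ 0 [set c | exists H, [/\ H 0 = 0,
    forall t, 0 <= t <= 1 -> is_derive t (1 : R) H (h t) & H 1 = c]]).
by exists (H 1), H.
Qed.

(** One estimate for two uses: continuity in a parameter, with [h3] and [c] zero, and
    differentiability, with [c] the increment and [h3] the candidate derivative. *)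
Lemma unit_integral_dist h1 h2 h3 c C :
  (forall t, 0 <= t <= 1 -> {for t, continuous h1}) ->
  (forall t, 0 <= t <= 1 -> {for t, continuous h2}) ->
  (forall t, 0 <= t <= 1 -> {for t, continuous h3}) ->
  (forall t, 0 <= t <= 1 -> `|h1 t - h2 t - c * h3 t| <= C) ->
  `|unit_integral h1 - unit_integral h2 - c * unit_integral h3| <= C.
Proof.
move=> /unit_integralP[H1 [H10 Hd1 <-]] /unit_integralP[H2 [H20 Hd2 <-]].
move=> /unit_integralP[H3 [H30 Hd3 <-]] hC.
have := @unit_derive_le (H1 - H2 - c *: H3) (fun t => h1 t - h2 t - c *: h3 t) C 1.
rewrite -![(_ - _ : _ -> _) _]/(_ - _) -![(_ *: _ : _ -> _) _]/(_ * _).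
rewrite H10 H20 H30 mulr0 !subr0; apply; last by rewrite ler01 lexx.
move=> t t01; split; last exact: hC.
have ? := Hd1 _ t01; have ? := Hd2 _ t01; have ? := Hd3 _ t01.
by apply: is_deriveB.
Qed.

Lemma unit_integral_cst c : unit_integral (fun=> c) = c.
Proof.
have [|H [H0 Hd <-]] := @unit_integralP (fun=> c).
  by move=> *; exact: cst_continuous.
have := @unit_derive_le (H - c *: id) (fun=> c - c *: 1) 0 1.
rewrite -![(_ - _ : _ -> _) _]/(_ - _) -![(_ *: _ : _ -> _) _]/(_ * _) H0.
rewrite mulr1 mulr0 !subr0 => h.
apply/eqP; rewrite -subr_eq0 -normr_le0; apply: h; last by rewrite ler01 lexx.
move=> t t01; split; last by rewrite [c *: 1]mulr1 subrr normr0.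
by have ? := Hd _ t01; apply: is_deriveB.
Qed.

End UnitInterval.

Section Hadamard.
Variables (R : realType) (m : nat).
Implicit Types (U : set 'rV[R]_m) (phi psi : 'rV[R]_m -> R) (x y : 'rV[R]_m).

Lemma norm_delta (c : R) i : `|c *: delta_mx 0 i : 'rV[R]_m| <= `|c|.
Proof.
apply: norm_le_coord => // j; rewrite !mxE eqxx /=.
by case: (j == i); rewrite ?mulr1 ?mulr0 ?normr0.
Qed.

Lemma bounded_on_closed_ball (I : finType) (phi : I -> 'rV[R]_m -> R) x0 r :
  (forall i x, `|x - x0| <= r -> {for x, continuous (phi i)}) ->
  exists2 K, 0 <= K & forall i x, `|x - x0| <= r -> `|phi i x| <= K.
Proof.
move=> cphi; pose A := [set x : 'rV[R]_m | `|x - x0| <= r].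
have cA : compact A.
  apply: bounded_closed_compact.
    exists (r + `|x0|); split; first exact: num_real.
    move=> M rM x /= xA; apply: le_trans (ltW rM).
    by rewrite -[x](subrK x0) (le_trans (ler_normD _ _))// lerD2r.
  rewrite (_ : A = (fun x => `|x - x0|) @^-1` [set t | t <= r])//.
  apply: closed_comp => [x _|]; last exact: closed_le.
  apply: (@continuous_comp _ _ _ (fun x => x - x0) (fun x => `|x|)).
    by apply: continuousB; [exact: cvg_id|exact: cst_continuous].
  exact: norm_continuous.
have bnd i : exists K, forall x, A x -> `|phi i x| <= K.
  have /compact_bounded[M [_ MP]] : compact (phi i @` A).
    apply: continuous_compact => //; apply: continuous_in_subspaceT => x.
    by rewrite inE; exact: cphi.
  exists (M + 1) => x Ax; apply: (MP (M + 1)); first by rewrite ltrDl.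
  by exists x.
have [K KP] := choice bnd.
exists (\sum_i `|K i|) => [|i x xr]; first by apply: sumr_ge0.
apply: le_trans (KP i x xr) _; apply: le_trans (ler_norm _) _.
by rewrite (bigD1 i)//= lerDl sumr_ge0.
Qed.

Lemma smooth_on_derive U phi i : smooth_on U phi ->
  smooth_on U ('D_(delta_mx 0 i) (phi : _ -> R^o)).
Proof. by move=> sphi k; case: (sphi k.+1) => _ /(_ i) []. Qed.

Lemma smooth_on_is_derive U phi i x : smooth_on U phi -> U x ->
  is_derive x (delta_mx 0 i) phi ('D_(delta_mx 0 i) (phi : _ -> R^o) x).
Proof. by move=> /(_ 1%N) sphi Ux; exact: (Ck_on_derive i sphi Ux). Qed.

Lemma smooth_on_continuous U phi x : smooth_on U phi -> U x ->
  {for x, continuous phi}.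
Proof. by move=> /(_ 0%N) sphi Ux; exact: (Ck_on_continuous sphi Ux). Qed.

Variables (U : set 'rV[R]_m) (x0 : 'rV[R]_m) (r : R).
Hypotheses (oU : open U) (r0 : 0 < r).
Hypothesis xU : forall x, `|x - x0| <= r -> U x.

(** The weight [t ^+ k] closes the family under differentiation: each partial derivative in [x]
    brings out one factor [t] and so turns [k] into [k.+1]. *)
Definition radial k psi x : R :=
  unit_integral (fun t : R => t ^+ k * psi (x0 + t *: (x - x0))).

Lemma segment_ball x t : `|x - x0| <= r -> 0 <= t <= 1 ->
  `|x0 + t *: (x - x0) - x0| <= r.
Proof.
move=> xr /andP[t0 t1]; rewrite addrAC subrr add0r normrZ ger0_norm//.
by apply: le_trans xr; rewrite ler_piMl.
Qed.

Lemma radial_integrand k psi x : smooth_on U psi -> `|x - x0| <= r ->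
  forall t : R, 0 <= t <= 1 ->
  {for t, continuous (fun t : R => t ^+ k * psi (x0 + t *: (x - x0)))}.
Proof.
move=> spsi xr t t01; apply: continuousM; first exact: exprn_continuous.
apply: (@continuous_comp _ _ _ (fun t : R => x0 + t *: (x - x0)) psi).
  apply: continuousD; first exact: cst_continuous.
  exact: scalel_continuous.
by apply: (smooth_on_continuous spsi); apply/xU/segment_ball.
Qed.

Lemma smooth_lipschitz psi : smooth_on U psi ->
  exists2 K, 0 <= K & forall x y, `|x - x0| <= r -> `|y - x0| <= r ->
    `|psi y - psi x| <= K * `|y - x|.
Proof.
move=> spsi; have [|K K0 HK] := @bounded_on_closed_ball _
    (fun i => 'D_(delta_mx 0 i) (psi : _ -> R^o)) x0 r.
  move=> i y yr; apply: (smooth_on_continuous (smooth_on_derive i spsi)).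
  exact: xU.
exists (m%:R * K); first by rewrite mulr_ge0.
move=> x y xr yr; apply: (@partial_derive_le _ _ _
    (fun i => 'D_(delta_mx 0 i) (psi : _ -> R^o)) x0 r) => // z zr i.
by split; [apply: (smooth_on_is_derive i spsi); exact: xU|exact: HK].
Qed.

Lemma radial_continuous k psi x : smooth_on U psi -> `|x - x0| < r ->
  {for x, continuous (radial k psi)}.
Proof.
move=> spsi xr; have [K K0 HK] := smooth_lipschitz spsi.
apply: (@lipschitz_continuous _ _ _ _ _ (r - `|x - x0|) K) => [|y yx].
  by rewrite subr_gt0.
have yr : `|y - x0| <= r.
  rewrite -(subrK x y) -addrA (le_trans (ler_normD _ _))//.
  by rewrite -lerBrDr ltW.
have := @unit_integral_dist R _ _ (fun=> 0) 0 (K * `|y - x|)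
  (radial_integrand (k := k) spsi yr) (radial_integrand (k := k) spsi (ltW xr)).
rewrite [0 * unit_integral _]mul0r subr0; apply; first by move=> *; exact: cst_continuous.
move=> t t01; rewrite mul0r subr0 -mulrBr normrM; have /andP[t0 t1] := t01.
rewrite -[leRHS]mul1r; apply: ler_pM => //.
  by rewrite normrX exprn_ile1// ger0_norm.
apply: le_trans (HK _ _ _ _) _; [exact: segment_ball (ltW xr) t01|exact: segment_ball|].
rewrite ler_wpM2l// opprD addrACA subrr add0r -scalerBr opprB addrA subrK.
by rewrite normrZ ger0_norm// ler_piMl.
Qed.

(** Differentiation under the integral sign. For each [t] the mean value theorem reduces the
    remainder to a variation of the partial derivative [dpsi], whose Lipschitz bound is uniform in
    [t]; integrating keeps the remainder quadratic. *)
Lemma radial_derive k psi x i : smooth_on U psi -> `|x - x0| < r ->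
  is_derive x (delta_mx 0 i) (radial k psi)
    (radial k.+1 ('D_(delta_mx 0 i) (psi : _ -> R^o)) x).
Proof.
move=> spsi xr; set dpsi := 'D_(delta_mx 0 i) (psi : _ -> R^o).
have sdpsi : smooth_on U dpsi by exact: smooth_on_derive.
have [K K0 HK] := smooth_lipschitz sdpsi.
have quad (h : R) : `|h| <= r - `|x - x0| ->
    `|radial k psi (h *: delta_mx 0 i + x) - radial k psi x
      - h * radial k.+1 dpsi x| <= `|h| * (K * `|h|).
  move=> hr.
  have near_x (c : R) t : 0 <= t <= 1 -> `|c| <= `|h| ->
      `|x0 + t *: (x - x0) + c *: delta_mx 0 i - x0| <= r.
    move=> /andP[t0 t1] ch; rewrite addrAC [x0 + _]addrC addrK.
    apply: le_trans (ler_normD _ _) _.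
    have hr' : `|x - x0| + `|h| <= r by rewrite -lerBrDl.
    apply: le_trans hr'; apply: lerD; last by rewrite (le_trans (norm_delta _ _)).
    by rewrite normrZ ger0_norm// ler_piMl.
  have yr : `|h *: delta_mx 0 i + x - x0| <= r.
    have := near_x h 1; rewrite scale1r ler01 lexx => /(_ isT (lexx _)).
    by rewrite [x0 + _]addrC subrK [x + _]addrC.
  apply: unit_integral_dist.
  - exact: radial_integrand yr.
  - exact: radial_integrand (ltW xr).
  - exact: radial_integrand (ltW xr).
  move=> t t01; have /andP[t0 t1] := t01.
  pose y := x0 + t *: (x - x0).
  have -> : x0 + t *: (h *: delta_mx 0 i + x - x0) = y + (t * h) *: delta_mx 0 i.
    by rewrite [h *: _ + x]addrC [x + _ - _]addrAC scalerDr scalerA addrA.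
  have th (u : R) : 0 <= u <= 1 -> `|u * (t * h)| <= `|h|.
    move=> /andP[u0 u1]; rewrite mulrA normrM ger0_norm ?mulr_ge0//.
    by rewrite ler_piMl// mulr_ile1.
  have [u u01|u u01] := @MVT_origin R (fun u : R => psi (y + u *: delta_mx 0 i))
     (fun u : R => dpsi (y + u *: delta_mx 0 i)) (t * h).
    apply: (is_derive_line _ _ _ _ _).1; apply: (smooth_on_is_derive i spsi).
    by apply: xU; apply: near_x => //; exact: th.
  rewrite scale0r addr0 exprSr -/y => e.
  rewrite (_ : _ - _ = t ^+ k * (t * h) *
     (dpsi (y + (u * (t * h)) *: delta_mx 0 i) - dpsi y)); last first.
    by rewrite -mulrBr e; ring.
  rewrite normrM; apply: ler_pM => //.
  - rewrite mulrA normrM -[leRHS]mul1r ler_wpM2r// normrM normrX ger0_norm//.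
    by rewrite mulr_ile1// ?exprn_ge0// exprn_ile1.
  - apply: le_trans (HK _ _ _ _) _.
    + exact: segment_ball (ltW xr) t01.
    + by apply: near_x => //; exact: th.
    + rewrite ler_wpM2l// [_ + _ *: _]addrC addrK.
      by apply: le_trans (norm_delta _ _) _; exact: th.
apply: (is_derive_quadratic _ K0 quad); by rewrite subr_gt0.
Qed.

Lemma radial_smooth k psi : smooth_on U psi ->
  smooth_on (ball x0 r) (radial k psi).
Proof.
have inb x : ball x0 r x -> `|x - x0| < r.
  by rewrite -ball_normE /ball_ /= distrC.
move=> + l; elim: l k psi => [|l IH] k psi spsi.
  by split=> // x /inb; exact: radial_continuous.
apply: (@Ck_on_intro _ _ _ _ _
  (fun i => radial k.+1 ('D_(delta_mx 0 i) (psi : _ -> R^o)))).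
- exact: ball_open.
- by move=> x /inb; exact: radial_continuous.
- by move=> x i /inb; exact: radial_derive.
- by move=> i; apply: IH; exact: smooth_on_derive.
Qed.

Lemma radial0_center psi : radial 0 psi x0 = psi x0.
Proof.
rewrite /radial subrr -[RHS]unit_integral_cst; congr unit_integral.
by apply/funext => t; rewrite expr0 mul1r scaler0 addr0.
Qed.

(** The fundamental theorem of calculus along the segment from [x0] to [x]: subtracting from [phi]
    on the segment the primitives that define the integrals leaves a function [F] with zero
    derivative, whose values at 0 and 1 are then compared. *)
Lemma radial_expansion phi x : smooth_on U phi -> `|x - x0| <= r ->
  phi x = phi x0 + \sum_i (x 0 i - x0 0 i) *
     radial 0 ('D_(delta_mx 0 i) (phi : _ -> R^o)) x.
Proof.
move=> sphi xr; set dphi := fun i => 'D_(delta_mx 0 i) (phi : _ -> R^o).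
have sd i : smooth_on U (dphi i) by exact: smooth_on_derive.
have Hex i := unit_integralP (radial_integrand (k := 0) (sd i) xr).
have [H HP] := choice Hex.
pose y (t : R) := x0 + t *: (x - x0).
pose F : R -> R := (phi \o y) - \sum_i ((x 0 i - x0 0 i) *: H i).
have Fd (t : R) : 0 <= t <= 1 -> is_derive t (1 : R) F 0.
  move=> t01; have [H0 Hd He] := all_and3 HP.
  have -> : 0 = \sum_i (x 0 i - x0 0 i) * dphi i (y t)
      - \sum_i (x 0 i - x0 0 i) *: (t ^+ 0 * dphi i (x0 + t *: (x - x0))).
    by rewrite -sumrB big1// => i _; rewrite expr0 mul1r subrr.
  apply: is_deriveB; last first.
    by apply: is_derive_sum => i; have ? := Hd i _ t01; exact: is_deriveZ.
  apply: (@is_derive_chain _ _ _ y phi (fun i => x 0 i - x0 0 i) dphi).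
  - move=> i; have -> : (fun t => y t 0 i) = cst (x0 0 i) + (x 0 i - x0 0 i) *: id.
      by apply/funext => u; rewrite !mxE /GRing.add /GRing.scale /= mulrC.
    rewrite -[X in is_derive _ _ _ X]add0r; apply: is_deriveD.
    by rewrite -[X in is_derive _ _ _ X]mulr1; apply: is_deriveZ.
  - have Uy : U (y t) by apply/xU/segment_ball.
    apply: filterS (open_near oU Uy) => z Uz i.
    exact: smooth_on_is_derive sphi Uz.
  - by move=> i; apply: (smooth_on_continuous (sd i)); apply/xU/segment_ball.
have F10 : F 1 = F 0.
  apply/eqP; rewrite -subr_eq0 -normr_le0.
  apply: (@unit_derive_le _ F (fun=> 0)); last by rewrite ler01 lexx.
  by move=> t t01; split; [exact: Fd|rewrite normr0].
have FE (t : R) : F t = phi (y t) - \sum_i (x 0 i - x0 0 i) * H i t.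
  by rewrite /F -[LHS]/(phi (y t) - (\sum_i (x 0 i - x0 0 i) *: H i) t) fct_sumE.
have y1 : y 1 = x by rewrite /y scale1r addrC subrK.
have y0 : y 0 = x0 by rewrite /y scale0r addr0.
move: F10; rewrite !FE y0 y1.
have -> : \sum_i (x 0 i - x0 0 i) * H i 0 = 0.
  by apply: big1 => i _; have [-> _ _] := HP i; rewrite mulr0.
rewrite subr0 => <-.
rewrite -[LHS](subrK (\sum_i (x 0 i - x0 0 i) * H i 1)); congr (_ + _).
by apply: eq_bigr => i _; have [_ _ ->] := HP i.
Qed.

End Hadamard.

Lemma hadamard (R : realType) m (U : set 'rV[R]_m) (x0 : 'rV[R]_m)
    (phi : 'rV[R]_m -> R) : open U -> U x0 -> smooth_on U phi ->
  exists (r : R) (h : 'I_m -> 'rV[R]_m -> R), [/\ 0 < r, ball x0 r `<=` U,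
    forall i, smooth_on (ball x0 r) (h i),
    forall i, h i x0 = 'D_(delta_mx 0 i) (phi : _ -> R^o) x0 &
    forall x, ball x0 r x ->
      phi x = phi x0 + \sum_i (x 0 i - x0 0 i) * h i x].
Proof.
move=> oU Ux0 sphi.
have [e e0 eU] := (nbhs_ballP _ _).1 (open_near oU Ux0).
(* Halving the radius keeps the closed ball inside [U], where compactness bounds the derivatives. *)
have r0 : 0 < e / 2 by rewrite divr_gt0.
have xU x : `|x - x0| <= e / 2 -> U x.
  move=> xr; apply: eU; rewrite -ball_normE /ball_ /= distrC.
  by apply: le_lt_trans xr _; rewrite ltr_pdivrMr// ltr_pMr// ltr1n.
have bxU x : ball x0 (e / 2) x -> `|x - x0| <= e / 2.
  by rewrite -ball_normE /ball_ /= distrC => /ltW.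
exists (e / 2), (fun i => radial x0 0 ('D_(delta_mx 0 i) (phi : _ -> R^o))).
split=> //.
- by move=> x /bxU; exact: xU.
- by move=> i; apply: (@radial_smooth _ _ U) => //; exact: smooth_on_derive.
- by move=> i; exact: radial0_center.
- by move=> x /bxU xr; apply: (@radial_expansion _ _ U x0 (e / 2)).
Qed.

(** * Flows of commuting vector fields *)

Section Dyadic.
Variable R : realType.
Implicit Types (C a e : R).

Lemma dyadic_small C e : 0 < e -> exists k, C / 2 ^+ k < e.
Proof.
move=> e0; exists (Num.bound (`|C| / e)).
have := archi_boundP (divr_ge0 (normr_ge0 C) (ltW e0)).
set n := Num.bound _ => hn.
have n2 : n%:R < 2 ^+ n :> R by rewrite -natrX ltr_nat ltn_expl.
rewrite ltr_pdivrMr ?exprn_gt0//; apply: le_lt_trans (ler_norm C) _.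
by rewrite mulrC -ltr_pdivrMr//; exact: lt_trans n2.
Qed.

Lemma dyadic_le0 C a : (forall k, a <= C / 2 ^+ k) -> a <= 0.
Proof.
move=> aC; rewrite leNgt; apply/negP => a0; have [k] := dyadic_small C a0.
by rewrite ltNge aC.
Qed.

(** The intervals of radius [2 * C / 2 ^+ k] about [u k] are nested, since these radii decrease by
    exactly [C / 2 ^+ k] at each step. The supremum of their lower ends lies in all of them. *)
Lemma dyadic_limit (u : nat -> R) C :
  (forall k, `|u k.+1 - u k| <= C / 2 ^+ k) ->
  exists l, forall k, `|u k - l| <= 2 * C / 2 ^+ k.
Proof.
move=> uC.
have C0 : 0 <= C by have := uC 0; rewrite expr0 divr1; exact: le_trans.
pose q k : R := 2 * C / 2 ^+ k.
have q0 k : 0 <= q k by rewrite divr_ge0 ?mulr_ge0 ?exprn_ge0.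
have qS k : q k - q k.+1 = C / 2 ^+ k.
  have k2 : (2 : R) ^+ k != 0 by rewrite expf_neq0.
  by rewrite /q exprS; field.
have lowS k : u k - q k <= u k.+1 - q k.+1.
  by have := uC k; rewrite -qS ler_norml => /andP[? _]; lra.
have upS k : u k.+1 + q k.+1 <= u k + q k.
  by have := uC k; rewrite -qS ler_norml => /andP[_ ?]; lra.
have lowD k j : u k - q k <= u (k + j)%N - q (k + j)%N.
  by elim: j => [|j IH]; rewrite ?addn0// addnS (le_trans IH).
have upD k j : u (k + j)%N + q (k + j)%N <= u k + q k.
  by elim: j => [|j IH]; rewrite ?addn0// addnS (le_trans _ IH).
have lowup j k : u j - q j <= u k + q k.
  have := lowD j k; have := upD k j; rewrite addnC.
  by have := q0 (j + k)%N; lra.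
pose E := range (fun k => u k - q k).
have Eub : has_ubound E by exists (u 0 + q 0) => _ [j _ <-]; exact: lowup.
exists (sup E) => k; rewrite ler_norml; apply/andP; split.
- have : sup E <= u k + q k.
    apply: ge_sup; first by exists (u 0 - q 0), 0.
    by move=> _ [j _ <-]; exact: lowup.
  by rewrite /q; lra.
- have : u k - q k <= sup E by apply: ub_le_sup => //; exists k.
  by rewrite /q; lra.
Qed.

(* The a priori bound [B] starts the iteration of the implication. *)
Lemma contraction_le (a : R -> R) B C :
  (forall t : R, 0 <= t <= 1 -> a t <= B) ->
  (forall S, (forall t : R, 0 <= t <= 1 -> a t <= S) ->
     forall t : R, 0 <= t <= 1 -> a t <= S / 2 + C) ->
  forall t : R, 0 <= t <= 1 -> a t <= 2 * C.
Proof.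
move=> aB aS; have ak k : forall t : R, 0 <= t <= 1 ->
    a t <= 2 * C + (B - 2 * C) / 2 ^+ k.
  elim: k => [|k IH] t t01.
    by rewrite expr0 divr1 addrC subrK; exact: aB.
  apply: le_trans (aS _ IH t t01) _.
  have k2 : (2 : R) ^+ k != 0 by rewrite expf_neq0.
  by rewrite exprS le_eqVlt; apply/orP; left; apply/eqP; field.
move=> t t01; rewrite -subr_le0; apply: (@dyadic_le0 (B - 2 * C)) => k.
by rewrite lerBlDl; exact: ak.
Qed.

End Dyadic.

(** * Picard iteration on the unit interval *)

Section RowODE.
Variables (R : realType) (m : nat).
Implicit Types (G H h : R -> 'rV[R]_m) (W : 'rV[R]_m -> 'rV[R]_m).

Lemma antiderivative_rV h c :
  (forall t : R, 0 <= t <= 1 -> {for t, continuous h}) ->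
  exists2 H : R -> 'rV[R]_m, H 0 = c & forall t : R, 0 <= t <= 1 ->
    forall i, is_derive t (1 : R) (fun s => H s 0 i : R) (h t 0 i).
Proof.
move=> ch.
have ex i : exists H : R -> R, H 0 = c 0 i /\
    forall t : R, 0 <= t <= 1 -> is_derive t (1 : R) H (h t 0 i).
  have [t t01|H H0 Hd] := @antiderivative R (fun t => h t 0 i) (c 0 i).
    apply: (@continuous_comp _ _ _ h (fun x : 'rV[R]_m => x 0 i)).
      exact: ch.
    exact: coord_continuous.
  by exists H.
have [H HP] := choice ex.
exists (fun t => \row_i H i t) => [|t t01 i].
  by apply/rowP => i; rewrite mxE; case: (HP i).
under eq_fun do rewrite mxE.
by case: (HP i) => _; apply.
Qed.

Lemma unit_derive_le_rV H h C t : 0 <= C ->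
  (forall t : R, 0 <= t <= 1 ->
     (forall i, is_derive t (1 : R) (fun s => H s 0 i : R) (h t 0 i)) /\
     `|h t| <= C) ->
  0 <= t <= 1 -> `|H t - H 0| <= C.
Proof.
move=> C0 Hh t01; apply: norm_le_coord => // i; rewrite !mxE.
apply: (@unit_derive_le R (fun s => H s 0 i) (fun s => h s 0 i)) => // s s01.
have [Hd hC] := Hh s s01; split; first exact: Hd.
exact: le_trans (norm_coord_le _ _) hC.
Qed.

Lemma derive_rV_continuous H (dH : 'I_m -> R) (t : R) :
  (forall i, is_derive t (1 : R) (fun s => H s 0 i : R) (dH i)) ->
  {for t, continuous H}.
Proof.
by move=> Hd; apply: continuous_rV => i; exact: is_derive_continuous (Hd i).
Qed.

Variables (W : 'rV[R]_m -> 'rV[R]_m) (x0 : 'rV[R]_m) (r : R).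
Hypothesis r0 : 0 <= r.
Hypothesis cW : forall x, `|x - x0| <= r -> {for x, continuous W}.
Hypothesis Wr : forall x, `|x - x0| <= r -> `|W x| <= r.
Hypothesis lipW : forall x y, `|x - x0| <= r -> `|y - x0| <= r ->
  `|W x - W y| <= `|x - y| / 2.

(** Picard's theorem normalised to unit time: speed at most [r] keeps the iterates in the ball of
    radius [r], and Lipschitz constant 1/2 makes consecutive iterates differ by at most
    [r / 2 ^+ k]. Scaling the field down takes the place of shortening the time. *)
Lemma ode_unit_solution : exists G, [/\ G 0 = x0,
  forall t : R, 0 <= t <= 1 -> `|G t - x0| <= r &
  forall t : R, 0 <= t <= 1 -> forall i,
    is_derive t (1 : R) (fun s => G s 0 i : R) (W (G t) 0 i)].
Proof.
pose good G := forall t : R, 0 <= t <= 1 ->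
  `|G t - x0| <= r /\ {for t, continuous G}.
pose primitive G G' := G' 0 = x0 /\ forall t : R, 0 <= t <= 1 -> forall i,
  is_derive t (1 : R) (fun s => G' s 0 i : R) (W (G t) 0 i).
have ex G : exists G', good G -> primitive G G'.
  have [gG|] := pselect (good G); last by exists G.
  have [t t01|G' G'0 Gd] := @antiderivative_rV (W \o G) x0.
    have [Gr cG] := gG t t01.
    by apply: continuous_comp => //; exact: cW.
  by exists G'.
have [F FP] := choice ex.
have primitive_good G G' : good G -> primitive G G' -> good G'.
  move=> gG [G'0 Gd] t t01; split; last exact: derive_rV_continuous (Gd t t01).
  rewrite -G'0; apply: (@unit_derive_le_rV _ (W \o G)) => // s s01.
  by split; [exact: Gd|apply: Wr; case: (gG s s01)].
pose g k := iter k F (fun=> x0).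
have good_g k : good (g k).
  elim: k => [|k IH]; last exact: primitive_good (FP _ IH).
  move=> t t01; split; last exact: cst_continuous.
  by rewrite subrr normr0.
have prim_g k : primitive (g k) (g k.+1) by exact: FP.
have diff_prim G1 G2 H1 H2 S : 0 <= S -> good G1 -> good G2 ->
    primitive G1 H1 -> primitive G2 H2 ->
    (forall t : R, 0 <= t <= 1 -> `|G1 t - G2 t| <= S) ->
    forall t : R, 0 <= t <= 1 -> `|H1 t - H2 t| <= S / 2.
  move=> S0 g1 g2 [H10 Hd1] [H20 Hd2] GS t t01.
  have -> : H1 t - H2 t = (H1 - H2) t - (H1 - H2) 0.
    by rewrite -![(_ - _ : _ -> _) _]/(_ - _) H10 H20 subrr subr0.
  apply: (@unit_derive_le_rV _ (fun t => W (G1 t) - W (G2 t))) => //.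
    by rewrite divr_ge0.
  move=> s s01; split=> [i|].
    rewrite !mxE (_ : (fun s => _) = (fun s => H1 s 0 i) - (fun s => H2 s 0 i)).
      by have ? := Hd1 s s01 i; have ? := Hd2 s s01 i; exact: is_deriveB.
    by apply/funext => u; rewrite !mxE.
  apply: le_trans (lipW _ _) _; [by case: (g1 s s01)|by case: (g2 s s01)|].
  by rewrite ler_pdivrMr// divfK// GS.
have step k : forall t : R, 0 <= t <= 1 -> `|g k.+1 t - g k t| <= r / 2 ^+ k.
  elim: k => [|k IH].
    move=> t t01; rewrite expr0 divr1.
    by case: (good_g 1%N t t01).
  rewrite exprSr invfM mulrA; apply: diff_prim IH => //.
  by rewrite divr_ge0 ?exprn_ge0.
(* The limit is taken at [clamp t], so that the estimate holds for every real [t]; continuity of [G]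
   at 0 and 1 is two-sided and needs this. *)
have exl (t : R) : exists l : 'rV[R]_m,
    forall k, `|g k (clamp t) - l| <= 2 * r / 2 ^+ k.
  have exi i : exists l : R, forall k,
      `|g k (clamp t) 0 i - l| <= 2 * r / 2 ^+ k.
    apply: dyadic_limit => k; apply: le_trans (step k _ (clamp_itv t)).
    by have := norm_coord_le (g k.+1 (clamp t) - g k (clamp t)) i; rewrite !mxE.
  have [l lP] := choice exi; exists (\row_i l i) => k.
  apply: norm_le_coord => [|i].
    by rewrite divr_ge0 ?mulr_ge0 ?exprn_ge0.
  by rewrite !mxE; exact: lP.
have [G GP] := choice exl.
have GP' k t : 0 <= t <= 1 -> `|g k t - G t| <= 2 * r / 2 ^+ k.
  by move=> t01; rewrite -{1}(clamp_id t01); exact: GP.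
have good_G : good G.
  move=> t t01; split.
    rewrite -subr_le0; apply: (@dyadic_le0 _ (2 * r)) => k.
    rewrite lerBlDl -(subrKA (g k t)) [leRHS]addrC.
    apply: le_trans (ler_normD _ _) _.
    by apply: lerD; [rewrite distrC; exact: GP'|case: (good_g k t t01)].
  apply/cvgrPdist_le => e e0.
  have [k hk] := @dyadic_small _ (2 * r) (e / 3) ltac:(by rewrite divr_gt0).
  have gc : {for t, continuous (fun s : R => g k (clamp s))}.
    apply: (@continuous_comp _ _ _ (@clamp R) (g k)); first exact: clamp_continuous.
    by case: (good_g k _ (clamp_itv t)).
  near=> s.
  have : `|g k (clamp t) - g k (clamp s)| <= e / 3.
    near: s; move/cvgrPdist_le : gc; apply.
    by rewrite divr_gt0.
  have := le_lt_trans (GP t k) hk; have := le_lt_trans (GP s k) hk.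
  move=> /= hs ht hts.
  rewrite -(subrKA (g k (clamp t))) -[X in _ + X](subrKA (g k (clamp s))).
  apply: le_trans (ler_normD _ _) _.
  apply: (@le_trans _ _ (e / 3 + (e / 3 + e / 3))); last by lra.
  apply: lerD; first by rewrite distrC ltW.
  by apply: le_trans (ler_normD _ _) _; apply: lerD => //; exact: ltW.
(* [P] integrates [W] along the limit [G]. The contraction estimate places [P] as close to the
   iterates as [G] is, so [P] and [G] agree on [0, 1] and [P] solves the equation. *)
have [P] := ex G => /(_ good_G) [P0 Pd].
have PG t : 0 <= t <= 1 -> P t = G t.
  move=> t01; apply/eqP; rewrite -subr_eq0 -normr_le0.
  apply: (@dyadic_le0 _ (2 * (2 * r))) => k.
  have h1 : `|g k.+1 t - P t| <= 2 * r / 2 ^+ k / 2.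
    apply: (diff_prim (g k) G) => //; last by move=> *; exact: GP'.
    by rewrite divr_ge0 ?mulr_ge0 ?exprn_ge0.
  have h2 := GP' k.+1 t t01.
  rewrite -(subrKA (g k.+1 t)); apply: le_trans (ler_normD _ _) _.
  have k2 : (2 : R) ^+ k != 0 by rewrite expf_neq0.
  rewrite (_ : 2 * (2 * r) / 2 ^+ k = 2 * r / 2 ^+ k / 2 + 2 * r / 2 ^+ k.+1
     + 2 * r / 2 ^+ k); last by rewrite exprS; field.
  apply: ler_wpDr; first by rewrite divr_ge0 ?mulr_ge0 ?exprn_ge0.
  by apply: lerD; rewrite // distrC.
exists P; split=> // t t01; first by rewrite PG//; case: (good_G t t01).
by move=> i; rewrite PG//; exact: Pd.
Unshelve. all: by end_near. Qed.

End RowODE.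

Lemma common_bound (R : realType) (I : finType) (P : I -> R -> Prop) :
  (forall i K K', K <= K' -> P i K -> P i K') ->
  (forall i, exists2 K, 0 <= K & P i K) ->
  exists2 K, 0 <= K & forall i, P i K.
Proof.
move=> Pmon ex.
have [K KP] := choice (fun i => (exists2P _ _).1 (ex i)).
have K0 i : 0 <= K i by case: (KP i).
exists (\sum_i K i) => [|i]; first exact: sumr_ge0.
apply: Pmon (KP i).2; rewrite (bigD1 i)//= lerDl; exact: sumr_ge0.
Qed.

(** * Integral curves of combinations of commuting fields *)

Section LocalAction.
Variables (R : realType) (m s : nat).
Variables (V : 'I_s -> 'rV[R]_m -> 'rV[R]_m) (U : set 'rV[R]_m) (x0 : 'rV[R]_m).
Hypothesis oU : open U.
Hypothesis sV : forall a i, smooth_on U (fun x => V a x 0 i).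

Definition dfield a i l : 'rV[R]_m -> R :=
  'D_(delta_mx 0 l) (fun x => V a x 0 i : R^o).

Hypothesis commV : forall a b i x, U x ->
  \sum_l V a x 0 l * dfield b i l x = \sum_l V b x 0 l * dfield a i l x.

Definition comb (u : 'rV[R]_s) (x : 'rV[R]_m) : 'rV[R]_m :=
  \sum_a u 0 a *: V a x.

Lemma combE u x i : comb u x 0 i = \sum_a u 0 a * V a x 0 i.
Proof. by rewrite summxE; apply: eq_bigr => a _; rewrite mxE. Qed.

Section Estimates.
Variables (r K d : R).
Hypotheses (r0 : 0 < r) (K0 : 0 <= K).
Let B (x : 'rV[R]_m) := `|x - x0| <= r.
Hypothesis BU : forall x, B x -> U x.
Hypothesis VK : forall a x, B x -> `|V a x| <= K.
Hypothesis Vlip : forall a i x y, B x -> B y ->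
  `|V a y 0 i - V a x 0 i| <= K * `|y - x|.
Hypothesis dVK : forall a i l x, B x -> `|dfield a i l x| <= K.
Hypothesis dVlip : forall a i l x y, B x -> B y ->
  `|dfield a i l y - dfield a i l x| <= K * `|y - x|.
(** Smallness of the parameter radius [d]: [dr] bounds the speed by [r], [dhalf] gives [comb u]
    Lipschitz constant 1/2, and [dmhalf] makes the linearised equation in [flow_quadratic] a
    contraction. *)
Hypothesis dr : s%:R * K * d <= r.
Hypothesis dhalf : s%:R * K * d <= 2^-1.
Hypothesis dmhalf : s%:R * (m%:R * K) * d <= 2^-1.

Lemma comb_norm u x : B x -> `|comb u x| <= s%:R * K * `|u|.
Proof.
move=> Bx; apply: le_trans (ler_norm_sum _ _ _) _.
apply: (@le_trans _ _ (\sum_(a < s) K * `|u|)).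
  apply: ler_sum => a _; rewrite normrZ mulrC; apply: ler_pM => //; first exact: VK.
  exact: norm_coord_le.
by rewrite sumr_const card_ord -[X in _ <= X]mulrA mulr_natl lexx.
Qed.

Lemma comb_lip u x y : B x -> B y ->
  `|comb u y - comb u x| <= s%:R * K * `|u| * `|y - x|.
Proof.
move=> Bx By; apply: norm_le_coord => [|i]; first by rewrite !mulr_ge0.
rewrite !mxE !combE -sumrB; apply: le_trans (ler_norm_sum _ _ _) _.
apply: (@le_trans _ _ (\sum_(a < s) K * `|u| * `|y - x|)).
  apply: ler_sum => a _; rewrite -mulrBr normrM mulrAC [leRHS]mulrC.
  apply: ler_pM => //; first exact: norm_coord_le.
  exact: Vlip.
by rewrite sumr_const card_ord -!mulrA mulr_natl lexx.
Qed.

Lemma comb_continuous u x : B x -> {for x, continuous (comb u)}.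
Proof.
move=> Bx; apply: continuous_rV => i.
have -> : (fun y => comb u y 0 i) = (fun y => \sum_a u 0 a * V a y 0 i).
  by apply/funext => y; exact: combE.
apply: (@Ck_on_continuous _ _ 0 U); last exact: BU.
apply: Ck_on_sum => // a; apply: Ck_onM => //; first exact: Ck_on_cst.
exact: sV.
Qed.

Lemma flow_exists u : `|u| <= d -> exists G : R -> 'rV[R]_m, [/\ G 0 = x0,
  forall t : R, 0 <= t <= 1 -> B (G t) &
  forall t : R, 0 <= t <= 1 -> forall i,
    is_derive t (1 : R) (fun s => G s 0 i : R) (comb u (G t) 0 i)].
Proof.
move=> ud; have sK : 0 <= s%:R * K by rewrite mulr_ge0.
apply: ode_unit_solution; first exact: ltW.
- by move=> x Bx; exact: comb_continuous.
- move=> x Bx; apply: le_trans (comb_norm u Bx) (le_trans _ dr).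
  exact: ler_wpM2l.
- move=> x y Bx By; apply: le_trans (comb_lip u By Bx) _.
  rewrite mulrC ler_wpM2l//; apply: le_trans dhalf; exact: ler_wpM2l.
Qed.

Variable G : 'rV[R]_s -> R -> 'rV[R]_m.
Hypothesis G0 : forall u, `|u| <= d -> G u 0 = x0.
Hypothesis GB : forall u, `|u| <= d -> forall t : R, 0 <= t <= 1 -> B (G u t).
Hypothesis Gd : forall u, `|u| <= d -> forall t : R, 0 <= t <= 1 ->
  forall i, is_derive t (1 : R) (fun s => G u s 0 i : R) (comb u (G u t) 0 i).

Lemma combB u v x : comb u x - comb v x = comb (u - v) x.
Proof.
by rewrite /comb -sumrB; apply: eq_bigr => a _; rewrite !mxE scalerBl.
Qed.

(** A Gronwall estimate by [contraction_le], started from the a priori bound [2 * r]. Changing the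
    coefficients at a fixed point costs a multiple of [|v - u|]; moving the point with fixed
    coefficients costs at most half of the current bound. *)
Lemma flow_lipschitz u v : `|u| <= d -> `|v| <= d ->
  forall t : R, 0 <= t <= 1 -> `|G v t - G u t| <= 2 * (s%:R * K * `|v - u|).
Proof.
move=> ud vd; have sK : 0 <= s%:R * K by rewrite mulr_ge0.
apply: (@contraction_le _ (fun t => `|G v t - G u t|) (2 * r)).
  move=> t t01; have := GB ud t01; have := GB vd t01; rewrite /B => hv hu.
  rewrite -(subrKA x0); apply: le_trans (ler_normD _ _) _.
  by rewrite mulr_natl mulr2n lerD// distrC.
move=> S HS t t01.
have S0 : 0 <= S by apply: le_trans (HS t t01).
have -> : G v t - G u t = (G v - G u) t - (G v - G u) 0.
  by rewrite -![(_ - _ : _ -> _) _]/(_ - _) !G0// subrr subr0.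
apply: (@unit_derive_le_rV _ _ _ (fun t => comb v (G v t) - comb u (G u t))) => //.
  by rewrite addr_ge0 ?divr_ge0 ?mulr_ge0.
move=> y y01; split=> [i|].
  rewrite !mxE (_ : (fun s => _) = (fun s => G v s 0 i) - (fun s => G u s 0 i)).
    by have ? := Gd vd y01 i; have ? := Gd ud y01 i; exact: is_deriveB.
  by apply/funext => z; rewrite !mxE.
rewrite -(subrKA (comb u (G v y))) combB; apply: le_trans (ler_normD _ _) _.
rewrite addrC; apply: lerD.
  apply: le_trans (comb_lip u (GB ud y01) (GB vd y01)) _.
  rewrite mulrC; apply: ler_pM => //; first by rewrite mulr_ge0.
    exact: HS.
  by apply: le_trans dhalf; exact: ler_wpM2l.
by apply: comb_norm; exact: GB.
Qed.

Lemma is_derive_field u a i (t : R) : `|u| <= d -> 0 <= t <= 1 ->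
  is_derive t (1 : R) (fun y => V a (G u y) 0 i : R)
    (\sum_l comb u (G u t) 0 l * dfield a i l (G u t)).
Proof.
move=> ud t01; have Ut : U (G u t) by apply/BU/GB.
apply: (@is_derive_chain _ _ _ (G u) (fun x => V a x 0 i)
  (fun l => comb u (G u t) 0 l) (dfield a i)) => [l||l].
- exact: Gd.
- apply: filterS (open_near oU Ut) => z Uz l.
  exact: (smooth_on_is_derive l (sV a i) Uz).
- exact: (smooth_on_continuous (smooth_on_derive l (sV a i)) Ut).
Qed.

(* By commutativity, [w t = G v t - G u t - (h t) V_b (G u t)] solves up to
   O(h^2) a homogeneous linear equation, so that [contraction_le] bounds it. *)
Lemma flow_quadratic u b h : `|u| <= d -> `|h *: delta_mx 0 b + u| <= d ->
  `|G (h *: delta_mx 0 b + u) 1 - G u 1 - h *: V b (G u 1)| <=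
  `|h| * (2 * (K * (2 * s%:R * K) + (2 * s%:R * K) ^+ 2) * `|h|).
Proof.
move=> ud vd; set v := h *: delta_mx 0 b + u.
pose D := 2 * s%:R * K; have D0 : 0 <= D by rewrite !mulr_ge0.
have sK : 0 <= s%:R * K by rewrite mulr_ge0.
have lipG t : 0 <= t <= 1 -> `|G v t - G u t| <= D * `|h|.
  move=> t01; apply: le_trans (flow_lipschitz ud vd t01) _.
  rewrite /D -!mulrA !ler_wpM2l// addrK; exact: norm_delta.
pose w t := G v t - G u t - (h * t) *: V b (G u t).
pose C := `|h| * ((K * D + D ^+ 2) * `|h|).
have main : forall t : R, 0 <= t <= 1 -> `|w t| <= 2 * C; last first.
  have := main 1; rewrite /w mulr1 ler01 lexx => /(_ isT)/le_trans; apply.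
  by rewrite /C -/D mulrCA [2 * (_ * `|h|)]mulrA lexx.
apply: (@contraction_le _ (fun t => `|w t|) (D * `|h| + `|h| * K)).
  move=> t t01; apply: le_trans (ler_normB _ _) _; apply: lerD; first exact: lipG.
  rewrite normrZ; apply: ler_pM => //; last by apply: VK; exact: GB.
  have /andP[t0 t1] := t01.
  by rewrite normrM (ger0_norm t0) ler_piMr.
move=> S HS t t01.
have S0 : 0 <= S by apply: le_trans (HS t t01).
have C0 : 0 <= C by rewrite !(mulr_ge0, addr_ge0, exprn_ge0).
pose dw t : 'rV[R]_m := \row_i (comb v (G v t) 0 i - comb u (G u t) 0 i -
  h * (t * (\sum_l comb u (G u t) 0 l * dfield b i l (G u t)) + V b (G u t) 0 i)).
have -> : w t = w t - w 0 by rewrite /w !G0// mulr0 scale0r !subrr subr0.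
apply: (@unit_derive_le_rV _ _ w dw) => //; first by rewrite addr_ge0// divr_ge0.
move=> {}t {}t01; split=> [i|].
  rewrite mxE (_ : (fun s => _) = (fun s => G v s 0 i) - (fun s => G u s 0 i) -
     h *: (id * (fun s => V b (G u s) 0 i) : R -> R)); last first.
    by apply/funext => z; rewrite !mxE -mulrA.
  apply: is_deriveB.
    by have ? := Gd vd t01 i; have ? := Gd ud t01 i; exact: is_deriveB.
  apply: is_deriveZ; have ? := is_derive_field b i ud t01.
  apply: is_derive_eq; rewrite [X in _ = _ + X](_ : _ = V b (G u t) 0 i *: 1) //.
  by rewrite [RHS]mulr1.
apply: norm_le_coord => [|i]; first by rewrite addr_ge0// divr_ge0.
have Bu := GB ud t01; have Bv := GB vd t01.
pose e := G v t - G u t.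
have eD : `|e| <= D * `|h| by exact: lipG.
(* [br a] is the increment of [V a] from [G u t] to [G v t] minus its linear prediction for the
   displacement [(h * t) *: V b]. By [partial_MVT] it splits into a term quadratic in the
   displacement [e] and a term linear in [w t], which the contraction absorbs. *)
pose br a := (V a (G v t) 0 i - V a (G u t) 0 i) -
  h * t * \sum_l V b (G u t) 0 l * dfield a i l (G u t).
have -> : dw t 0 i = h * (V b (G v t) 0 i - V b (G u t) 0 i) + \sum_a u 0 a * br a.
  have combv : comb v (G v t) 0 i = h * V b (G v t) 0 i + comb u (G v t) 0 i.
    rewrite !combE (bigD1 b)//= [in RHS](bigD1 b)//= !mxE !eqxx mulr1 mulrDl -addrA.
    congr (_ + (_ + _)); apply: eq_bigr => a ab.
    by rewrite !mxE (negbTE ab) andbF mulr0 add0r.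
  (* Commutativity enters here: the derivative of [V b] along the curve becomes the derivative of
     the velocity field [comb u] in the direction [V b], which is what linearising the velocity
     difference produces. *)
  have swap : \sum_l comb u (G u t) 0 l * dfield b i l (G u t) =
      \sum_a u 0 a * \sum_l V b (G u t) 0 l * dfield a i l (G u t).
    under eq_bigr do rewrite combE mulr_suml.
    rewrite exchange_big /=; apply: eq_bigr => a _.
    rewrite -commV; last exact: BU.
    by rewrite mulr_sumr; apply: eq_bigr => l _; rewrite mulrA.
  rewrite mxE combv swap.
  have -> : \sum_a u 0 a * br a = comb u (G v t) 0 i - comb u (G u t) 0 i -
      h * t * \sum_a u 0 a * \sum_l V b (G u t) 0 l * dfield a i l (G u t).
    rewrite !combE [in RHS]mulr_sumr -!sumrB; apply: eq_bigr => a _.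
    by rewrite /br; ring.
  by ring.
have br_le a : `|br a| <= m%:R * K * (`|e| ^+ 2 + S).
  have [z|z [ze Vz]] := @partial_MVT _ _ (fun x => V a x 0 i) (dfield a i)
      x0 r (G u t) (G v t) Bu Bv.
    by move=> Bz l; apply: (smooth_on_is_derive l (sV a i)); exact: BU.
  have -> : br a = \sum_l (e 0 l * (dfield a i l (z l) - dfield a i l (G u t)) +
      w t 0 l * dfield a i l (G u t)).
    rewrite /br Vz mulr_sumr -sumrB; apply: eq_bigr => l _.
    by rewrite !mxE; ring.
  apply: le_trans (ler_norm_sum _ _ _) _.
  apply: (@le_trans _ _ (\sum_(l < m) K * (`|e| ^+ 2 + S))); last first.
    by rewrite sumr_const card_ord -[leRHS]mulrA mulr_natl lexx.
  apply: ler_sum => l _; rewrite [leRHS]mulrDr; apply: le_trans (ler_normD _ _) _.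
  have [zle zB] := ze l.
  apply: lerD; rewrite normrM.
    rewrite expr2 mulrCA; apply: ler_pM => //; first exact: norm_coord_le.
    apply: le_trans (dVlip _ _ _ Bu zB) _; exact: ler_wpM2l.
  rewrite mulrC; apply: ler_pM => //; first exact: dVK.
  by apply: le_trans (norm_coord_le _ _) _; exact: HS.
apply: le_trans (ler_normD _ _) _; rewrite addrC.
have sum_le : `|\sum_a u 0 a * br a| <= 2^-1 * (`|e| ^+ 2 + S).
  apply: le_trans (ler_norm_sum _ _ _) _.
  apply: (@le_trans _ _ (\sum_(a < s) d * (m%:R * K * (`|e| ^+ 2 + S)))).
    apply: ler_sum => a _; rewrite normrM; apply: ler_pM => //.
    exact: le_trans (norm_coord_le _ _) ud.
  rewrite sumr_const card_ord -[leLHS]mulr_natl.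
  rewrite (_ : _ * _ = s%:R * (m%:R * K) * d * (`|e| ^+ 2 + S)); last by ring.
  by apply: ler_wpM2r => //; rewrite addr_ge0 ?exprn_ge0.
have e2 : `|e| ^+ 2 <= (D * `|h|) ^+ 2 by rewrite ler_pXn2r ?nnegrE ?mulr_ge0.
have hV : `|h * (V b (G v t) 0 i - V b (G u t) 0 i)| <= `|h| * (K * (D * `|h|)).
  rewrite normrM ler_wpM2l//; apply: le_trans (Vlip _ _ Bu Bv) _.
  by rewrite ler_wpM2l.
apply: le_trans (lerD sum_le hV) _.
rewrite /C exprMn in e2 *; set H := `|h| in e2 *; set E := `|e| ^+ 2 in e2 *.
have E0 : 0 <= E by rewrite exprn_ge0.
have -> : H * ((K * D + D ^+ 2) * H) = H * (K * (D * H)) + D ^+ 2 * H ^+ 2 by ring.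
by lra.
Qed.

End Estimates.
End LocalAction.

Theorem commuting_local_action (R : realType) m s
    (V : 'I_s -> 'rV[R]_m -> 'rV[R]_m) (U : set 'rV[R]_m) (x0 : 'rV[R]_m) :
  open U -> U x0 -> (forall a i, smooth_on U (fun x => V a x 0 i)) ->
  (forall a b i x, U x ->
    \sum_l V a x 0 l * 'D_(delta_mx 0 l) (fun x => V b x 0 i : R^o) x =
    \sum_l V b x 0 l * 'D_(delta_mx 0 l) (fun x => V a x 0 i : R^o) x) ->
  exists (d : R) (iota : 'rV[R]_s -> 'rV[R]_m), [/\ 0 < d, iota 0 = x0,
    forall u, ball 0 d u -> U (iota u),
    forall u a i, ball 0 d u -> is_derive u (delta_mx 0 a)
      (fun v => iota v 0 i : R) (V a (iota u) 0 i) &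
    forall i, smooth_on (ball 0 d) (fun u => iota u 0 i)].
Proof.
move=> oU Ux0 sV commV.
have [e e0 eU] := (nbhs_ballP _ _).1 (open_near oU Ux0).
pose r := e / 2; have r0 : 0 < r by rewrite divr_gt0.
have BU x : `|x - x0| <= r -> U x.
  move=> xr; apply: eU; rewrite -ball_normE /ball_ /= distrC.
  by apply: le_lt_trans xr _; rewrite ltr_pdivrMr// ltr_pMr// ltr1n.
have sdV a i l : smooth_on U (dfield V a i l) by exact: smooth_on_derive.
have [K1 K10 VK] : exists2 K, 0 <= K & forall ai : 'I_s * 'I_m, forall x,
    `|x - x0| <= r -> `|V ai.1 x 0 ai.2| <= K.
  apply: bounded_on_closed_ball => -[a i] x /BU Ux.
  exact: (smooth_on_continuous (sV a i) Ux).
have [K2 K20 dVK] : exists2 K, 0 <= K & forall ail : 'I_s * 'I_m * 'I_m, forall x,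
    `|x - x0| <= r -> `|dfield V ail.1.1 ail.1.2 ail.2 x| <= K.
  apply: bounded_on_closed_ball => -[[a i] l] x /BU Ux.
  exact: (smooth_on_continuous (sdV a i l) Ux).
have lip_mono (F : 'rV[R]_m -> R) (K K' : R) : K <= K' ->
    (forall x y, `|x - x0| <= r -> `|y - x0| <= r -> `|F y - F x| <= K * `|y - x|) ->
    forall x y, `|x - x0| <= r -> `|y - x0| <= r -> `|F y - F x| <= K' * `|y - x|.
  by move=> KK' FK x y xr yr; apply: le_trans (FK x y xr yr) _; exact: ler_wpM2r.
have [K3 K30 Vlip] : exists2 K, 0 <= K & forall ai : 'I_s * 'I_m, forall x y,
    `|x - x0| <= r -> `|y - x0| <= r ->
    `|V ai.1 y 0 ai.2 - V ai.1 x 0 ai.2| <= K * `|y - x|.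
  apply: common_bound => [ai K K'|[a i]]; first exact: lip_mono.
  exact: (@smooth_lipschitz _ _ U x0 r BU (fun x => V a x 0 i)).
have [K4 K40 dVlip] : exists2 K, 0 <= K & forall ail : 'I_s * 'I_m * 'I_m, forall x y,
    `|x - x0| <= r -> `|y - x0| <= r ->
    `|dfield V ail.1.1 ail.1.2 ail.2 y - dfield V ail.1.1 ail.1.2 ail.2 x|
      <= K * `|y - x|.
  apply: common_bound => [ai K K'|[[a i] l]]; first exact: lip_mono.
  exact: (@smooth_lipschitz _ _ U x0 r BU).
pose K := K1 + K2 + K3 + K4.
have K0 : 0 <= K by rewrite !addr_ge0.
have [K1K K2K K3K K4K] : [/\ K1 <= K, K2 <= K, K3 <= K & K4 <= K].
  by rewrite /K; split; lra.
have {}VK a x : `|x - x0| <= r -> `|V a x| <= K.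
  move=> xr; apply: norm_le_coord => // i.
  by apply: le_trans K1K; exact: (VK (a, i)).
have {}dVK a i l x : `|x - x0| <= r -> `|dfield V a i l x| <= K.
  by move=> xr; apply: le_trans K2K; exact: (dVK (a, i, l)).
have {}Vlip a i := lip_mono _ _ _ K3K (Vlip (a, i)).
have {}dVlip a i l := lip_mono _ _ _ K4K (dVlip (a, i, l)).
pose q := Num.min r 2^-1; have q0 : 0 < q by rewrite lt_min r0/= invr_gt0.
(* [S] dominates both coefficients of [d] in the smallness conditions, and the summand 1 keeps it
   positive when [K] or [s] is 0. With [d = q / S] each product is at most [q], hence at most [r]
   and 1/2. *)
pose S := s%:R * K + s%:R * (m%:R * K) + 1.
have S0 : 0 < S by rewrite ltr_wpDl// !(addr_ge0, mulr_ge0).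
pose d := q / S; have d0 : 0 < d by rewrite divr_gt0.
have small c : 0 <= c -> c <= S -> c * d <= q.
  move=> c0 cS; rewrite /d mulrCA ler_piMr ?(ltW q0)//.
  by rewrite ler_pdivrMr// mul1r.
have sK0 : 0 <= s%:R * K by rewrite mulr_ge0.
have smK0 : 0 <= s%:R * (m%:R * K) by rewrite !mulr_ge0.
have qr : q <= r by rewrite ge_min lexx.
have qh : q <= 2^-1 by rewrite ge_min lexx orbT.
have sKS : s%:R * K <= S by rewrite /S; lra.
have smKS : s%:R * (m%:R * K) <= S by rewrite /S; lra.
have dr := le_trans (small _ sK0 sKS) qr.
have dhalf := le_trans (small _ sK0 sKS) qh.
have dmhalf := le_trans (small _ smK0 smKS) qh.
have exG u : exists G : R -> 'rV[R]_m, `|u| <= d -> [/\ G 0 = x0,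
    forall t : R, 0 <= t <= 1 -> `|G t - x0| <= r &
    forall t : R, 0 <= t <= 1 -> forall i,
    is_derive t (1 : R) (fun s => G s 0 i : R) (comb V u (G t) 0 i)].
  have [ud|] := pselect (`|u| <= d); last by exists (fun=> x0).
  have [G GP] := @flow_exists R m s V U x0 oU sV r K d r0 K0 BU VK Vlip dr dhalf u ud.
  by exists G.
have [G GP] := choice exG.
have G0 u : `|u| <= d -> G u 0 = x0 by case/GP.
have GB u : `|u| <= d -> forall t : R, 0 <= t <= 1 -> `|G u t - x0| <= r by case/GP.
have Gd u : `|u| <= d -> forall t : R, 0 <= t <= 1 -> forall i,
    is_derive t (1 : R) (fun s => G u s 0 i : R) (comb V u (G u t) 0 i).
  by case/GP.
pose iota u := G u 1.
have one01 : 0 <= (1 : R) <= 1 by rewrite ler01 lexx.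
have inb (u : 'rV[R]_s) : ball 0 d u -> `|u| < d.
  by rewrite -ball_normE /ball_ /= sub0r normrN.
have inU u : ball 0 d u -> U (iota u).
  by move=> /inb/ltW ud; apply/BU/GB.
have nearu (u v : 'rV[R]_s) : `|v - u| <= d - `|u| -> `|v| <= d.
  move=> vu; rewrite -(subrK u v) (le_trans (ler_normD _ _))//.
  by rewrite -lerBrDr.
have iotad u a i : ball 0 d u -> is_derive u (delta_mx 0 a)
    (fun v => iota v 0 i : R) (V a (iota u) 0 i).
  move=> /inb ud.
  pose C := 2 * (K * (2 * s%:R * K) + (2 * s%:R * K) ^+ 2).
  apply: (@is_derive_quadratic _ _ _ _ _ _ (d - `|u|) C).
  - by rewrite subr_gt0.
  - by rewrite !(mulr_ge0, addr_ge0, exprn_ge0).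
  move=> h hd.
  have vd : `|h *: delta_mx 0 a + u| <= d.
    apply: (nearu u); rewrite addrK; apply: le_trans hd; exact: norm_delta.
  have /= := flow_quadratic oU sV commV K0 BU VK Vlip dVK dVlip
    dhalf dmhalf G0 GB Gd (ltW ud) vd.
  apply: le_trans; have := norm_coord_le (G (h *: delta_mx 0 a + u) 1 - G u 1
    - h *: V a (G u 1)) i.
  by rewrite !mxE.
have ciota u : ball 0 d u -> {for u, continuous iota}.
  move=> /inb ud; apply: (@lipschitz_continuous _ _ _ _ _ (d - `|u|) (2 * (s%:R * K))).
    by rewrite subr_gt0.
  move=> v /ltW vu; rewrite -mulrA.
  exact: (flow_lipschitz K0 VK Vlip dhalf G0 GB Gd (ltW ud) (nearu _ _ vu) one01).
exists d, iota; split=> //.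
(* For the parameter 0 the field vanishes, so the curve has derivative 0 and stays at [x0]. *)
- apply/eqP; rewrite -subr_eq0 -normr_le0.
  have z0 : `|0 : 'rV[R]_s| <= d by rewrite normr0 ltW.
  rewrite -[X in _ - X](G0 0 z0).
  apply: (@unit_derive_le_rV _ _ (G 0) (fun t => comb V 0 (G 0 t))) => // t t01.
  split; first exact: Gd.
  by rewrite /comb big1 ?normr0// => a _; rewrite mxE scale0r.
- move=> + k; elim: k => [|k IH] i.
    split=> // u ud; apply: (@continuous_comp _ _ _ iota (fun x : 'rV[R]_m => x 0 i)).
      exact: ciota.
    exact: coord_continuous.
  (* Bootstrapping: the partial derivatives of [iota] are smooth functions composed with [iota],
     hence of class C^k as soon as [iota] is. *)
  apply: (@Ck_on_intro _ _ _ _ _ (fun a u => V a (iota u) 0 i)).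
  + exact: ball_open.
  + move=> u ud; apply: (@continuous_comp _ _ _ iota (fun x : 'rV[R]_m => x 0 i)).
      exact: ciota.
    exact: coord_continuous.
  + move=> a; apply: (@Ck_on_comp _ _ _ _ _ U iota (fun x => V a x 0 i)) => //.
      exact: ball_open.
    exact: sV.
Qed.

(** * Smooth functions and tangent vectors *)

Lemma open_setI_preimage (S T : topologicalType) (f : S -> T) (U : set S)
    (O : set T) : open U -> open O -> (forall x, U x -> {for x, continuous f}) ->
  open (U `&` f @^-1` O).
Proof.
move=> oU oO cf; rewrite openE => x [Ux Ox].
apply: filterI; first exact: open_near.
exact: (cf x Ux O (open_near oO Ox)).
Qed.

Section Charts.
Variables (R : realType) (m : nat) (M : smooth_manifold R m).
Implicit Types (p q : M) (phi psi : M -> R) (c d : chart R M m).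

Definition chart_image c : set 'rV[R]_m := chart_coord c @` chart_dom c.

Lemma chart_paramK c x : chart_image c x -> chart_coord c (chart_param c x) = x.
Proof. by move=> [p cp <-]; rewrite chart_coordK. Qed.

Lemma chart_param_dom c x : chart_image c x -> chart_dom c (chart_param c x).
Proof. by move=> [p cp <-]; rewrite chart_coordK. Qed.

Lemma chart_image_coord c p : chart_dom c p -> chart_image c (chart_coord c p).
Proof. by move=> cp; exists p. Qed.

Lemma transition_domain c d :
  chart_coord c @` (chart_dom c `&` chart_dom d) =
  chart_image c `&` chart_param c @^-1` chart_dom d.
Proof.
apply/seteqP; split=> [_ [p [cp dp] <-]|x [[p cp <-]]] /=.
  by split; [exact: chart_image_coord|rewrite chart_coordK].
by rewrite chart_coordK// => dp; exists p.
Qed.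

Lemma transition_domain_open c d :
  open (chart_coord c @` (chart_dom c `&` chart_dom d)).
Proof.
rewrite transition_domain; apply: open_setI_preimage.
- exact: chart_coord_open.
- exact: chart_dom_open.
- by move=> x; exact: chart_param_continuous.
Qed.

(** [smooth_at] quantifies over all charts around [p]; one suffices, since the transition maps of
    the atlas are smooth. *)
Lemma smooth_at_chart p phi c : atlas c -> chart_dom c p ->
  (exists U : set 'rV[R]_m,
      [/\ open U, U (chart_coord c p), U `<=` chart_image c &
          smooth_on U (phi \o chart_param c)]) -> smooth_at p phi.
Proof.
move=> ac cp [U [oU Up Uc sphi]] d ad dp.
pose W := chart_coord d @` (chart_dom d `&` chart_dom c).
pose T x := chart_coord c (chart_param d x).
have oW : open W by exact: transition_domain_open.
have sT j : smooth_on W (fun x => T x 0 j) by exact: atlas_compatible.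
have oV : open (W `&` T @^-1` U).
  apply: open_setI_preimage => // x Wx; apply: continuous_rV => j.
  exact: (smooth_on_continuous (sT j) Wx).
exists (W `&` T @^-1` U); split=> //.
- by split; [exists p|rewrite /= /T chart_coordK].
- by move=> x [[q [dq _] <-] _]; exists q.
- move=> k; apply: (@eq_Ck_on _ _ k _ (fun x => (phi \o chart_param c) (T x))) => //.
    move=> x [[q [dq cq] <-] _] /=; rewrite /T chart_coordK// chart_coordK//.
  apply: (@Ck_on_comp _ _ _ _ _ U T (phi \o chart_param c)) => //.
    by move=> x [].
  by move=> j; apply: Ck_on_sub (sT j k) => x [].
Qed.

Lemma eq_smooth_at p phi psi : (\forall q \near p, phi q = psi q) ->
  smooth_at p phi -> smooth_at p psi.
Proof.
move=> e sphi c ac cp; pose W := [set q | phi q = psi q]°.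
have oW : open W by exact: open_interior.
have Wp : W p by exact: e.
have WE : W `<=` [set q | phi q = psi q] by exact: interior_subset.
have [U [oU Up Uc sU]] := sphi c ac cp.
have cpar x : U x -> {for x, continuous (chart_param c)}.
  by move=> /Uc; exact: chart_param_continuous.
exists (U `&` chart_param c @^-1` W); split.
- exact: open_setI_preimage.
- by split=> //=; rewrite chart_coordK.
- by move=> x [/Uc].
- move=> k; apply: (@eq_Ck_on _ _ k _ (phi \o chart_param c)).
  + exact: open_setI_preimage.
  + by move=> x [_ /WE].
  + by apply: Ck_on_sub (sU k) => x [].
Qed.

Lemma smooth_at_family (I : finType) (phi : I -> M -> R) p c :
  atlas c -> chart_dom c p -> (forall i, smooth_at p (phi i)) ->
  exists U : set 'rV[R]_m,
    [/\ open U, U (chart_coord c p), U `<=` chart_image c &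
        forall i, smooth_on U (phi i \o chart_param c)].
Proof.
move=> ac cp sphi.
have [U UP] := choice (fun i => sphi i c ac cp).
exists ([set x | forall i, U i x] `&` chart_image c); split.
- apply: openI; last exact: chart_coord_open.
  rewrite openE => x Ux.
  suff : \forall y \near x, forall i, U i y by [].
  have h i : \forall y \near x, U i y by apply: open_near => //; case: (UP i).
  exact: (filter_forall _ h).
- by split=> [i|]; [case: (UP i)|exact: chart_image_coord].
- by move=> x [].
- by move=> i k; have [_ _ _ sU] := UP i; apply: Ck_on_sub (sU k) => x [/(_ i)].
Qed.

Lemma smooth_at_near p phi : smooth_at p phi ->
  \forall q \near p, smooth_at q phi.
Proof.
move=> sphi; have [c ac cp] := atlas_cover p.
have [U [oU Up Uc sU]] := sphi c ac cp.
have oV : open (chart_dom c `&` chart_coord c @^-1` U).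
  apply: open_setI_preimage => //; first exact: chart_dom_open.
  exact: chart_coord_continuous.
have Vp : (chart_dom c `&` chart_coord c @^-1` U) p by split.
apply: filterS (open_near oV Vp) => q [cq Uq].
by apply: (smooth_at_chart ac cq); exists U.
Qed.

Lemma smooth_at_cst p (a : R) : smooth_at p (fun=> a).
Proof.
move=> c ac cp; exists (chart_image c); split=> //.
- exact: chart_coord_open.
- exact: chart_image_coord.
- by move=> k; apply: Ck_on_cst; exact: chart_coord_open.
Qed.

Lemma smooth_at_comp k (F : 'rV[R]_k -> R) (G : M -> 'rV[R]_k) V p :
  open V -> V (G p) -> smooth_on V F ->
  (forall i, smooth_at p (fun q => G q 0 i)) -> smooth_at p (fun q => F (G q)).
Proof.
move=> oV Vp sF sG; have [c ac cp] := atlas_cover p.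
have [U [oU Up Uc sU]] := smooth_at_family ac cp sG.
apply: (smooth_at_chart ac cp).
have cG x : U x -> {for x, continuous (G \o chart_param c)}.
  by move=> Ux; apply: continuous_rV => i; exact: (smooth_on_continuous (sU i) Ux).
exists (U `&` (G \o chart_param c) @^-1` V); split.
- exact: open_setI_preimage.
- by split=> //=; rewrite chart_coordK.
- by move=> x [/Uc].
- move=> l; apply: (@Ck_on_comp _ _ _ _ _ V (G \o chart_param c) F) => //.
  + exact: open_setI_preimage.
  + by move=> x [].
  + by move=> i; apply: Ck_on_sub (sU i l) => x [].
Qed.

Lemma smooth_at_coord p c j : atlas c -> chart_dom c p ->
  smooth_at p (fun q => chart_coord c q 0 j).
Proof.
move=> ac cp; apply: (smooth_at_chart ac cp); exists (chart_image c); split=> //.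
- exact: chart_coord_open.
- exact: chart_image_coord.
- move=> k; apply: (@eq_Ck_on _ _ k _ (fun x : 'rV[R]_m => x 0 j)).
  + exact: chart_coord_open.
  + by move=> x cx /=; rewrite chart_paramK.
  + by apply: Ck_on_coord; exact: chart_coord_open.
Qed.

Lemma smooth_at_chart_comp p c (h : 'rV[R]_m -> R) V : atlas c ->
  chart_dom c p -> open V -> V (chart_coord c p) -> smooth_on V h ->
  smooth_at p (fun q => h (chart_coord c q)).
Proof.
move=> ac cp oV Vp sh; apply: (smooth_at_comp oV Vp sh) => i.
exact: smooth_at_coord.
Qed.

Lemma smooth_at_op (op : R -> R -> R) p phi psi :
  (forall k (U : set 'rV[R]_m) f h, open U -> Ck_on k U f -> Ck_on k U h ->
     Ck_on k U (fun x => op (f x) (h x))) ->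
  smooth_at p phi -> smooth_at p psi -> smooth_at p (fun q => op (phi q) (psi q)).
Proof.
move=> opC sphi spsi; have [c ac cp] := atlas_cover p.
have sb (b : bool) : smooth_at p (if b then phi else psi) by case: b.
have [U [oU Up Uc sU]] := smooth_at_family ac cp sb.
apply: (smooth_at_chart ac cp); exists U; split=> // k.
by apply: opC => //; [exact: (sU true)|exact: (sU false)].
Qed.

Lemma smooth_atD p phi psi : smooth_at p phi -> smooth_at p psi ->
  smooth_at p (fun q => phi q + psi q).
Proof. by apply: (smooth_at_op (op := +%R)) => *; exact: Ck_onD. Qed.

Lemma smooth_atM p phi psi : smooth_at p phi -> smooth_at p psi ->
  smooth_at p (fun q => phi q * psi q).
Proof. by apply: (smooth_at_op (op := *%R)) => *; exact: Ck_onM. Qed.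

Lemma smooth_atZ p (a : R) phi : smooth_at p phi -> smooth_at p (fun q => a * phi q).
Proof. by apply: smooth_atM; exact: smooth_at_cst. Qed.

Lemma smooth_at_sum p (I : Type) (r : seq I) (phi : I -> M -> R) :
  (forall i, smooth_at p (phi i)) -> smooth_at p (fun q => \sum_(i <- r) phi i q).
Proof.
move=> sphi; elim: r => [|i r IH].
  by under eq_fun do rewrite big_nil; exact: smooth_at_cst.
by under eq_fun do rewrite big_cons; exact: smooth_atD.
Qed.

Lemma smooth_at_prod p (I : Type) (r : seq I) (phi : I -> M -> R) :
  (forall i, smooth_at p (phi i)) -> smooth_at p (fun q => \prod_(i <- r) phi i q).
Proof.
move=> sphi; elim: r => [|i r IH].
  by under eq_fun do rewrite big_nil; exact: smooth_at_cst.
by under eq_fun do rewrite big_cons; exact: smooth_atM.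
Qed.

Lemma smooth_atV p phi : phi p != 0 -> smooth_at p phi ->
  smooth_at p (fun q => (phi q)^-1).
Proof.
(* Inversion is regarded as a function of rows of length 1, so that [smooth_at_comp] covers it. *)
move=> n0 sphi; pose V := [set x : 'rV[R]_1 | x 0 0 != 0].
have oV : open V.
  rewrite openE => x Vx.
  have oN : open [set y : R | y != 0] by exact: open_neq.
  exact: (@coord_continuous R 1 1 0 0 x _ (open_near oN Vx)).
have : smooth_at p (fun q => ((\row_(i < 1) phi q) 0 0)^-1).
  apply: (@smooth_at_comp 1 (fun x => (x 0 0)^-1) (fun q => \row_i phi q) V) => //.
  - by rewrite /V /= mxE.
  - by move=> k; apply: Ck_onV => //; exact: Ck_on_coord.
  - by move=> i; under eq_fun do rewrite mxE.
by under eq_fun do rewrite mxE.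
Qed.

Lemma smooth_at_continuous p phi : smooth_at p phi -> {for p, continuous phi}.
Proof.
move=> sphi; have [c ac cp] := atlas_cover p.
have [U [oU Up _ sU]] := sphi c ac cp.
apply: (@near_eq_continuous _ _ (fun q => (phi \o chart_param c) (chart_coord c q))).
  have nc := open_near (chart_dom_open c) cp.
  by apply: filterS nc => q cq /=; rewrite chart_coordK.
apply: (@continuous_comp _ _ _ (chart_coord c) (phi \o chart_param c)).
  exact: chart_coord_continuous.
exact: smooth_on_continuous sU Up.
Qed.

End Charts.

Section Tangent.
Variables (R : realType) (m : nat) (M : smooth_manifold R m).
Implicit Types (p q : M) (phi psi : M -> R) (c : chart R M m) (u v : operator M).

Lemma tangent_spaceP p a u v : tangent_space p u -> tangent_space p v ->
  tangent_space p (a *: u + v).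
Proof.
move=> [u1 u2 u3] [v1 v2 v3]; split=> [b phi psi sphi spsi|phi psi sphi spsi|phi nphi].
- rewrite -![(_ + _ : operator M) _]/(_ + _) -![(_ *: _ : operator M) _]/(_ *: _).
  rewrite u1// v1//= -![_ *: _]/(_ * _); ring.
- rewrite -![(_ + _ : operator M) _]/(_ + _) -![(_ *: _ : operator M) _]/(_ *: _).
  rewrite u2// v2//= -![_ *: _]/(_ * _); ring.
- rewrite -![(_ + _ : operator M) _]/(_ + _) -![(_ *: _ : operator M) _]/(_ *: _).
  by rewrite u3// v3// scaler0 addr0.
Qed.

Lemma tangent_space0 p : tangent_space p (0 : operator M).
Proof.
by split=> *; rewrite -![(0 : operator M) _]/0 ?mulr0 ?mul0r ?addr0.
Qed.

Lemma tangent_spaceZ p a u : tangent_space p u -> tangent_space p (a *: u).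
Proof.
by move=> Tu; rewrite -[a *: u]addr0; apply: tangent_spaceP => //;
  exact: tangent_space0.
Qed.

Lemma tangent_spaceD p u v : tangent_space p u -> tangent_space p v ->
  tangent_space p (u + v).
Proof. by move=> Tu Tv; rewrite -[u]scale1r; exact: tangent_spaceP. Qed.

Lemma tangent_spaceN p u : tangent_space p u -> tangent_space p (- u).
Proof. by move=> Tu; rewrite -scaleN1r; exact: tangent_spaceZ. Qed.

Lemma tangent_spaceB p u v : tangent_space p u -> tangent_space p v ->
  tangent_space p (u - v).
Proof. by move=> Tu Tv; apply: tangent_spaceD => //; exact: tangent_spaceN. Qed.

Lemma tangent_space_sum p (I : Type) (r : seq I) (u : I -> operator M) :
  (forall i, tangent_space p (u i)) -> tangent_space p (\sum_(i <- r) u i).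
Proof.
move=> Tu; elim: r => [|i r IH]; first by rewrite big_nil; exact: tangent_space0.
by rewrite big_cons; exact: tangent_spaceD.
Qed.

Section Derivation.
Variables (p : M) (v : operator M).
Hypothesis Tv : tangent_space p v.

Lemma tangent_cst (a : R) : v (fun=> a) = 0.
Proof.
have [v1 v2 _] := Tv; have s := @smooth_at_cst _ _ _ p.
have v0 : v (fun=> 0) = 0.
  have := v2 _ _ (s 0) (s 0); rewrite (_ : (fun _ => _) = (fun=> 0)).
    by rewrite mulr0 mul0r addr0.
  by apply/funext => q; rewrite mulr0.
have v11 : v (fun=> 1) = 0.
  have := v2 _ _ (s 1) (s 1); rewrite (_ : (fun _ => _) = (fun=> 1)).
    by rewrite mulr1 mul1r => e; apply: (addrI (v (fun=> 1))); rewrite addr0.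
  by apply/funext => q; rewrite mulr1.
have := v1 a _ _ (s 1) (s 0); by rewrite v11 v0 mulr0 !addr0 mulr1.
Qed.

Lemma tangentD phi psi : smooth_at p phi -> smooth_at p psi ->
  v (fun q => phi q + psi q) = v phi + v psi.
Proof.
move=> sphi spsi; have [v1 _ _] := Tv; have := v1 1 _ _ sphi spsi.
by rewrite mul1r => <-; congr (v _); apply/funext => q; rewrite mul1r.
Qed.

Lemma tangentZ a phi : smooth_at p phi -> v (fun q => a * phi q) = a * v phi.
Proof.
move=> sphi; have [v1 _ _] := Tv; have := v1 a _ _ sphi (@smooth_at_cst _ _ _ p 0).
rewrite tangent_cst addr0 => <-; congr (v _); apply/funext => q.
by rewrite addr0.
Qed.

Lemma tangentB phi psi : smooth_at p phi -> smooth_at p psi ->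
  v (fun q => phi q - psi q) = v phi - v psi.
Proof.
move=> sphi spsi; rewrite -mulN1r -tangentZ// -tangentD//; last exact: smooth_atZ.
by congr (v _); apply/funext => q; rewrite mulN1r.
Qed.

Lemma tangentM phi psi : smooth_at p phi -> smooth_at p psi ->
  v (fun q => phi q * psi q) = v phi * psi p + phi p * v psi.
Proof. by move=> sphi spsi; have [_ v2 _] := Tv; exact: v2. Qed.

Lemma tangent_sum (I : Type) (r : seq I) (phi : I -> M -> R) :
  (forall i, smooth_at p (phi i)) ->
  v (fun q => \sum_(i <- r) phi i q) = \sum_(i <- r) v (phi i).
Proof.
move=> sphi; elim: r => [|i r IH].
  by under eq_fun do rewrite big_nil; rewrite big_nil tangent_cst.
under eq_fun do rewrite big_cons; rewrite big_cons tangentD//.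
  by rewrite IH.
exact: smooth_at_sum.
Qed.

(* Locality needs no bump function: the indicator of a neighbourhood of p is
   smooth at p. *)
Lemma tangent_local phi psi : (\forall q \near p, phi q = psi q) -> v phi = v psi.
Proof.
move=> e; have [v1 v2 v3] := Tv.
have [sphi|nphi] := pselect (smooth_at p phi); last first.
  rewrite !v3// => spsi; apply: nphi; apply: eq_smooth_at spsi.
  by apply: filterS e => q.
have spsi : smooth_at p psi by exact: eq_smooth_at sphi.
pose chi q : R := if `[< phi q = psi q >] then 1 else 0.
have schi : smooth_at p chi.
  apply: (@eq_smooth_at _ _ _ _ (fun=> 1)); last exact: smooth_at_cst.
  by apply: filterS e => q eq; rewrite /chi asboolT.
have := tangentM (smooth_atD sphi (smooth_atZ (-1) spsi)) schi.
rewrite (_ : (fun q => _ * chi q) = (fun=> 0)); last first.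
  apply/funext => q; rewrite /chi; case: ifP => [/asboolP ->|_]; last by rewrite mulr0.
  by rewrite mulr1 mulN1r subrr.
have ep : phi p = psi p by exact: nbhs_singleton e.
rewrite tangent_cst tangentD//; last exact: smooth_atZ.
rewrite tangentZ// /chi asboolT// ep !mulN1r subrr mul0r addr0 mulr1 => /esym/eqP.
by rewrite subr_eq0 => /eqP.
Qed.

End Derivation.

Definition partial c (a : 'I_m) p : operator M := fun phi =>
  if `[< smooth_at p phi >]
  then 'D_(delta_mx 0 a) (phi \o chart_param c : _ -> R^o) (chart_coord c p)
  else 0.

Lemma partial_is_derive c a p phi : atlas c -> chart_dom c p -> smooth_at p phi ->
  is_derive (chart_coord c p) (delta_mx 0 a) (phi \o chart_param c : _ -> R)
    (partial c a p phi).
Proof.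
move=> ac cp sphi; rewrite /partial asboolT//.
by have [U [_ Up _ sU]] := sphi c ac cp; exact: smooth_on_is_derive sU Up.
Qed.

Lemma partial_tangent c a p : atlas c -> chart_dom c p ->
  tangent_space p (partial c a p).
Proof.
move=> ac cp; split=> [b phi psi sphi spsi|phi psi sphi spsi|phi nphi].
- have s := smooth_atD (smooth_atZ b sphi) spsi.
  have [_ <-] := partial_is_derive a ac cp s.
  have ? := partial_is_derive a ac cp sphi.
  have ? := partial_is_derive a ac cp spsi.
  have [_ <-//] : is_derive (chart_coord c p) (delta_mx 0 a)
    (b *: (phi \o chart_param c : _ -> R) + (psi \o chart_param c : _ -> R))
    (b *: partial c a p phi + partial c a p psi).
  by apply: is_deriveD.
- have s := smooth_atM sphi spsi.
  have [_ <-] := partial_is_derive a ac cp s.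
  have ? := partial_is_derive a ac cp sphi.
  have ? := partial_is_derive a ac cp spsi.
  have [_ h] : is_derive (chart_coord c p) (delta_mx 0 a)
    ((phi \o chart_param c : _ -> R) * (psi \o chart_param c : _ -> R))
    ((phi \o chart_param c) (chart_coord c p) *: partial c a p psi +
     (psi \o chart_param c) (chart_coord c p) *: partial c a p phi).
    exact: is_deriveM.
  rewrite -[LHS]/('D_(delta_mx 0 a) ((phi \o chart_param c : _ -> R) *
    (psi \o chart_param c : _ -> R)) (chart_coord c p)) h /= chart_coordK//.
  by rewrite addrC [_ *: _]mulrC.
- by rewrite /partial asboolF.
Qed.

Lemma near_chart c p : chart_dom c p -> \forall q \near p, chart_dom c q.
Proof. by apply: open_near; exact: chart_dom_open. Qed.

Lemma partial_smooth c a p phi : atlas c -> chart_dom c p -> smooth_at p phi ->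
  smooth_at p (fun q => partial c a q phi).
Proof.
move=> ac cp sphi; have [U [oU Up _ sU]] := sphi c ac cp.
apply: (@eq_smooth_at _ _ _ _ (fun q =>
  'D_(delta_mx 0 a) (phi \o chart_param c : _ -> R^o) (chart_coord c q))).
  by apply: filterS (smooth_at_near sphi) => q sq; rewrite /partial asboolT.
exact: smooth_at_chart_comp (smooth_on_derive a sU).
Qed.

(** By Hadamard's lemma [phi] is near [p] a constant plus a sum of terms (x_a - x_a(p)) h_a. The
    derivation kills the constant, and by the Leibniz rule only v(x_a) h_a(p) survives from each
    term, where h_a(p) is the partial derivative of [phi]. *)
Lemma tangent_expansion c p v : atlas c -> chart_dom c p -> tangent_space p v ->
  v = \sum_a v (fun q => chart_coord c q 0 a) *: partial c a p.
Proof.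
move=> ac cp Tv; apply/funext => phi; rewrite fct_sumE.
have [sphi|nphi] := pselect (smooth_at p phi); last first.
  have [_ _ ->//] := Tv; rewrite big1// => a _.
  rewrite -[LHS]/(_ *: partial c a p phi).
  by have [_ _ ->//] := partial_tangent a ac cp; rewrite scaler0.
have [U [oU Up _ sU]] := sphi c ac cp.
have [r [h [r0 bU sh h0 hE]]] := hadamard oU Up sU.
have b0 : ball (chart_coord c p) r (chart_coord c p) by exact: ballxx.
have sx a : smooth_at p (fun q => chart_coord c q 0 a).
  exact: smooth_at_coord.
have sh' a : smooth_at p (fun q => h a (chart_coord c q)).
  by apply: smooth_at_chart_comp (sh a) => //; exact: ball_open.
have sd a : smooth_at p (fun q => chart_coord c q 0 a - chart_coord c p 0 a).
  by apply: smooth_atD => //; exact: smooth_at_cst.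
rewrite (tangent_local Tv (psi := fun q => phi p +
  \sum_a (chart_coord c q 0 a - chart_coord c p 0 a) * h a (chart_coord c q))).
  rewrite (tangentD Tv); [|exact: smooth_at_cst|]; last first.
    by apply: smooth_at_sum => a; exact: smooth_atM.
  rewrite (tangent_cst Tv) add0r (tangent_sum Tv); last first.
    by move=> a; exact: smooth_atM.
  apply: eq_bigr => a _; rewrite (tangentM Tv)// subrr mul0r addr0.
  rewrite (tangentB Tv)//; last exact: smooth_at_cst.
  by rewrite (tangent_cst Tv) subr0 h0 -[RHS]/(_ * partial c a p phi) /partial asboolT.
have near_b : \forall q \near p, ball (chart_coord c p) r (chart_coord c q).
  exact: (chart_coord_continuous cp (open_near (ball_open _ _) b0)).
apply: filterS2 near_b (near_chart cp) => q bq cq.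
have := hE _ bq; rewrite /= !chart_coordK//.
Qed.

Lemma tangent_eq c p u v : atlas c -> chart_dom c p -> tangent_space p u ->
  tangent_space p v ->
  (forall a, u (fun q => chart_coord c q 0 a) = v (fun q => chart_coord c q 0 a)) ->
  u = v.
Proof.
move=> ac cp Tu Tv uv; rewrite (tangent_expansion ac cp Tu).
rewrite [RHS](tangent_expansion ac cp Tv).
by apply: eq_bigr => a _; rewrite uv.
Qed.

End Tangent.

(** * Moving frames and smooth maps *)

Section LinearSolve.
Variables (R : realType) (k : nat) (N : smooth_manifold R k).

Lemma smooth_at_det n (A : N -> 'M[R]_n) q :
  (forall i j, smooth_at q (fun x => A x i j)) -> smooth_at q (fun x => \det (A x)).
Proof.
move=> sA; rewrite /determinant; apply: smooth_at_sum => s.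
by apply: smooth_atZ; apply: smooth_at_prod => i.
Qed.

(** If B^T B v = 0 then the squared length of B v is 0, so B v = 0 as squares are nonnegative in
    [R]. *)
Lemma gram_det_neq0 m n (B : 'M[R]_(m, n)) :
  (forall w : 'cV[R]_n, B *m w = 0 -> w = 0) -> \det (B^T *m B) != 0.
Proof.
move=> injB; apply/negP => /det0P[v v0 vB]; move/eqP: v0; apply.
suff BvT : B *m v^T = 0 by rewrite -[v]trmxK (injB _ BvT) trmx0.
have : (B *m v^T)^T *m (B *m v^T) = 0.
  by rewrite trmx_mul trmxK -mulmxA [B^T *m _]mulmxA [v *m (_ *m _)]mulmxA vB mul0mx.
move=> /matrixP/(_ 0 0); rewrite !mxE => sq0.
apply/matrixP => i j; rewrite (ord1 j) [RHS]mxE.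
have /eqP := sq0; rewrite psumr_eq0 => [/allP/(_ i (mem_index_enum _))|l _].
  by rewrite mxE -expr2 sqrf_eq0 => /eqP.
by rewrite [X in X * _]mxE -expr2 sqr_ge0.
Qed.

(** The system may be overdetermined, so it is replaced by its normal equations, whose matrix [G] is
    square. Injectivity at [q] alone makes [\det (G q)] nonzero, continuity extends this to nearby
    points, and Cramer's rule gives a smooth formula for the unknowns, on which no regularity is
    assumed. *)
Lemma smooth_linear_solve m n (B : 'I_m -> 'I_n -> N -> R) (z : 'I_m -> N -> R)
    (c : 'I_n -> N -> R) q :
  (forall j a, smooth_at q (B j a)) -> (forall j, smooth_at q (z j)) ->
  (\forall x \near q, forall j, \sum_a B j a x * c a x = z j x) ->
  (forall w : 'I_n -> R, (forall j, \sum_a B j a q * w a = 0) -> forall a, w a = 0) ->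
  forall a, smooth_at q (c a).
Proof.
move=> sB sz Bcz injB a.
pose Bm x : 'M[R]_(m, n) := \matrix_(j, a) B j a x.
pose G x := (Bm x)^T *m Bm x.
have sG i j : smooth_at q (fun x => G x i j).
  have -> : (fun x => G x i j) = (fun x => \sum_l B l i x * B l j x).
    by apply/funext => x; rewrite !mxE; apply: eq_bigr => l _; rewrite !mxE.
  by apply: smooth_at_sum => l; exact: smooth_atM.
have sdet : smooth_at q (fun x => \det (G x)) by exact: smooth_at_det.
have det0 : \det (G q) != 0.
  apply: gram_det_neq0 => w Bw; apply/matrixP => i j; rewrite (ord1 j) [RHS]mxE.
  apply: (injB (fun i => w i 0)) => l.
  have := congr1 (fun A : 'cV_m => A l 0) Bw; rewrite [X in _ = X]mxE /= => e.
  by apply: etrans _ e; rewrite [RHS]mxE; apply: eq_bigr => b _; rewrite mxE.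
have sadj i j : smooth_at q (fun x => (\adj (G x)) i j).
  have -> : (fun x => (\adj (G x)) i j) =
      (fun x => (-1) ^+ (j + i) * \det (row' j (col' i (G x)))).
    by apply/funext => x; rewrite mxE.
  apply: smooth_atZ; apply: smooth_at_det => i' j'.
  by have -> : (fun x => (row' j (col' i (G x))) i' j') =
    (fun x => G x (lift j i') (lift i j')) by apply/funext => x; rewrite !mxE.
pose sol x := (\det (G x))^-1 *
  \sum_b (\adj (G x)) a b * \sum_l B l b x * z l x.
have ssol : smooth_at q sol.
  apply: smooth_atM; first exact: smooth_atV.
  apply: smooth_at_sum => b; apply: smooth_atM => //.
  by apply: smooth_at_sum => l; exact: smooth_atM.
apply: eq_smooth_at ssol.
have oN : open [set y : R | y != 0] by exact: open_neq.
have near_det : \forall x \near q, \det (G x) != 0.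
  exact: (smooth_at_continuous sdet (open_near oN det0)).
apply: filterS2 near_det Bcz => x dx Bcx; rewrite /sol.
pose cv : 'cV[R]_n := \col_a c a x.
have zE l : z l x = (Bm x *m cv) l 0.
  by rewrite -Bcx mxE; apply: eq_bigr => b _; rewrite !mxE.
have -> : \sum_b (\adj (G x)) a b * \sum_l B l b x * z l x =
    (\adj (G x) *m (G x *m cv)) a 0.
  rewrite mxE; apply: eq_bigr => b _; congr (_ * _).
  rewrite -mulmxA mxE; apply: eq_bigr => l _.
  by rewrite zE !mxE.
by rewrite mulmxA mul_adj_mx mul_scalar_mx !mxE mulKf.
Qed.

End LinearSolve.

Section Maps.
Variables (R : realType) (k m : nat).
Variables (N : smooth_manifold R k) (M : smooth_manifold R m).
Implicit Types (iota : N -> M) (q : N).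

Lemma smooth_at_pullback iota q d (Phi : M -> R) : {for q, continuous iota} ->
  atlas d -> chart_dom d (iota q) ->
  (forall j, smooth_at q (fun q' => chart_coord d (iota q') 0 j)) ->
  smooth_at (iota q) Phi -> smooth_at q (fun q' => Phi (iota q')).
Proof.
move=> ci ad dq sd sPhi; have [U [oU Uq _ sU]] := sPhi d ad dq.
have s := @smooth_at_comp _ _ _ _ (Phi \o chart_param d)
  (fun q' => chart_coord d (iota q')) U q oU Uq sU sd.
have nd : \forall q' \near q, chart_dom d (iota q') := ci _ (near_chart dq).
apply: eq_smooth_at s.
by apply: filterS nd => q' dq' /=; rewrite chart_coordK.
Qed.

Lemma smooth_map_pullback iota q (Phi : M -> R) : smooth_map iota ->
  smooth_at (iota q) Phi -> smooth_at q (fun q' => Phi (iota q')).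
Proof.
move=> [ci si]; have [d ad dq] := atlas_cover (iota q).
exact: (smooth_at_pullback (ci q) ad dq (si q d ad dq)).
Qed.

Lemma tangent_mapE iota q v (Phi : M -> R) : smooth_at (iota q) Phi ->
  tangent_map iota q v Phi = v (fun q' => Phi (iota q')).
Proof. by move=> s; rewrite /tangent_map asboolT. Qed.

Lemma tangent_map_tangent iota q v : smooth_map iota -> tangent_space q v ->
  tangent_space (iota q) (tangent_map iota q v).
Proof.
move=> si Tv; split=> [a Phi Psi sPhi sPsi|Phi Psi sPhi sPsi|Phi nPhi].
- rewrite !tangent_mapE//; last exact: smooth_atD (smooth_atZ a sPhi) sPsi.
  have sPhi' := smooth_map_pullback si sPhi.
  have sPsi' := smooth_map_pullback si sPsi.
  by have [v1 _ _] := Tv; exact: (v1 a _ _ sPhi' sPsi').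
- rewrite !tangent_mapE//; last exact: smooth_atM.
  have sPhi' := smooth_map_pullback si sPhi.
  have sPsi' := smooth_map_pullback si sPsi.
  by have [_ v2 _] := Tv; exact: (v2 _ _ sPhi' sPsi').
- by rewrite /tangent_map asboolF.
Qed.

Lemma tangent_mapP iota q a (u v : operator N) :
  tangent_map iota q (a *: u + v) = a *: tangent_map iota q u + tangent_map iota q v.
Proof.
apply/funext => Phi; rewrite -[RHS]/(a *: tangent_map iota q u Phi + _) /tangent_map.
by case: ifP => // _; rewrite scaler0 addr0.
Qed.

Lemma tangent_map0 iota q : tangent_map iota q 0 = 0.
Proof. by apply/funext => Phi; rewrite /tangent_map; case: ifP. Qed.

Lemma tangent_mapZ iota q a (u : operator N) :
  tangent_map iota q (a *: u) = a *: tangent_map iota q u.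
Proof. by rewrite -[a *: u]addr0 tangent_mapP tangent_map0 addr0. Qed.

Lemma tangent_mapD iota q (u v : operator N) :
  tangent_map iota q (u + v) = tangent_map iota q u + tangent_map iota q v.
Proof. by rewrite -[u]scale1r tangent_mapP !scale1r. Qed.

Lemma tangent_mapB iota q (u v : operator N) :
  tangent_map iota q (u - v) = tangent_map iota q u - tangent_map iota q v.
Proof. by rewrite tangent_mapD -scaleN1r tangent_mapZ scaleN1r. Qed.

Lemma tangent_map_sum iota q (I : Type) (r : seq I) (u : I -> operator N) :
  tangent_map iota q (\sum_(i <- r) u i) = \sum_(i <- r) tangent_map iota q (u i).
Proof.
elim: r => [|i r IH]; first by rewrite !big_nil tangent_map0.
by rewrite !big_cons tangent_mapD IH.
Qed.

Lemma immersion_inj0 iota q v : immersed_submanifold iota ->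
  tangent_space q v -> tangent_map iota q v = 0 -> v = 0.
Proof.
move=> [_ _ inj] Tv v0; apply: (inj q) => //; rewrite ?inE ?tangent_map0//.
exact: tangent_space0.
Qed.

End Maps.

Section VectorFields.
Variables (R : realType) (m : nat) (M : smooth_manifold R m).
Implicit Types (p : M) (c : chart R M m) (X Y Z : M -> operator M).

Lemma partial_coord c p a b : atlas c -> chart_dom c p ->
  partial c a p (fun q => chart_coord c q 0 b) = (b == a)%:R.
Proof.
move=> ac cp; have [_ <-] := partial_is_derive a ac cp (smooth_at_coord b ac cp).
have cip := chart_image_coord cp.
have [_ <-] : is_derive (chart_coord c p) (delta_mx 0 a)
    (fun x => chart_coord c (chart_param c x) 0 b : R) (b == a)%:R; last by [].
apply: near_eq_is_derive (is_derive_coord _ b a).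
have nc := open_near (@chart_coord_open _ _ _ c : open (chart_image c)) cip.
have nx : \forall x \near chart_coord c p, (x : 'rV[R]_m) 0 b = chart_coord c (chart_param c x) 0 b.
  by apply: filterS nc => x cx; rewrite chart_paramK.
exact: nx.
Qed.

Lemma vector_field_coordinates X c p (x : 'I_m -> M -> R) :
  (forall q, tangent_space q (X q)) -> atlas c -> chart_dom c p ->
  (\forall q \near p, forall a, X q (fun q' => chart_coord c q' 0 a) = x a q) ->
  (forall a, smooth_at p (x a)) ->
  forall phi, smooth_at p phi -> smooth_at p (fun q => X q phi).
Proof.
move=> TX ac cp Xx sx phi sphi.
apply: (@eq_smooth_at _ _ _ _ (fun q => \sum_a x a q * partial c a q phi)).
  apply: filterS2 Xx (near_chart cp) => q Xxq cq.
  rewrite [X q](tangent_expansion ac cq (TX q)) fct_sumE.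
  by apply: eq_bigr => a _; rewrite Xxq.
apply: smooth_at_sum => a; apply: smooth_atM => //; exact: partial_smooth.
Qed.

Lemma vector_fieldD X Y : vector_field X -> vector_field Y ->
  vector_field (fun p => X p + Y p).
Proof.
move=> [TX sX] [TY sY]; split=> [p|p phi sphi]; first exact: tangent_spaceD.
by apply: smooth_atD; [exact: sX|exact: sY].
Qed.

Lemma vector_fieldM (h : M -> R) X : smooth_function h -> vector_field X ->
  vector_field (fun p => h p *: X p).
Proof.
move=> sh [TX sX]; split=> [p|p phi sphi]; first exact: tangent_spaceZ.
by apply: smooth_atM; [exact: sh|exact: sX].
Qed.

Lemma vector_field0 : vector_field (fun p => 0 : operator M).
Proof.
split=> [p|p phi sphi]; first exact: tangent_space0.
exact: smooth_at_cst.
Qed.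

Lemma vector_field_sum (I : Type) (r : seq I) (X : I -> M -> operator M) :
  (forall i, vector_field (X i)) -> vector_field (fun p => \sum_(i <- r) X i p).
Proof.
move=> vX; elim: r => [|i r IH].
  by under eq_fun do rewrite big_nil; exact: vector_field0.
by under eq_fun do rewrite big_cons; exact: vector_fieldD.
Qed.

Lemma vector_fieldB X Y : vector_field X -> vector_field Y ->
  vector_field (fun p => X p - Y p).
Proof.
move=> vX vY; under eq_fun do rewrite -scaleN1r.
apply: vector_fieldD => //; apply: vector_fieldM => // p; exact: smooth_at_cst.
Qed.

Definition independent_fields s (X : 'I_s -> M -> operator M) :=
  forall p (w : 'I_s -> R), \sum_a w a *: X a p = 0 -> forall a, w a = 0.

(* Solving in a chart, Cramer's rule makes the coefficients of a vector field
   in a moving frame smooth. *)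
Lemma frame_coefficients_smooth s (X : 'I_s -> M -> operator M) Z
    (h : 'I_s -> M -> R) : (forall a, vector_field (X a)) ->
  independent_fields X -> vector_field Z ->
  (forall p, Z p = \sum_a h a p *: X a p) -> forall a, smooth_function (h a).
Proof.
move=> vX iX vZ Zh a p; have [c ac cp] := atlas_cover p.
have sx j : smooth_at p (fun q => chart_coord c q 0 j) by exact: smooth_at_coord.
apply: (smooth_linear_solve (B := fun j a q => X a q (fun q' => chart_coord c q' 0 j))
  (z := fun j q => Z q (fun q' => chart_coord c q' 0 j))) => [j b|j||w w0].
- by apply: (vX b).2; exact: sx.
- by apply: vZ.2; exact: sx.
- apply: nearW => q j; rewrite Zh fct_sumE; apply: eq_bigr => b _.
  by rewrite mulrC.
- apply: (iX p); apply: (tangent_eq ac cp).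
  + by apply: tangent_space_sum => b; apply: tangent_spaceZ; exact: (vX b).1.
  + exact: tangent_space0.
  + move=> j; rewrite fct_sumE -[RHS](w0 j); apply: eq_bigr => b _.
    by rewrite mulrC.
Qed.

End VectorFields.

Section Lift.
Variables (R : realType) (k m : nat).
Variables (N : smooth_manifold R k) (M : smooth_manifold R m).

(** The chart components of [Y] solve a linear system with the Jacobian of [iota] as its matrix and
    the components of [X] along [iota] as right-hand side. The Jacobian is injective because [iota]
    is an immersion, so lifts chosen point by point are automatically smooth. *)
Lemma lift_vector_field (iota : N -> M) (X : M -> operator M) (Y : N -> operator N) :
  immersed_submanifold iota -> vector_field X ->
  (forall q, tangent_space q (Y q)) ->
  (forall q, tangent_map iota q (Y q) = X (iota q)) -> vector_field Y.
Proof.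
move=> im [TX sX] TY YX; split=> // q phi sphi.
have [si _ _] := im.
have [c ac cq] := atlas_cover q; have [d ad dq] := atlas_cover (iota q).
pose x j (p : M) := chart_coord d p 0 j.
have near_d : \forall q' \near q, chart_dom d (iota q').
  exact: (si.1 q _ (near_chart dq)).
have sxi j q' : chart_dom d (iota q') -> smooth_at q' (fun q => x j (iota q)).
  by move=> dq'; apply: smooth_map_pullback => //; exact: smooth_at_coord.
apply: (@vector_field_coordinates _ _ _ _ c _
  (fun a q' => Y q' (fun q' => chart_coord c q' 0 a))) sphi => //.
  exact: nearW.
apply: (smooth_linear_solve (B := fun j a q' => partial c a q' (fun q' => x j (iota q')))
  (z := fun j q' => X (iota q') (x j))) => [j a|j||w w0].
- by apply: partial_smooth => //; exact: sxi.
- apply: (smooth_map_pullback (Phi := fun p => X p (x j)) si).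
  by apply: sX; exact: smooth_at_coord.
- apply: filterS2 near_d (near_chart cq) => q' dq' cq' j.
  rewrite -YX tangent_mapE; last exact: smooth_at_coord.
  rewrite [Y q' in RHS](tangent_expansion ac cq' (TY q')) fct_sumE.
  by apply: eq_bigr => a _; rewrite mulrC.
- pose u : operator N := \sum_a w a *: partial c a q.
  have Tu : tangent_space q u.
    by apply: tangent_space_sum => a; apply: tangent_spaceZ; exact: partial_tangent.
  have u0 : u = 0.
    apply: (immersion_inj0 im Tu); apply: (tangent_eq ad dq).
    + exact: tangent_map_tangent.
    + exact: tangent_space0.
    + move=> j; rewrite tangent_mapE; last exact: smooth_at_coord.
      rewrite /u fct_sumE -[RHS](w0 j); apply: eq_bigr => a _.
      by rewrite mulrC.
  move=> a; have := congr1 (fun v : operator N => v (fun q' => chart_coord c q' 0 a)) u0.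
  rewrite /u fct_sumE -[X in _ = X -> _]/(0 : R) => <-; rewrite (bigD1 a)//= big1 => [|b ba].
    by rewrite addr0 -[RHS]/(_ * partial _ _ _ _) partial_coord// eqxx mulr1.
  by rewrite -[LHS]/(_ * partial _ _ _ _) partial_coord// eq_sym (negbTE ba) mulr0.
Qed.

End Lift.

(** * Integrability of commuting frames *)

Lemma rV_second_countable (R : realType) s : @second_countable 'rV[R]_s.
Proof.
pose rad (n : nat) : R := n.+1%:R^-1.
have rad0 n : 0 < rad n by rewrite invr_gt0.
pose center (q : 'rV[rat]_s) : 'rV[R]_s := \row_i (ratr (q 0 i) : R).
pose B (qn : 'rV[rat]_s * nat) : set 'rV[R]_s := ball (center qn.1) (rad qn.2).
exists (range B).
  exact: card_le_trans (card_image_le _ _) (countableP _).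
split=> [_ [qn _ <-]|x A /nbhs_ballP[e e0 eA]]; first exact: ball_open.
have [n ne] : exists n, rad n < e / 2.
  have e20 : 0 < e / 2 by rewrite divr_gt0.
  exists (Num.bound (e / 2)^-1).
  rewrite /rad invf_plt ?posrE// (lt_trans (archi_boundP _)) ?ltr_nat//.
  by rewrite ltW// invr_gt0.
have /choice[q qP] i : exists q : rat, `|x 0 i - ratr q| < rad n.
  have [q] := @rat_in_itvoo R (x 0 i - rad n) (x 0 i + rad n)
    ltac:(by rewrite ltrD2l gtrN).
  by rewrite in_itv /= => /andP[q1 q2]; exists q; rewrite ltr_norml; lra.
pose c := center (\row_i q i).
have xB : ball c (rad n) x.
  by split=> // i j; rewrite (ord1 i) !mxE /= /ball /= distrC.
exists (B (\row_i q i, n)); first by split; first by exists (\row_i q i, n).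
rewrite /B /= => y By.
apply: eA; rewrite (splitr e); apply: (@ball_triangle _ _ c).
  by apply: ball_sym; apply: le_ball xB; exact: ltW.
by apply: le_ball By; exact: ltW.
Qed.

Section BallManifold.
Variables (R : realType) (s : nat) (d : R).
Hypothesis d0 : 0 < d.
Implicit Types x t : 'rV[R]_s.

Definition shrink t : 'rV[R]_s := (d / (1 + `|t|)) *: t.
Definition grow x : 'rV[R]_s := (d - `|x|)^-1 *: x.

Let t1 t : 0 < 1 + `|t|.
Proof. by rewrite ltr_wpDr. Qed.

Lemma shrink_norm t : `|shrink t| = d - d / (1 + `|t|).
Proof.
rewrite normrZ ger0_norm; last by rewrite divr_ge0 ?ltW.
have := lt0r_neq0 (t1 t); move: `|t| => u u0; field.
exact: u0.
Qed.

Lemma shrink_lt t : `|shrink t| < d.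
Proof. by rewrite shrink_norm gtrBl divr_gt0. Qed.

Lemma shrinkK t : grow (shrink t) = t.
Proof.
rewrite /grow shrink_norm opprB addrCA subrr addr0 /shrink scalerA.
by rewrite mulVf ?scale1r// mulf_neq0 ?invr_neq0 ?lt0r_neq0.
Qed.

Lemma growK x : `|x| < d -> shrink (grow x) = x.
Proof.
move=> xd; have dx : 0 < d - `|x| by rewrite subr_gt0.
rewrite /shrink /grow normrZ ger0_norm ?invr_ge0 ?(ltW dx)// scalerA.
rewrite (_ : _ * _ = 1) ?scale1r//.
have dxn := lt0r_neq0 dx; have dn := lt0r_neq0 d0.
have -> : 1 + (d - `|x|)^-1 * `|x| = d / (d - `|x|) by field.
by field; rewrite dxn dn.
Qed.

Lemma in_ball0 x : ball 0 d x <-> `|x| < d.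
Proof. by rewrite -ball_normE /ball_ /= sub0r normrN. Qed.

Lemma shrink_image : shrink @` setT = ball 0 d.
Proof.
apply/seteqP; split=> [_ [t _ <-]|x /in_ball0 xd].
  by apply/in_ball0; exact: shrink_lt.
by exists (grow x) => //; exact: growK.
Qed.

Lemma continuous_scale_id (k : 'rV[R]_s -> R) x : {for x, continuous k} ->
  {for x, continuous (fun y => k y *: y)}.
Proof. by move=> ck; exact: (@continuousZ _ _ _ k id x ck (fun _ => id)). Qed.

Lemma shrink_continuous : continuous shrink.
Proof.
move=> t; apply: continuous_scale_id; apply: continuousM; first exact: cst_continuous.
apply: continuousV; first by rewrite lt0r_neq0.
by apply: continuousD; [exact: cst_continuous|exact: norm_continuous].
Qed.

Lemma grow_continuous x : `|x| < d -> {for x, continuous grow}.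
Proof.
move=> xd; apply: continuous_scale_id.
apply: continuousV; first by rewrite lt0r_neq0// subr_gt0.
by apply: continuousB; [exact: cst_continuous|exact: norm_continuous].
Qed.

Definition ball_chart : chart R 'rV[R]_s s.
Proof.
apply: (@Chart R 'rV[R]_s s setT shrink grow).
- exact: openT.
- by rewrite shrink_image; exact: ball_open.
- by move=> t _; exact: shrink_continuous.
- by move=> x; rewrite shrink_image => /in_ball0; exact: grow_continuous.
- by move=> t _; exact: shrinkK.
Defined.

(* The ball as a manifold carried by the whole space: the chart need only be a
   homeomorphism, so the radial rescaling does not have to be smooth at 0. *)
Definition ball_manifold : smooth_manifold R s.
Proof.
apply: (@SmoothManifold R s 'rV[R]_s [set ball_chart]).
- exact: norm_hausdorff.
- exact: rV_second_countable.
- by move=> p; exists ball_chart.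
- move=> _ _ -> -> j k.
  have -> : chart_coord ball_chart @` (chart_dom ball_chart `&` chart_dom ball_chart)
      = ball 0 d by rewrite setIid -shrink_image.
  apply: (@eq_Ck_on _ _ k _ (fun x : 'rV[R]_s => x 0 j)).
  + exact: ball_open.
  + by move=> x /in_ball0 xd /=; rewrite growK.
  + by apply: Ck_on_coord; exact: ball_open.
Defined.

End BallManifold.

(** Since [A] inverts the Jacobian at 0, composing [iota] with [A] and subtracting the identity
    gives a map [y] with zero derivative at 0, hence 1/2-Lipschitz nearby. If [iota u = iota v],
    then [y] changes by exactly [v - u], which forces [u = v]. *)
Lemma local_injective (R : realType) m s (iota : 'rV[R]_s -> 'rV[R]_m) (d : R)
    (A : 'M[R]_(m, s)) : 0 < d ->
  (forall j, smooth_on (ball 0 d) (fun u => iota u 0 j)) ->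
  (\matrix_(a, j) 'D_(delta_mx 0 a) (fun u => iota u 0 j : R^o) 0) *m A = 1%:M ->
  exists e, [/\ 0 < e, e <= d & forall u v, ball 0 e u -> ball 0 e v ->
    iota u = iota v -> u = v].
Proof.
move=> d0 si DA.
have b0 : ball (0 : 'rV[R]_s) d 0 by exact: ballxx.
pose y b (u : 'rV[R]_s) : R := \sum_j iota u 0 j * A j b + -1 * u 0 b.
have sy b : smooth_on (ball 0 d) (y b).
  move=> k; have ob : open (ball (0 : 'rV[R]_s) d) by exact: ball_open.
  apply: Ck_onD => //; last first.
    by apply: Ck_onM => //; [exact: Ck_on_cst|exact: Ck_on_coord].
  apply: Ck_on_sum => // j; apply: Ck_onM => //; last exact: Ck_on_cst.
  exact: si.
have dy0 b a : 'D_(delta_mx 0 a) (y b : _ -> R^o) 0 = 0.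
  have [_ ->] // : is_derive (0 : 'rV[R]_s) (delta_mx 0 a) (y b) 0.
  have -> : 0 = \sum_j A j b *: 'D_(delta_mx 0 a) (fun u => iota u 0 j : R^o) 0
      + -1 *: (b == a)%:R.
    have /matrixP/(_ a b) := DA; rewrite !mxE => e.
    rewrite scaleN1r eq_sym -e; apply/esym/eqP; rewrite subr_eq0; apply/eqP.
    by apply: eq_bigr => j _; rewrite mxE mulrC.
  have -> : y b = \sum_j (A j b *: (fun u => iota u 0 j : R)) +
      -1 *: (fun u : 'rV[R]_s => u 0 b : R).
    apply/funext => u; rewrite -[RHS]/((\sum_j _) u + _) fct_sumE /y.
    by congr (_ + _); apply: eq_bigr => j _; rewrite mulrC.
  apply: is_deriveD; last by apply: is_deriveZ; exact: is_derive_coord.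
  apply: is_derive_sum => j; apply: is_deriveZ.
  exact: smooth_on_is_derive (si j) b0.
(* [partial_derive_le] loses a factor [s]; this choice makes [s%:R * K] at most 1/2, and [s%:R + 1]
   is nonzero for every [s]. *)
pose K : R := (2 * (s%:R + 1))^-1.
have K0 : 0 < K by rewrite invr_gt0 mulr_gt0// ltr_wpDl.
have near_K : \forall u \near (0 : 'rV[R]_s), forall b a,
    `|'D_(delta_mx 0 a) (y b : _ -> R^o) u| < K.
  have h b a : \forall u \near (0 : 'rV[R]_s),
      `|'D_(delta_mx 0 a) (y b : _ -> R^o) u| < K.
    have := smooth_on_continuous (smooth_on_derive a (sy b)) b0.
    move=> /cvgrPdist_lt/(_ K K0); apply: filterS => u.
    by rewrite dy0 sub0r normrN.
  exact: (filter_forall _ (fun b => filter_forall _ (h b))).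
have [e e0 eK] := (nbhs_ballP _ _).1 near_K.
pose r := Num.min (e / 2) (d / 2).
have r0 : 0 < r by rewrite lt_min !divr_gt0.
have rle (z : 'rV[R]_s) : `|z - 0| <= r -> ball 0 e z /\ ball 0 d z.
  rewrite subr0 -!ball_normE /ball_ /= !sub0r !normrN => zr.
  have re : r <= e / 2 by rewrite ge_min lexx.
  have rd : r <= d / 2 by rewrite ge_min lexx orbT.
  have e0' : 0 < e by exact: e0.
  by split; lra.
exists r; split=> //.
  have rd : r <= d / 2 by rewrite ge_min lexx orbT.
  by lra.
move=> u v; rewrite -!ball_normE /ball_ /= !sub0r !normrN => ur vr iuv.
apply/eqP; rewrite -subr_eq0 -normr_le0.
suff : `|u - v| <= s%:R * K * `|u - v|.
  have : s%:R * K <= 2^-1.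
    rewrite /K invfM mulrCA ler_piMr ?invr_ge0// ler_pdivrMr ?ltr_wpDl//.
    by rewrite mul1r lerDl.
  move=> cle tle; have := ler_wpM2r (normr_ge0 (u - v)) cle; lra.
apply: norm_le_coord => [|b].
  by rewrite !mulr_ge0// ltW.
have -> : (u - v) 0 b = - (y b u - y b v).
  by rewrite !mxE /y iuv; ring.
rewrite normrN; apply: (@partial_derive_le _ _ _
  (fun a => 'D_(delta_mx 0 a) (y b : _ -> R^o)) 0 r); rewrite ?subr0 ?ltW//.
move=> z /rle[ze zd] a; split; last exact/ltW/eK.
exact: smooth_on_is_derive (sy b) zd.
Qed.

Definition field_span (R : realType) m s (M : smooth_manifold R m)
    (X : 'I_s -> M -> operator M) (p : M) : set (operator M) :=
  [set u | exists w : 'I_s -> R, u = \sum_a w a *: X a p].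

(** The local action is built in a chart, then restricted to a ball of radius [e] on which it is
    injective, as [immersed_submanifold] requires. *)
Theorem commuting_fields_integrable (R : realType) m s (M : smooth_manifold R m)
    (X : 'I_s -> M -> operator M) :
  (forall a, vector_field (X a)) -> independent_fields X ->
  (forall a b p, lie_bracket (X a) (X b) p = 0) ->
  integrable_distribution s (field_span X).
Proof.
move=> vX iX commX p; have [c ac cp] := atlas_cover p.
pose x j (q : M) := chart_coord c q 0 j.
have sx j q : chart_dom c q -> smooth_at q (x j) by exact: smooth_at_coord.
pose phi (aj : 'I_s * 'I_m) (q : M) : R := X aj.1 q (x aj.2).
have sphi aj : smooth_at p (phi aj) by apply: (vX _).2; exact: sx.
have [U [oU Up Uc sU]] := smooth_at_family ac cp sphi.
pose V a y : 'rV[R]_m := \row_j X a (chart_param c y) (x j).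
have sV a j : smooth_on U (fun y => V a y 0 j).
  by under eq_fun do rewrite mxE; exact: (sU (a, j)).
have expand a y phi' : U y -> X a (chart_param c y) phi' =
    \sum_l V a y 0 l * partial c l (chart_param c y) phi'.
  move=> /Uc cy; have dy := chart_param_dom cy.
  rewrite {1}(tangent_expansion ac dy ((vX a).1 _)) fct_sumE.
  by apply: eq_bigr => l _; rewrite mxE.
(* The vanishing bracket evaluated on the coordinate function [x j]. *)
have commV a b j y : U y ->
    \sum_l V a y 0 l * 'D_(delta_mx 0 l) (fun y => V b y 0 j : R^o) y =
    \sum_l V b y 0 l * 'D_(delta_mx 0 l) (fun y => V a y 0 j : R^o) y.
  move=> Uy; have dy := chart_param_dom (Uc _ Uy).
  have := congr1 (fun v : operator M => v (x j)) (commX a b (chart_param c y)).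
  rewrite /lie_bracket asboolT; last exact: sx.
  have sXx d : smooth_at (chart_param c y) (fun q => X d q (x j)).
    by apply: (vX d).2; exact: sx.
  have D d e : X d (chart_param c y) (fun q => X e q (x j)) =
      \sum_l V d y 0 l * 'D_(delta_mx 0 l) (fun y => V e y 0 j : R^o) y.
    rewrite expand//; apply: eq_bigr => l _; congr (_ * _).
    rewrite /partial asboolT// chart_paramK; last exact: Uc.
    by congr ('D__ _ _); apply/funext => z; rewrite !mxE.
  by rewrite !D => /eqP; rewrite subr_eq0 => /eqP.
have [d [iota [d0 i0 iU id si]]] := commuting_local_action oU Up sV commV.
have iX0 y : U y -> forall w : 'I_s -> R, \sum_a w a *: V a y = 0 -> forall a, w a = 0.
  move=> Uy w wV; have dy := chart_param_dom (Uc _ Uy).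
  apply: (iX (chart_param c y)); apply: (tangent_eq ac dy).
  - by apply: tangent_space_sum => a; apply: tangent_spaceZ; exact: (vX a).1.
  - exact: tangent_space0.
  - move=> j; rewrite fct_sumE; have := congr1 (fun v : 'rV_m => v 0 j) wV.
    rewrite [X in _ = X]mxE summxE => e; apply: etrans _ e.
    by apply: eq_bigr => a _; rewrite !mxE.
have b0 : ball (0 : 'rV[R]_s) d 0 by exact: ballxx.
(* The rows of the Jacobian at 0 are the vectors [V a (iota 0)], independent because the [X a] are;
   a row-free matrix has a right inverse. *)
have [A DA] : exists A : 'M[R]_(m, s), (\matrix_(a, j)
    'D_(delta_mx 0 a) (fun u => iota u 0 j : R^o) 0) *m A = 1%:M.
  apply/row_freeP; apply: inj_row_free => v vD.
  apply/rowP => a; rewrite [RHS]mxE.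
  apply: (iX0 (iota 0) (iU _ b0) (fun a => v 0 a)).
  apply: etrans _ vD; apply/rowP => j; rewrite summxE [RHS]mxE.
  by apply: eq_bigr => b _; rewrite !mxE; have [_ ->] := id 0 b j b0; rewrite mxE.
have [e [e0 ed inj]] := local_injective d0 si DA.
have bed : ball (0 : 'rV[R]_s) e `<=` ball 0 d by exact: le_ball.
pose N := ball_manifold s e0; pose bc : chart R N s := ball_chart s e0.
have abc : atlas bc by [].
pose J : N -> M := fun q => chart_param c (iota (shrink e q)).
have shrink_ball (q : N) : ball (0 : 'rV[R]_s) e (shrink e q).
  by apply/in_ball0; exact: shrink_lt.
have UJ (q : N) : U (iota (shrink e q)) by apply/iU/bed.
have dJ (q : N) : chart_dom c (J q) by apply/chart_param_dom/Uc/UJ.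
have xJ (q : N) j : x j (J q) = iota (shrink e q) 0 j.
  by rewrite /x /J chart_paramK//; exact: Uc.
have sxJ (q : N) j : smooth_at q (fun q => x j (J q)).
  under eq_fun do rewrite xJ.
  apply: (@smooth_at_chart_comp _ _ N q bc (fun u => iota u 0 j) (ball 0 e)) => //.
  - exact: ball_open.
  - exact: shrink_ball.
  - by move=> k; apply: Ck_on_sub (si j k).
have cJ : continuous J.
  move=> q; apply: (@continuous_comp _ _ _ (shrink e) (fun u => chart_param c (iota u))).
    exact: shrink_continuous.
  apply: (@continuous_comp _ _ _ iota (chart_param c)).
    apply: continuous_rV => j; apply: (smooth_on_continuous (si j)); exact/bed.
  by apply: chart_param_continuous; exact/Uc/UJ.
have sJ : smooth_map J.
  split=> // q d' ad' dq j.
  exact: (smooth_at_pullback (Phi := fun p => chart_coord d' p 0 j) (cJ q) ac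
    (dJ q) (sxJ q) (smooth_at_coord j ad' dq)).
(* The ball carries the coordinates of the parameter, so its coordinate fields are sent to the given
   frame. Tangency and injectivity of the differential both follow from this. *)
have push (q : N) a : tangent_map J q (partial bc a q) = X a (J q).
  apply: (tangent_eq ac (dJ q)).
  - by apply: tangent_map_tangent => //; exact: partial_tangent.
  - exact: (vX a).1.
  - move=> j; rewrite tangent_mapE; last exact: sx.
    have [_ <-] := @partial_is_derive R s N bc a q _ abc Logic.I (sxJ q j).
    have [_ Dv] : is_derive (chart_coord bc q) (delta_mx 0 a)
        ((fun q => x j (J q)) \o chart_param bc : _ -> R) (V a (iota (shrink e q)) 0 j).
      have nb : \forall u \near shrink e q, ball (0 : 'rV[R]_s) e u.
        by apply: open_near => //; exact: ball_open.
      have near_e : \forall u \near shrink e q,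
          iota u 0 j = ((fun q => x j (J q)) \o chart_param bc) u.
        by apply: filterS nb => u /in_ball0 ue /=; rewrite xJ growK.
      by apply: near_eq_is_derive near_e _; apply: id; exact: bed.
    by apply: (etrans Dv); rewrite mxE.
have expN (q : N) v : tangent_space q v -> exists w : 'I_s -> R,
    v = \sum_a w a *: partial bc a q.
  move=> Tv; exists (fun a => v (fun q' => chart_coord bc q' 0 a)).
  exact: (@tangent_expansion R s N bc q v abc Logic.I Tv).
have push_sum (q : N) (w : 'I_s -> R) : tangent_map J q (\sum_a w a *: partial bc a q) =
    \sum_a w a *: X a (J q).
  by rewrite tangent_map_sum; apply: eq_bigr => a _; rewrite tangent_mapZ push.
exists N, J; split; last first.
  by exists 0; rewrite /J /shrink scaler0 i0 chart_coordK.
split; first split=> //.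
- move=> q q' JJ; rewrite -(shrinkK e0 q) -(shrinkK e0 q'); congr grow.
  apply: inj => //; apply/rowP => j; by rewrite -!xJ JJ.
- move=> q u v; rewrite !inE => Tu Tv uv; apply/eqP; rewrite -subr_eq0; apply/eqP.
  have [w wE] := expN q _ (tangent_spaceB Tu Tv).
  rewrite wE; apply: big1 => a _.
  have := tangent_mapB J q u v; rewrite uv subrr wE push_sum => wX.
  by rewrite (iX _ _ wX) scale0r.
- move=> q; apply/seteqP; split=> [_ [v Tv <-]|_ [w ->]].
    by have [w ->] := expN q v Tv; rewrite push_sum; exists w.
  exists (\sum_a w a *: partial bc a q); last exact: push_sum.
  by apply: tangent_space_sum => a; apply: tangent_spaceZ; exact: partial_tangent.
Qed.

(** * Weak nearly S- and C-manifolds *)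

(* [L] is injective on [P] with image in a finite dimensional space, so that
   the [L^k u], k >= 1, are linearly dependent; dividing a relation between
   them by powers of [L] expresses [u] by the [L^k u], k >= 1. *)
Lemma krylov_annihilator (R : realType) (V : lmodType R) (P : set V) (L : V -> V)
    (ell : V -> R) r (D : set V) (u : V) :
  has_dimension D r -> (forall v, P v -> D (L v)) ->
  (forall v, P v -> P (L v)) -> (forall v, P v -> L v = 0 -> v = 0) ->
  P 0 -> (forall a v w, P v -> P w -> P (a *: v + w)) ->
  (forall a v w, P v -> P w -> L (a *: v + w) = a *: L v + L w) ->
  (forall a v w, P v -> P w -> ell (a *: v + w) = a * ell v + ell w) ->
  P u -> (forall k, ell (iter k.+1 L u) = 0) -> ell u = 0.
Proof.
move=> [e [De e_free]] LD PL Linj P0 PP LP ellP Pu ell0.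
have L0 : L 0 = 0.
  have := LP 1 0 0 P0 P0; rewrite !scale1r addr0 => h.
  by apply: (addrI (L 0)); rewrite addr0.
have ell00 : ell 0 = 0.
  have := ellP 1 0 0 P0 P0; rewrite scale1r mul1r addr0 => h.
  by apply: (addrI (ell 0)); rewrite addr0.
have Piter k : P (iter k L u) by elim: k => //= k; exact: PL.
have Psum N (v : nat -> R) j : P (\sum_(k < N) v k *: iter (j + k) L u).
  elim/big_rec: _ => // k x _ Px; exact: PP.
have Lsum N (v : nat -> R) j : L (\sum_(k < N) v k *: iter (j + k) L u) =
    \sum_(k < N) v k *: iter (j.+1 + k) L u.
  elim: N => [|N IH]; first by rewrite !big_ord0.
  rewrite big_ord_recr [RHS]big_ord_recr -IH /= addrC.
  by rewrite (LP _ _ _ (Piter _) (Psum _ _ _)) addrC.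
have ellsum N (v : nat -> R) : ell (\sum_(k < N) v k *: iter (1 + k) L u) = 0.
  elim: N => [|N IH]; first by rewrite big_ord0.
  rewrite big_ord_recr /= addrC (ellP _ _ _ (Piter (1 + N)%N) (Psum N v 1%N)) IH.
  by rewrite (ell0 N) mulr0 addr0.
have main N : forall v : nat -> R, (exists2 k, (k < N)%N & v k != 0) ->
    \sum_(k < N) v k *: iter (0 + k) L u = 0 -> ell u = 0.
  elim: N => [|N IH] v [k kN vk]; first by rewrite ltn0 in kN.
  rewrite big_ord_recl /= => S0.
  have S0' : v 0%N *: u + \sum_(k < N) v k.+1 *: iter (1 + k) L u = 0.
    by rewrite -[RHS]S0; congr (_ + _).
  have [v0|v0] := eqVneq (v 0%N) 0; last first.
    have := congr1 ell S0'; rewrite ellP//; last exact: (Psum N (fun k => v k.+1)).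
    rewrite (ellsum N (fun k => v k.+1)) addr0 ell00 => /eqP.
    by rewrite mulf_eq0 (negbTE v0) /= => /eqP.
  move: S0'; rewrite v0 scale0r add0r -(Lsum N (fun k => v k.+1) 0%N).
  move=> /(Linj _ (Psum N (fun k => v k.+1) 0%N)) Z.
  apply: (IH (fun k => v k.+1)) => //.
  case: k kN vk => [|k]; first by rewrite v0 eqxx.
  by rewrite ltnS => kN vk; exists k.
have exk (k : 'I_r.+1) : exists c : 'rV[R]_r,
    iter (1 + k) L u = \sum_(i < r) c 0 i *: e i.
  by have := LD _ (Piter k); rewrite De.
have [C CP] := choice exk.
pose A : 'M[R]_(r.+1, r) := \matrix_(k, i) C k 0 i.
have : kermx A != 0.
  rewrite kermx_eq0 /row_free; apply/negP => /eqP rA.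
  by have := rank_leq_col A; rewrite rA ltnn.
case/rowV0Pn => w /sub_kermxP wA w0.
(* The dependent vectors are the [r.+1] powers from [L u] on, in a space spanned by [r] vectors;
   [main] counts from the power 0, hence the coefficient 0 put in front. *)
apply: (main r.+2 (fun k => if k is k'.+1 then w 0 (inord k') else 0)).
  have [k wk] : exists k, w 0 k != 0.
    apply/existsP; rewrite -negb_forall; apply: contra w0 => /forallP w0.
    by apply/eqP/rowP => k; rewrite mxE; apply/eqP.
  by exists k.+1; [rewrite ltnS ltn_ord|rewrite inord_val].
rewrite big_ord_recl /= scale0r add0r.
have E (k : 'I_r.+1) : w 0 (inord (0 + k)) *: L (iter (0 + k) L u) =
    \sum_(i < r) (w 0 k * C k 0 i) *: e i.
  rewrite add0n inord_val -[L (iter k L u)]/(iter (1 + k) L u) CP scaler_sumr.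
  by apply: eq_bigr => i _; rewrite scalerA.
rewrite (eq_bigr _ (fun k _ => E k)) exchange_big; apply: big1 => i _.
rewrite -scaler_suml.
have /rowP/(_ i) := wA; rewrite !mxE => wi.
rewrite (_ : \sum_(i0 < r.+1) _ = 0) ?scale0r//.
by rewrite -[RHS]wi; apply: eq_bigr => k _; rewrite mxE.
Qed.

(** * Pointwise algebra of metrics, tensors and connections *)

Section Metric.
Variables (R : realType) (m : nat) (M : smooth_manifold R m).
Variable g : M -> operator M -> operator M -> R.
Hypothesis Hg : is_riemannian_metric g.
Implicit Types (p : M) (u v w : operator M) (X Y : M -> operator M).

Lemma metricPl p a u v w : tangent_space p u -> tangent_space p v ->
  tangent_space p w -> g p (a *: u + v) w = a * g p u w + g p v w.
Proof. exact: (metric_linear Hg). Qed.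

Lemma metricC p u v : tangent_space p u -> tangent_space p v -> g p u v = g p v u.
Proof. by move=> Tu Tv; rewrite (Defs.metric_sym Hg Tu Tv). Qed.

Lemma metric0l p w : tangent_space p w -> g p 0 w = 0.
Proof.
move=> Tw; have T0 := tangent_space0 p; have := metricPl 1 T0 T0 Tw.
by rewrite scale1r mul1r addr0 => h; apply: (addrI (g p 0 w)); rewrite addr0.
Qed.

Lemma metric0r p w : tangent_space p w -> g p w 0 = 0.
Proof. by move=> Tw; rewrite metricC ?metric0l//; exact: tangent_space0. Qed.

Lemma metricDl p u v w : tangent_space p u -> tangent_space p v ->
  tangent_space p w -> g p (u + v) w = g p u w + g p v w.
Proof. by move=> Tu Tv Tw; rewrite -[u]scale1r metricPl// scale1r mul1r. Qed.

Lemma metricZl p a u w : tangent_space p u -> tangent_space p w ->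
  g p (a *: u) w = a * g p u w.
Proof.
move=> Tu Tw; rewrite -[a *: u]addr0 metricPl//; last exact: tangent_space0.
by rewrite metric0l// addr0.
Qed.

Lemma metricNl p u w : tangent_space p u -> tangent_space p w ->
  g p (- u) w = - g p u w.
Proof. by move=> Tu Tw; rewrite -scaleN1r metricZl// mulN1r. Qed.

Lemma metricBl p u v w : tangent_space p u -> tangent_space p v ->
  tangent_space p w -> g p (u - v) w = g p u w - g p v w.
Proof.
by move=> Tu Tv Tw; rewrite metricDl ?metricNl//; exact: tangent_spaceN.
Qed.

Lemma metricDr p u v w : tangent_space p u -> tangent_space p v ->
  tangent_space p w -> g p w (u + v) = g p w u + g p w v.
Proof.
move=> Tu Tv Tw; rewrite ![g p w _]metricC// ?metricDl//; exact: tangent_spaceD.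
Qed.

Lemma metricZr p a u w : tangent_space p u -> tangent_space p w ->
  g p w (a *: u) = a * g p w u.
Proof.
by move=> Tu Tw; rewrite ![g p w _]metricC// ?metricZl//; exact: tangent_spaceZ.
Qed.

Lemma metricNr p u w : tangent_space p u -> tangent_space p w ->
  g p w (- u) = - g p w u.
Proof. by move=> Tu Tw; rewrite -scaleN1r metricZr// mulN1r. Qed.

Lemma metricBr p u v w : tangent_space p u -> tangent_space p v ->
  tangent_space p w -> g p w (u - v) = g p w u - g p w v.
Proof.
by move=> Tu Tv Tw; rewrite metricDr ?metricNr//; exact: tangent_spaceN.
Qed.

Lemma metric_suml p (I : Type) (r : seq I) (u : I -> operator M) w :
  (forall i, tangent_space p (u i)) -> tangent_space p w ->
  g p (\sum_(i <- r) u i) w = \sum_(i <- r) g p (u i) w.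
Proof.
move=> Tu Tw; elim: r => [|i r IH]; first by rewrite !big_nil metric0l.
by rewrite !big_cons metricDl ?IH//; exact: tangent_space_sum.
Qed.

Lemma metric_eq0 p u : tangent_space p u -> g p u u = 0 -> u = 0.
Proof.
move=> Tu gu0; apply: contrapT => un0; have := metric_pos Hg Tu un0.
by rewrite gu0 ltxx.
Qed.

End Metric.

Section EndoTensor.
Variables (R : realType) (m : nat) (M : smooth_manifold R m).
Variable A : M -> operator M -> operator M.
Hypothesis HA : is_endo_tensor A.
Implicit Types (p : M) (u v w : operator M) (X Y : M -> operator M).

Lemma endo_tangent p u : tangent_space p u -> tangent_space p (A p u).
Proof. by case: HA => h _ _; exact: h. Qed.

Lemma endo_field X : vector_field X -> vector_field (fun p => A p (X p)).
Proof. by case: HA => _ _ h; exact: h. Qed.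

Lemma endoP p a u v : tangent_space p u -> tangent_space p v ->
  A p (a *: u + v) = a *: A p u + A p v.
Proof. by case: HA => _ h _; exact: h. Qed.

Lemma endo0 p : A p 0 = 0.
Proof.
have T0 := tangent_space0 p; have := endoP 1 T0 T0; rewrite !scale1r addr0 => h.
by apply: (addrI (A p 0)); rewrite addr0.
Qed.

Lemma endoD p u v : tangent_space p u -> tangent_space p v ->
  A p (u + v) = A p u + A p v.
Proof. by move=> Tu Tv; rewrite -[u]scale1r endoP// !scale1r. Qed.

Lemma endoZ p a u : tangent_space p u -> A p (a *: u) = a *: A p u.
Proof.
move=> Tu; rewrite -[a *: u]addr0 endoP//; last exact: tangent_space0.
by rewrite endo0 addr0.
Qed.

Lemma endoN p u : tangent_space p u -> A p (- u) = - A p u.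
Proof. by move=> Tu; rewrite -scaleN1r endoZ// scaleN1r. Qed.

Lemma endo_sum p (I : Type) (r : seq I) (u : I -> operator M) :
  (forall i, tangent_space p (u i)) ->
  A p (\sum_(i <- r) u i) = \sum_(i <- r) A p (u i).
Proof.
move=> Tu; elim: r => [|i r IH]; first by rewrite !big_nil endo0.
by rewrite !big_cons endoD ?IH//; exact: tangent_space_sum.
Qed.

End EndoTensor.

Section Connection.
Variables (R : realType) (m : nat) (M : smooth_manifold R m).
Variable nabla : covariant_derivative M.
Hypothesis Hn : is_connection nabla.
Implicit Types (p : M) (u v : operator M) (X Y Z : M -> operator M).

Lemma conn0l p Y : vector_field Y -> nabla p 0 Y = 0.
Proof.
move=> vY; have T0 := tangent_space0 p; have := conn_linear Hn 1 T0 T0 vY.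
rewrite !scale1r addr0 => h.
by apply: (addrI (nabla p 0 Y)); rewrite addr0.
Qed.

Lemma connDl p u v Y : tangent_space p u -> tangent_space p v -> vector_field Y ->
  nabla p (u + v) Y = nabla p u Y + nabla p v Y.
Proof.
by move=> Tu Tv vY; have := conn_linear Hn 1 Tu Tv vY; rewrite !scale1r.
Qed.

Lemma connZl p a u Y : tangent_space p u -> vector_field Y ->
  nabla p (a *: u) Y = a *: nabla p u Y.
Proof.
move=> Tu vY; have := conn_linear Hn a Tu (tangent_space0 p) vY.
by rewrite !addr0 conn0l// addr0.
Qed.

Lemma conn_suml p (I : Type) (r : seq I) (u : I -> operator M) Y :
  (forall i, tangent_space p (u i)) -> vector_field Y ->
  nabla p (\sum_(i <- r) u i) Y = \sum_(i <- r) nabla p (u i) Y.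
Proof.
move=> Tu vY; elim: r => [|i r IH]; first by rewrite !big_nil conn0l.
by rewrite !big_cons connDl ?IH//; exact: tangent_space_sum.
Qed.

Lemma connZr p v a Y : tangent_space p v -> vector_field Y ->
  nabla p v (fun q => a *: Y q) = a *: nabla p v Y.
Proof.
move=> Tv vY; have sa : smooth_function (fun _ : M => a).
  by move=> q; exact: smooth_at_cst.
by rewrite (conn_leibniz Hn Tv sa vY) (tangent_cst Tv) scale0r add0r.
Qed.

Lemma conn0r p v : tangent_space p v -> nabla p v (fun=> 0) = 0.
Proof.
move=> Tv; rewrite -[RHS](scale0r (nabla p v (fun=> 0))).
rewrite -(connZr 0 Tv (vector_field0 M)).
by congr (nabla p v _); apply/funext => q; rewrite scale0r.
Qed.

Lemma connNr p v Y : tangent_space p v -> vector_field Y ->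
  nabla p v (fun q => - Y q) = - nabla p v Y.
Proof.
move=> Tv vY; rewrite -scaleN1r -connZr//; congr (nabla p v _).
by apply/funext => q; rewrite scaleN1r.
Qed.

Lemma conn_sumr p v (I : Type) (r : seq I) (Y : I -> M -> operator M) :
  tangent_space p v -> (forall i, vector_field (Y i)) ->
  nabla p v (fun q => \sum_(i <- r) Y i q) = \sum_(i <- r) nabla p v (Y i).
Proof.
move=> Tv vY; elim: r => [|i r IH].
  by under eq_fun do rewrite big_nil; rewrite big_nil conn0r.
under eq_fun do rewrite big_cons.
by rewrite (conn_add Hn Tv)// ?IH ?big_cons//; exact: vector_field_sum.
Qed.

(* In a parallel frame the connection differentiates coefficients, so its
   curvature measures the failure of [X, Y] = XY - YX on functions. *)
Lemma parallel_frame_flat s (E : 'I_s -> M -> operator M) X Y Z :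
  (forall a, vector_field (E a)) -> independent_fields E ->
  (forall p v, tangent_space p v -> exists w : 'I_s -> R, v = \sum_a w a *: E a p) ->
  (forall p v a, tangent_space p v -> nabla p v (E a) = 0) ->
  (forall p, tangent_space p (lie_bracket X Y p)) ->
  vector_field X -> vector_field Y -> vector_field Z ->
  forall p, curvature nabla X Y Z p = 0.
Proof.
move=> vE iE spanE parE TXY vX vY vZ p.
have [h hZ] := choice (fun q => spanE q (Z q) (vZ.1 q)).
have sh a : smooth_function (h^~ a).
  by apply: (frame_coefficients_smooth (h := fun a q => h q a) vE iE vZ).
have covE (k : 'I_s -> M -> R) q v : (forall a, smooth_function (k a)) ->
    tangent_space q v ->
    nabla q v (fun q => \sum_a k a q *: E a q) = \sum_a v (k a) *: E a q.
  move=> sk Tv; rewrite conn_sumr//; last by move=> a; exact: vector_fieldM.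
  apply: eq_bigr => a _.
  by rewrite (conn_leibniz Hn Tv (sk a) (vE a)) parE// scaler0 addr0.
have ZE : Z = fun q => \sum_a h q a *: E a q by apply/funext.
have covZ W : (forall q, tangent_space q (W q)) ->
    cov nabla W Z = fun q => \sum_a W q (h^~ a) *: E a q.
  by move=> TW; apply/funext => q; rewrite /cov ZE (covE (fun a q => h q a)).
rewrite /curvature (covZ Y vY.1) (covZ X vX.1) (covZ _ TXY) /cov.
have sXh W a : vector_field W -> smooth_function (fun q => W q (h^~ a)).
  by move=> vW q; apply: vW.2; exact: sh.
rewrite (covE (fun a q => Y q (h^~ a)) p _ (fun a => sXh Y a vY) (vX.1 p)).
rewrite (covE (fun a q => X q (h^~ a)) p _ (fun a => sXh X a vX) (vY.1 p)).
rewrite -!sumrB; apply: big1 => a _; rewrite -!scalerBl /lie_bracket asboolT.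
  by rewrite subrr scale0r.
exact: sh.
Qed.

End Connection.

(** * The kernel of f and the covariant derivatives of its frame *)

Section WeakNearly.
Variables (R : realType) (n s : nat) (M : smooth_manifold R (2 * n + s)).
Variables (f Q : M -> operator M -> operator M).
Variables (xi : 'I_s -> M -> operator M) (eta : 'I_s -> M -> operator M -> R).
Variables (g : M -> operator M -> operator M -> R) (nabla : covariant_derivative M).
Hypothesis Hw : weak_metric_f_structure f Q xi eta g.
Implicit Types (p : M) (X Y Z : M -> operator M).

Let Hg : is_riemannian_metric g := wmf_metric Hw.
Let Hf : is_endo_tensor f := wmf_f Hw.
Let HQ : is_endo_tensor Q := wmf_Q Hw.

Lemma xi_field i : vector_field (xi i). Proof. exact: wmf_xi Hw i. Qed.

Lemma xi_tangent i p : tangent_space p (xi i p).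
Proof. exact: (xi_field i).1. Qed.

Hint Resolve xi_tangent xi_field : core.

(** Compatibility gives the squared length of f xi_i as g(xi_i, Q xi_i) - 1, which is 0 because Q
    xi_i = xi_i has length 1. *)
Lemma f_xi p i : f p (xi i p) = 0.
Proof.
have Tf : tangent_space p (f p (xi i p)) by exact: endo_tangent.
apply: (metric_eq0 Hg Tf); rewrite (wmf_compatible Hw)// (wmf_Q_xi Hw).
rewrite (wmf_xi_orthonormal Hw) eqxx (bigD1 i)//= (wmf_eta_xi Hw) eqxx.
rewrite big1 ?mulr1 ?addr0 ?subrr// => j ji.
by rewrite (wmf_eta_xi Hw) (negbTE ji) mulr0.
Qed.

(** Compatibility for the pair (xi_i, u): the left side vanishes by [f_xi], and Q moves over to
    xi_i, which it fixes. *)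
Lemma eta_metric p i u : tangent_space p u -> eta i p u = g p (xi i p) u.
Proof.
move=> Tu; have := wmf_compatible Hw (xi_tangent i p) Tu.
rewrite f_xi (metric0l Hg); last exact: endo_tangent.
rewrite -(wmf_Q_selfadjoint Hw)// (wmf_Q_xi Hw) (bigD1 i)//= (wmf_eta_xi Hw) eqxx.
rewrite big1 => [|j ji]; last by rewrite (wmf_eta_xi Hw) (negbTE ji) mul0r.
by rewrite mul1r addr0 => /esym/eqP; rewrite subr_eq0 => /eqP.
Qed.

(** If f u = 0, the formula for f^2 says that Q u equals the sum on the right, which Q fixes;
    injectivity of Q concludes. *)
Lemma ker_f p u : tangent_space p u -> f p u = 0 -> u = \sum_i eta i p u *: xi i p.
Proof.
move=> Tu fu0; have := wmf_f_square Hw Tu; rewrite fu0 (endo0 Hf) => /esym/eqP.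
rewrite addrC subr_eq0 => /eqP e; have [_ Qinj _] := wmf_Q_nonsingular Hw p.
have Ts : tangent_space p (\sum_i eta i p u *: xi i p).
  by apply: tangent_space_sum => i; exact: tangent_spaceZ.
apply: Qinj; rewrite ?inE// -e (endo_sum HQ); last by move=> i; exact: tangent_spaceZ.
by apply: eq_bigr => i _; rewrite (endoZ HQ)// (wmf_Q_xi Hw).
Qed.

Lemma ker_f_span p : ker_distribution f p = field_span xi p.
Proof.
apply/seteqP; split=> [u [Tu fu0]|_ [w ->]].
  by exists (fun i => eta i p u); exact: ker_f.
split; first by apply: tangent_space_sum => i; exact: tangent_spaceZ.
rewrite (endo_sum Hf); last by move=> i; exact: tangent_spaceZ.
by apply: big1 => i _; rewrite (endoZ Hf)// f_xi scaler0.
Qed.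

Lemma metric_xi_sum p (w : 'I_s -> R) i : g p (\sum_a w a *: xi a p) (xi i p) = w i.
Proof.
rewrite (metric_suml Hg)//; last by move=> a; exact: tangent_spaceZ.
rewrite (bigD1 i)//= (metricZl Hg)// (wmf_xi_orthonormal Hw) eqxx mulr1.
rewrite big1 ?addr0// => a ai.
by rewrite (metricZl Hg)// (wmf_xi_orthonormal Hw) (negbTE ai) mulr0.
Qed.

Lemma xi_independent : independent_fields xi.
Proof.
move=> p w w0 a; rewrite -(metric_xi_sum p w a) w0 (metric0l Hg)//.
Qed.

Lemma eta_smooth X i : vector_field X -> smooth_function (fun p => eta i p (X p)).
Proof. by move=> vX; have [_ h] := wmf_eta Hw i; exact: h. Qed.

Hypothesis Hlc : is_levi_civita g nabla.
Let Hn : is_connection nabla := lc_connection Hlc.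

Variable kappa : R.
Hypothesis nearly : forall X Y, vector_field X -> vector_field Y -> forall p,
  cov_endo nabla f X Y p + cov_endo nabla f Y X p =
    kappa *: ((2 * g p (f p (X p)) (f p (Y p))) *: xi_bar xi p
    + eta_bar eta p (X p) *: f p (f p (Y p)) + eta_bar eta p (Y p) *: f p (f p (X p))).
Hypothesis comm_xi : forall i j p, lie_bracket (xi i) (xi j) p = 0.
Hypothesis eta_cov_xi : forall i j k p, eta k p (cov nabla (xi i) (xi j) p) = 0.

Lemma cov_field X Y : vector_field X -> vector_field Y -> vector_field (cov nabla X Y).
Proof. exact: (conn_smooth Hn). Qed.

Lemma cov_endo_xi X i p : vector_field X ->
  cov_endo nabla f X (xi i) p = - f p (cov nabla X (xi i) p).
Proof.
move=> vX; rewrite /cov_endo; have -> : (fun q => f q (xi i q)) = fun=> 0.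
  by apply/funext => q; exact: f_xi.
by rewrite /cov (conn0r Hn) ?sub0r//; exact: vX.1.
Qed.

Lemma cov_xi_xi i j p : cov nabla (xi i) (xi j) p = 0.
Proof.
have T a b : tangent_space p (cov nabla (xi a) (xi b) p).
  exact: (cov_field (xi_field a) (xi_field b)).1.
have sym : cov nabla (xi i) (xi j) p = cov nabla (xi j) (xi i) p.
  apply/eqP; rewrite -subr_eq0; apply/eqP.
  by rewrite (lc_torsion_free Hlc)// comm_xi.
have := nearly (xi_field i) (xi_field j) p.
rewrite !cov_endo_xi// !f_xi (endo0 Hf) (metric0l Hg); last exact: tangent_space0.
rewrite mulr0 scale0r !scaler0 !addr0 scaler0 -sym -opprD => /eqP.
rewrite oppr_eq0 -mulr2n -scaler_nat scaler_eq0 pnatr_eq0 /= => /eqP.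
move=> /(ker_f (T i j)) ->; apply: big1 => k _.
by rewrite eta_cov_xi scale0r.
Qed.

Lemma cov_span_xi p (w : 'I_s -> R) j : nabla p (\sum_a w a *: xi a p) (xi j) = 0.
Proof.
rewrite (conn_suml Hn)//; last by move=> a; exact: tangent_spaceZ.
apply: big1 => a _; rewrite (connZl Hn)//.
by have := cov_xi_xi a j p; rewrite /cov => ->; rewrite scaler0.
Qed.

(** * Integral manifolds of ker f *)

Section Leaf.
Variables (N : smooth_manifold R s) (iota : N -> M).
Hypothesis Hint : integral_manifold (ker_distribution f) iota.

Let im : immersed_submanifold iota := Hint.1.
Let si : smooth_map iota. Proof. by case: im. Qed.

Lemma leaf_tangent q v : tangent_space q v ->
  exists w : 'I_s -> R, tangent_map iota q v = \sum_a w a *: xi a (iota q).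
Proof.
move=> Tv; have : field_span xi (iota q) (tangent_map iota q v).
  by rewrite -ker_f_span -(Hint.2 q); exists v.
by [].
Qed.

(** [Y] lies in ker f only along the leaf, so it is split into its ker f component and a remainder
    [Z] vanishing along the leaf. The derivative of [Z] is 0 in directions tangent to the leaf; in
    that of the component only the coefficients are differentiated, as the xi_i are parallel along
    ker f. *)
Lemma leaf_totally_geodesic : totally_geodesic nabla iota.
Proof.
move=> q X Y vX vY nearXY.
have [[v Tv vE] _] := nbhs_singleton nearXY.
pose Z p := Y p - \sum_i eta i p (Y p) *: xi i p.
have vS : vector_field (fun p => \sum_i eta i p (Y p) *: xi i p).
  by apply: vector_field_sum => i; apply: vector_fieldM => //; exact: eta_smooth.
have vZ : vector_field Z by exact: vector_fieldB.
have nearZ : \forall q' \near q, Z (iota q') = 0.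
  apply: filterS nearXY => q' [_ [v' Tv' v'E]].
  have [w wE] := leaf_tangent Tv'; rewrite /Z -v'E wE.
  apply/eqP; rewrite subr_eq0; apply/eqP; apply: eq_bigr => a _.
  rewrite eta_metric; last by apply: tangent_space_sum => b; exact: tangent_spaceZ.
  rewrite (metricC Hg)//; last by apply: tangent_space_sum => b; exact: tangent_spaceZ.
  by rewrite metric_xi_sum.
(* With [W] the derivative of [Z] along [X], metric compatibility gives g(W, W) = X g(Z, W) - g(Z,
   nabla_X W). Both terms vanish at [iota q]: [Z] is 0 along the leaf near [q] and [X] is tangent to
   it there. *)
have covZ : cov nabla X Z (iota q) = 0.
  have vW := cov_field vX vZ; set W := cov nabla X Z in vW *.
  apply: (metric_eq0 Hg (vW.1 _)).
  have := lc_metric Hlc (vX.1 (iota q)) vZ vW.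
  rewrite (nbhs_singleton nearZ) (metric0l Hg); last first.
    exact: (conn_tangent Hn (vX.1 _) vW).
  rewrite addr0 => <-; rewrite -vE tangent_mapE; last exact: (metric_smooth Hg vZ vW).
  rewrite (tangent_local Tv (psi := fun=> 0)) ?(tangent_cst Tv)//.
  by apply: filterS nearZ => q' ->; rewrite (metric0l Hg)//; exact: vW.1.
rewrite (Hint.2 q) ker_f_span.
exists (fun i => X (iota q) (fun p => eta i p (Y p))).
have YE : Y = fun p => Z p + \sum_i eta i p (Y p) *: xi i p.
  by apply/funext => p; rewrite /Z subrK.
rewrite {1}YE /cov (conn_add Hn (vX.1 _) vZ vS).
have -> : nabla (iota q) (X (iota q)) Z = 0 by exact: covZ.
have vE' i : vector_field (fun p => eta i p (Y p) *: xi i p).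
  by apply: vector_fieldM => //; exact: eta_smooth.
rewrite add0r (conn_sumr Hn _ (vX.1 _) vE').
apply: eq_bigr => i _.
rewrite (conn_leibniz Hn (vX.1 _) (eta_smooth i vY) (xi_field i)).
have [w wE] := leaf_tangent Tv.
by rewrite -{2}vE wE cov_span_xi scaler0 addr0.
Qed.

Lemma leaf_flat : is_flat (pullback_metric g iota).
Proof.
move=> nabla' Hlc' X Y Z vX vY vZ p.
have Hn' := lc_connection Hlc'.
have lift a q : exists v, tangent_space q v /\ tangent_map iota q v = xi a (iota q).
  have : ker_distribution f (iota q) (xi a (iota q)) by split=> //; exact: f_xi.
  by rewrite -(Hint.2 q) => -[v Tv vE]; exists v.
(* The lifts of the xi_a are chosen point by point; [lift_vector_field] makes them smooth. *)
have [E EP] := choice (fun aq : 'I_s * N => lift aq.1 aq.2).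
pose e a q := E (a, q).
have Te a q : tangent_space q (e a q) by case: (EP (a, q)).
have push a q : tangent_map iota q (e a q) = xi a (iota q) by case: (EP (a, q)).
have ve a : vector_field (e a).
  exact: (lift_vector_field im (xi_field a) (Te a) (push a)).
have push_sum q (w : 'I_s -> R) : tangent_map iota q (\sum_a w a *: e a q) =
    \sum_a w a *: xi a (iota q).
  by rewrite tangent_map_sum; apply: eq_bigr => a _; rewrite tangent_mapZ push.
have ie : independent_fields e.
  move=> q w w0; apply: (xi_independent (p := iota q)).
  by rewrite -push_sum w0 tangent_map0.
have spane q v : tangent_space q v -> exists w : 'I_s -> R, v = \sum_a w a *: e a q.
  move=> Tv; have [w wE] := leaf_tangent Tv; exists w.
  have Ts : tangent_space q (\sum_a w a *: e a q).
    by apply: tangent_space_sum => a; exact: tangent_spaceZ.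
  have m0 : tangent_map iota q (v - \sum_a w a *: e a q) = 0.
    by rewrite tangent_mapB push_sum wE subrr.
  apply/eqP; rewrite -subr_eq0; apply/eqP.
  exact: (immersion_inj0 im (tangent_spaceB Tv Ts) m0).
have comme a b q : lie_bracket (e a) (e b) q = 0.
  (* Torsion-freeness presents the bracket as a difference of tangent vectors, so it need not be
     checked to be a derivation. *)
  have Tl : tangent_space q (lie_bracket (e a) (e b) q).
    rewrite -(lc_torsion_free Hlc')//; apply: tangent_spaceB.
      exact: (conn_smooth Hn' (ve a) (ve b)).1.
    exact: (conn_smooth Hn' (ve b) (ve a)).1.
  apply: (immersion_inj0 im Tl); apply/funext => Phi.
  have [sPhi|nPhi] := pselect (smooth_at (iota q) Phi); last first.
    by rewrite /tangent_map asboolF.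
  rewrite tangent_mapE// /lie_bracket asboolT; last exact: smooth_map_pullback.
  (* Brackets of related fields are related: second derivatives of a pulled-back function along the
     lifts are those along the xi. The inner identity holds only where [Phi] is smooth, which
     locality permits. *)
  have step c d : e c q (fun q' => e d q' (fun q'' => Phi (iota q''))) =
      xi c (iota q) (fun p' => xi d p' Phi).
    rewrite -push tangent_mapE; last exact: (xi_field d).2.
    apply: (tangent_local (Te c q)).
    have := smooth_at_near sPhi => /(si.1 q) near_s.
    have near_s' : \forall q' \near q, smooth_at (iota q') Phi by exact: near_s.
    by apply: filterS near_s' => q' s'; rewrite -push tangent_mapE.
  rewrite !step.
  have := congr1 (fun v : operator M => v Phi) (comm_xi a b (iota q)).
  by rewrite /lie_bracket asboolT.
pose h := pullback_metric g iota.
pose Gamma q a b c := h q (cov nabla' (e a) (e b) q) (e c q).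
have Tcov a b q : tangent_space q (cov nabla' (e a) (e b) q).
  exact: (conn_smooth Hn' (ve a) (ve b)).1.
have hC q u v : tangent_space q u -> tangent_space q v -> h q u v = h q v u.
  by move=> Tu Tv; apply: (metricC Hg); exact: tangent_map_tangent.
have sym12 q a b c : Gamma q a b c = Gamma q b a c.
  rewrite /Gamma; congr (h q _ _); apply/eqP; rewrite -subr_eq0; apply/eqP.
  by rewrite (lc_torsion_free Hlc')// comme.
have skew23 q a b c : Gamma q a b c = - Gamma q a c b.
  have := lc_metric Hlc' (Te a q) (ve b) (ve c).
  have -> : (fun q' => pullback_metric g iota q' (e b q') (e c q')) = fun=> (b == c)%:R.
    by apply/funext => q'; rewrite /pullback_metric !push (wmf_xi_orthonormal Hw).
  rewrite (tangent_cst (Te a q)) => /esym/eqP; rewrite addr_eq0 => /eqP.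
  move=> h1; rewrite /Gamma [in RHS](hC _ _ _ (Tcov a c q) (Te b q)); exact: h1.
have Gamma0 q a b c : Gamma q a b c = 0.
  (* Alternating the two transpositions three times returns the indices to their places, while the
     skew one contributes three signs. *)
  have h1 : Gamma q a b c = - Gamma q a b c.
    by rewrite {1}skew23 sym12 skew23 sym12 skew23 sym12 !opprK.
  by lra.
have pare q v a : tangent_space q v -> nabla' q v (e a) = 0.
  move=> Tv; have [w ->] := spane q v Tv.
  rewrite (conn_suml Hn')//; last by move=> b; exact: tangent_spaceZ.
  apply: big1 => b _; rewrite (connZl Hn')//.
  rewrite (_ : nabla' q (e b q) (e a) = 0) ?scaler0//.
  apply: (immersion_inj0 im (Tcov b a q)).
  have [w' w'E] := leaf_tangent (Tcov b a q).
  rewrite w'E; apply: big1 => c _.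
  rewrite -(metric_xi_sum (iota q) w' c) -w'E -push.
  by have := Gamma0 q b a c; rewrite /Gamma /h /pullback_metric => ->; rewrite scale0r.
apply: (parallel_frame_flat Hn' ve ie spane pare) => // q.
rewrite -(lc_torsion_free Hlc')//; apply: tangent_spaceB.
  exact: (conn_smooth Hn' vX vY).1.
exact: (conn_smooth Hn' vY vX).1.
Qed.

End Leaf.

(** * The symmetric part of the covariant derivative of xi_i *)

Section Killing.
Hypothesis xi_cov_xi : forall X, vector_field X -> forall i j p,
  g p (cov nabla X (xi i) p) (xi j p) = 0.
Hypothesis Q_parallel : forall X Y, vector_field X -> vector_field Y ->
  (forall p u, ker_distribution f p u -> g p (Y p) u = 0) ->
  forall p, cov_endo nabla Q X Y p = 0.
Variable i : 'I_s.

Let A X := cov nabla X (xi i).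

Let vA X : vector_field X -> vector_field (A X).
Proof. by move=> vX; exact: cov_field. Qed.

Let vf X : vector_field X -> vector_field (fun p => f p (X p)).
Proof. exact: (endo_field Hf). Qed.

Let Tf p u : tangent_space p u -> tangent_space p (f p u).
Proof. exact: (endo_tangent Hf). Qed.

Let f_sym p u v : tangent_space p u -> tangent_space p v ->
  g p u (f p v) = - g p (f p u) v.
Proof. by move=> Tu Tv; rewrite (wmf_f_skew Hw)// opprK. Qed.

Lemma cov_endo_f_xi X p : vector_field X ->
  cov_endo nabla f (xi i) X p = f p (A X p) + kappa *: f p (f p (X p)).
Proof.
move=> vX; have := nearly vX (xi_field i) p.
rewrite cov_endo_xi// f_xi (endo0 Hf) (metric0r Hg); last exact/Tf/vX.1.
have -> : eta_bar eta p (xi i p) = 1.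
  rewrite /eta_bar (bigD1 i)//= (wmf_eta_xi Hw) eqxx big1 ?addr0// => j ji.
  by rewrite (wmf_eta_xi Hw) (negbTE ji).
rewrite mulr0 scale0r scaler0 !add0r scale1r => e.
by rewrite -e addrA subrr add0r.
Qed.

(** Differentiate g(fY, Z) = - g(Y, fZ) along [X]; the terms in which [Y] or [Z] is differentiated
    cancel by skewness of f. *)
Lemma cov_endo_f_skew X Y Z p : vector_field X -> vector_field Y -> vector_field Z ->
  g p (cov_endo nabla f X Y p) (Z p) = - g p (Y p) (cov_endo nabla f X Z p).
Proof.
move=> vX vY vZ; have TX := vX.1 p.
have h1 := lc_metric Hlc TX (vf vY) vZ.
have h2 := lc_metric Hlc TX vY (vf vZ).
have e : X p (fun q => g q (f q (Y q)) (Z q)) = - X p (fun q => g q (Y q) (f q (Z q))).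
  rewrite -mulN1r -(tangentZ TX (-1)); last exact: (metric_smooth Hg vY (vf vZ)).
  congr (X p _); apply/funext => q; rewrite mulN1r f_sym ?opprK//.
    exact: vY.1.
  exact: vZ.1.
move: e; rewrite h1 h2 /cov_endo => e.
have TY := vY.1 p; have TZ := vZ.1 p.
have TcY := (cov_field vX vY).1 p; have TcZ := (cov_field vX vZ).1 p.
have TcfY := (cov_field vX (vf vY)).1 p; have TcfZ := (cov_field vX (vf vZ)).1 p.
rewrite (metricBl Hg)//; last exact: Tf.
rewrite (metricBr Hg)//; last exact: Tf.
rewrite (wmf_f_skew Hw TcY TZ) (f_sym TY TcZ).
by rewrite /cov; lra.
Qed.

(** Skewness of T = nabla_{xi_i} f, with T X = f A X + kappa f^2 X inserted; the two kappa terms add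
    up because f^2 is self-adjoint. *)
Lemma shape_skew X Y p : vector_field X -> vector_field Y ->
  g p (A X p) (f p (Y p)) + g p (f p (X p)) (A Y p) =
  2 * kappa * g p (f p (f p (X p))) (Y p).
Proof.
move=> vX vY; have := cov_endo_f_skew p (xi_field i) vX vY.
have [TX TY] := (vX.1 p, vY.1 p); have [TAX TAY] := ((vA vX).1 p, (vA vY).1 p).
have ? := Tf TX; have ? := Tf TY; have ? := Tf TAX; have ? := Tf TAY.
have ? := Tf (Tf TX); have ? := Tf (Tf TY).
have ? := tangent_spaceZ kappa (Tf (Tf TX)).
have ? := tangent_spaceZ kappa (Tf (Tf TY)).
rewrite !cov_endo_f_xi// (metricDl Hg)// (metricDr Hg)//.
rewrite (metricZl Hg)// (metricZr Hg)//.
rewrite (wmf_f_skew Hw TAX TY) (f_sym TX TAY) (f_sym TX (Tf TY)) (f_sym (Tf TX) TY).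
by lra.
Qed.

Let perp X := forall p j, g p (xi j p) (X p) = 0.

Let perp_f X : vector_field X -> perp (fun p => f p (X p)).
Proof.
move=> vX p j; have TX := vX.1 p.
by rewrite f_sym// f_xi (metric0l Hg)// oppr0.
Qed.

Lemma f_square_perp X p : vector_field X -> perp X ->
  f p (f p (X p)) = - Q p (X p).
Proof.
move=> vX pX; have TX := vX.1 p; rewrite (wmf_f_square Hw)// big1 ?addr0// => j _.
by rewrite eta_metric// pX scale0r.
Qed.

(** The left side is the derivative of f^2 along xi_i applied to [X]. Replacing f^2 by - Q is
    legitimate for [X], and also for its derivative [C], which stays orthogonal to ker f: g(xi_j, C)
    = - g(nabla_{xi_i} xi_j, X) = 0. *)
Lemma cov_endo_f_anticomm X p : vector_field X -> perp X ->
  cov_endo nabla f (xi i) (fun q => f q (X q)) p + f p (cov_endo nabla f (xi i) X p) = 0.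
Proof.
move=> vX pX; rewrite /cov_endo /cov.
set C := nabla p (xi i p) X; set D := nabla p (xi i p) (fun q => f q (X q)).
have TC : tangent_space p C by exact: (cov_field (xi_field i) vX).1.
have TD : tangent_space p D by exact: (cov_field (xi_field i) (vf vX)).1.
have fBE : f p (D - f p C) = f p D - f p (f p C).
  by rewrite (endoD Hf) ?(endoN Hf)//; [exact: Tf|exact/tangent_spaceN/Tf].
rewrite fBE addrA subrK.
have -> : (fun q => f q (f q (X q))) = fun q => - Q q (X q).
  by apply/funext => q; exact: f_square_perp.
rewrite (connNr Hn)//; last exact: (endo_field HQ).
have QC : nabla p (xi i p) (fun q => Q q (X q)) = Q p C.
  apply/eqP; rewrite -subr_eq0; apply/eqP.
  apply: (Q_parallel (X := xi i) (xi_field i) vX) => q u [Tu fu0].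
  have TX := vX.1 q.
  rewrite (metricC Hg)// (ker_f Tu fu0) (metric_suml Hg)//; last first.
    by move=> j; exact: tangent_spaceZ.
  by apply: big1 => j _; rewrite (metricZl Hg)// pX mulr0.
rewrite QC (wmf_f_square Hw TC) opprD opprK addrA addNr add0r.
apply/eqP; rewrite oppr_eq0; apply/eqP; apply: big1 => j _.
rewrite eta_metric//; have := lc_metric Hlc (xi_tangent i p) (xi_field j) vX.
have -> : (fun q => g q (xi j q) (X q)) = fun=> 0 by apply/funext => q; exact: pX.
rewrite (tangent_cst (xi_tangent i p)).
have := cov_xi_xi i j p; rewrite /cov => ->.
rewrite (metric0l Hg) ?add0r; last exact: vX.1.
by move=> <-; rewrite scale0r.
Qed.

(** Anticommutation only says that the difference [w] of the two sides is killed by f. It is also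
    orthogonal to every xi_j: the values of A are by [xi_cov_xi], those of f by skewness. Hence [w]
    is 0. *)
Lemma shape_f_perp X p : vector_field X -> perp X ->
  A (fun q => f q (X q)) p = - f p (A X p) - (2 * kappa) *: f p (f p (X p)).
Proof.
move=> vX pX; have TX := vX.1 p; have TAX := (vA vX).1 p.
have TAf : tangent_space p (A (fun q => f q (X q)) p) by exact: (vA (vf vX)).1.
set u := A (fun q => f q (X q)) p in TAf *.
pose w := u + f p (A X p) + (2 * kappa) *: f p (f p (X p)).
have Tw : tangent_space p w.
  apply: tangent_spaceD; first by apply: tangent_spaceD => //; exact: Tf.
  exact/tangent_spaceZ/Tf/Tf.
have fw : f p w = 0.
  have := cov_endo_f_anticomm p vX pX.
  rewrite (cov_endo_f_xi _ (vf vX)) cov_endo_f_xi// -/u.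
  rewrite (endoD Hf) ?(endoZ Hf)//; last exact/tangent_spaceZ/Tf/Tf; last exact: Tf; last exact/Tf/Tf.
  move=> e; rewrite /w (endoD Hf); last exact/tangent_spaceZ/Tf/Tf; last first.
    by apply: tangent_spaceD => //; exact: Tf.
  rewrite (endoD Hf)//; last exact: Tf.
  rewrite (endoZ Hf); last exact/Tf/Tf.
  rewrite -[RHS]e mulr_natl mulr2n scalerDl -!addrA; congr (_ + _).
  by rewrite addrCA.
have w0 : w = 0.
  rewrite (ker_f Tw fw); apply: big1 => j _.
  rewrite eta_metric// /w (metricDr Hg)//; last exact/tangent_spaceZ/Tf/Tf; last first.
    by apply: tangent_spaceD => //; exact: Tf.
  rewrite (metricDr Hg)//; last exact: Tf.
  rewrite (metricZr Hg)//; last exact/Tf/Tf.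
  rewrite (metricC Hg)// (xi_cov_xi (vf vX)) !f_sym//; last exact: Tf.
    by rewrite f_xi (endo0 Hf) !(metric0l Hg) ?oppr0 ?mulr0 ?addr0 ?scale0r//; exact: Tf.
  exact/Tf/xi_tangent.
by move/eqP: w0; rewrite /w -addrA addr_eq0 opprD => /eqP.
Qed.

(** The Lie derivative of the metric along xi_i, in terms of the connection; twice the symmetric
    part of A. *)
Definition shape_sym p u v := g p (nabla p u (xi i)) v + g p u (nabla p v (xi i)).

(** Inserting [shape_f_perp] for A f Z and moving f across the metric leaves the difference of the
    two sides of [shape_skew]. *)
Lemma shape_sym_f X Z p : vector_field X -> vector_field Z -> perp Z ->
  shape_sym p (X p) (f p (Z p)) = 0.
Proof.
move=> vX vZ pZ; rewrite /shape_sym.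
have := shape_f_perp p vZ pZ; have := shape_skew p vX vZ.
rewrite /A /cov => sk ->.
have [TX TZ] := (vX.1 p, vZ.1 p).
have TAZ : tangent_space p (nabla p (Z p) (xi i)) by exact: (vA vZ).1.
have TAX : tangent_space p (nabla p (X p) (xi i)) by exact: (vA vX).1.
have ? := Tf TAZ; have ? := Tf (Tf TZ); have ? := tangent_spaceN (Tf TAZ).
have ? := tangent_spaceZ (2 * kappa) (Tf (Tf TZ)).
rewrite (metricBr Hg)// (metricNr Hg)// (metricZr Hg)//.
rewrite (f_sym TX TAZ) (f_sym TX (Tf TZ)) (f_sym (Tf TX) TZ).
by lra.
Qed.

Let shape_sym_linear p u a v w : tangent_space p u -> tangent_space p v ->
  tangent_space p w ->
  shape_sym p u (a *: v + w) = a * shape_sym p u v + shape_sym p u w.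
Proof.
move=> Tu Tv Tw; rewrite /shape_sym.
have Tn z : tangent_space p z -> tangent_space p (nabla p z (xi i)).
  by move=> Tz; exact: (conn_tangent Hn Tz (xi_field i)).
have ? := Tn _ Tu; have ? := Tn _ Tv; have ? := Tn _ Tw.
have ? := tangent_spaceZ a Tv; have ? := tangent_spaceZ a (Tn _ Tv).
rewrite (conn_linear Hn)// !(metricDr Hg)// !(metricZr Hg)//.
ring.
Qed.

(** All iterates of f on [Z] are smooth fields orthogonal to ker f, so [shape_sym_f] applies to each
    of them. [krylov_annihilator] then reaches [Z] itself at the point [p], without a smooth
    preimage of [Z] under f. *)
Lemma shape_sym_perp X Z p : vector_field X -> vector_field Z -> perp Z ->
  shape_sym p (X p) (Z p) = 0.
Proof.
move=> vX vZ pZ; have TX := vX.1 p.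
pose P : set (operator M) := [set v | tangent_space p v /\ forall j, g p (xi j p) v = 0].
have iter_perp k : vector_field (fun q => iter k (f q) (Z q)) /\
    perp (fun q => iter k (f q) (Z q)).
  elim: k => [|k [vk pk]]; first by split.
  by split; [exact: (vf vk)|exact: (perp_f vk)].
apply: (@krylov_annihilator _ _ P (f p) (shape_sym p (X p)) _ _ _ (wmf_f_rank Hw p)).
- by move=> v [Tv _]; exists v.
- move=> v [Tv _]; split=> [|j]; first exact: Tf.
  by rewrite f_sym// f_xi (metric0l Hg)// oppr0.
- move=> v [Tv pv] fv0; rewrite (ker_f Tv fv0); apply: big1 => j _.
  by rewrite eta_metric// pv scale0r.
- by split=> [|j]; [exact: tangent_space0|rewrite (metric0r Hg)].
- move=> a v w [Tv pv] [Tw pw]; split=> [|j]; first exact: tangent_spaceP.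
  have ? := tangent_spaceZ a Tv.
  by rewrite (metricDr Hg)// (metricZr Hg)// pv pw mulr0 addr0.
- by move=> a v w [Tv _] [Tw _]; exact: (endoP Hf).
- by move=> a v w [Tv _] [Tw _]; exact: shape_sym_linear.
- by split=> [|j]; [exact: vZ.1|exact: pZ].
- by move=> k; have [vk pk] := iter_perp k; exact: (shape_sym_f p vX vk pk).
Qed.

Lemma shape_sym0 X Y p : vector_field X -> vector_field Y ->
  shape_sym p (X p) (Y p) = 0.
Proof.
move=> vX vY; have [TX TY] := (vX.1 p, vY.1 p).
pose Z q := Y q - \sum_j eta j q (Y q) *: xi j q.
have vS : vector_field (fun q => \sum_j eta j q (Y q) *: xi j q).
  by apply: vector_field_sum => j; apply: vector_fieldM => //; exact: eta_smooth.
have vZ : vector_field Z by exact: vector_fieldB.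
have pZ : perp Z.
  move=> q j; have TYq := vY.1 q; rewrite /Z (metricBr Hg)//; last exact: vS.1.
  by rewrite [g q _ (\sum_j _)](metricC Hg) ?metric_xi_sum ?eta_metric ?subrr//;
    exact: vS.1.
(* In the directions of ker f each term vanishes separately: the first by [xi_cov_xi], the second
   because nabla_{xi_j} xi_i = 0. *)
have shape_xi j : shape_sym p (X p) (xi j p) = 0.
  rewrite /shape_sym; have := xi_cov_xi vX i j p; rewrite {1}/cov => ->.
  by have := cov_xi_xi j i p; rewrite /cov => ->; rewrite (metric0r Hg)// addr0.
have shape0 : shape_sym p (X p) 0 = 0.
  have T0 := tangent_space0 p; have := shape_sym_linear (-1) TX T0 T0.
  by rewrite scaler0 addr0 => ->; rewrite mulN1r addNr.
have shape_sum : shape_sym p (X p) (\sum_j eta j p (Y p) *: xi j p) = 0.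
  have [_ +] : tangent_space p (\sum_j eta j p (Y p) *: xi j p) /\
      shape_sym p (X p) (\sum_j eta j p (Y p) *: xi j p) = 0; last by [].
  elim/big_rec: _ => [|j v _ [Tv IH]]; first by split=> //; exact: tangent_space0.
  split; first exact: tangent_spaceP.
  by rewrite shape_sym_linear// IH shape_xi mulr0 addr0.
have := shape_sym_linear 1 TX (vZ.1 p) (vS.1 p).
rewrite scale1r /Z subrK => ->; rewrite mul1r shape_sum addr0.
exact: (shape_sym_perp p vX vZ pZ).
Qed.

(** Metric compatibility expands the derivative of g(Y, Z) and torsion-freeness the brackets; the
    derivatives of [Y] and [Z] along xi_i cancel and [shape_sym] remains. *)
Lemma xi_killing : is_killing g (xi i).
Proof.
split=> // Y Z vY vZ p; rewrite /lie_derivative_metric.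
have Txi := xi_tangent i p; have [TY TZ] := (vY.1 p, vZ.1 p).
rewrite (lc_metric Hlc Txi vY vZ) -!(lc_torsion_free Hlc)//.
have := shape_sym0 p vY vZ; rewrite /shape_sym /cov => e.
have Tn v W : tangent_space p v -> vector_field W -> tangent_space p (nabla p v W).
  by move=> Tv vW; exact: (conn_tangent Hn Tv vW).
have ? := Tn _ _ Txi vY; have ? := Tn _ _ Txi vZ.
have ? := Tn _ _ TY (xi_field i); have ? := Tn _ _ TZ (xi_field i).
rewrite (metricBl Hg)// (metricBr Hg)//.
by lra.
Qed.
End Killing.
End WeakNearly.

Theorem proposition2 (R : realType) (n s : nat) (n_gt0 : (0 < n)%N)
    (s_gt0 : (0 < s)%N) (M : smooth_manifold R (2 * n + s)%N)
    (f Q : M -> operator M -> operator M) (xi : 'I_s -> M -> operator M)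
    (eta : 'I_s -> M -> operator M -> R)
    (g : M -> operator M -> operator M -> R) (nabla : covariant_derivative M) :
  weak_metric_f_structure f Q xi eta g ->
  is_levi_civita g nabla ->
  weak_nearly_S f xi eta g nabla \/ weak_nearly_C f nabla ->
  (forall (i j : 'I_s) (p : M), lie_bracket (xi i) (xi j) p = 0) ->
  (forall (i j k : 'I_s) (p : M), eta k p (cov nabla (xi i) (xi j) p) = 0) ->
  flat_totally_geodesic_foliation s g nabla (ker_distribution f) /\
  ((forall X, vector_field X -> forall (i j : 'I_s) (p : M),
      g p (cov nabla X (xi i) p) (xi j p) = 0) ->
   (forall X Y, vector_field X -> vector_field Y ->
      (forall (p : M) u, ker_distribution f p u -> g p (Y p) u = 0) ->
      forall p : M, cov_endo nabla Q X Y p = 0) ->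
   forall i : 'I_s, is_killing g (xi i)).
Proof.
move=> Hw Hlc nearlySC comm_xi eta_cov_xi.
have [kappa nearly] : exists kappa : R, forall X Y, vector_field X ->
    vector_field Y -> forall p,
    cov_endo nabla f X Y p + cov_endo nabla f Y X p =
    kappa *: ((2 * g p (f p (X p)) (f p (Y p))) *: xi_bar xi p
    + eta_bar eta p (X p) *: f p (f p (Y p)) + eta_bar eta p (Y p) *: f p (f p (X p))).
  case: nearlySC => [nS|nC]; [exists 1|exists 0] => X Y vX vY p.
    by rewrite scale1r nS.
  by rewrite scale0r nC.
split; last first.
  move=> xi_cov_xi Q_parallel i.
  exact: (xi_killing Hw Hlc nearly comm_xi eta_cov_xi xi_cov_xi Q_parallel).
split; last first.
  move=> N iota Hi; split.
    exact: (leaf_totally_geodesic Hw Hlc nearly comm_xi eta_cov_xi Hi).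
  exact: (leaf_flat Hw comm_xi Hi).
have -> : ker_distribution f = field_span xi.
  by apply/funext => p; exact: (ker_f_span Hw p).
apply: commuting_fields_integrable => //; first exact: xi_field Hw.
exact: xi_independent Hw.
Qed.
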